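(* Let $\mathcal C$ be an algebraic triangulated category, viewed as a full subcategory of its sequential completion $\widehat{\mathcal C}$. Suppose that the class of Cauchy sequences in $\mathcal C$ is phantomless. Then $\widehat{\mathcal C}$ admits a unique triangulated structure such that the exact triangles are precisely the ones isomorphic to colimits of Cauchy sequences that are given by coherent morphisms of exact triangles in $\mathcal C$.
   Context: Sequential completion: a sequence $X=(X_0\to X_1\to\cdots)$ in $\mathcal C$ is Cauchy if for every $C\in\mathcal C$ the map $\operatorname{Hom}(C,X_i)\to\operatorname{Hom}(C,X_{i+1})$ is bijective for $i\gg0$; a morphism $X\to Y$ of Cauchy sequences is eventually invertible if for every $C\in\mathcal C$ the map $\operatorname{Hom}(C,X_i)\to\operatorname{Hom}(C,Y_i)$ is bijective for $i\gg0$; $\widehat{\mathcal C}$ is obtained from the category of Cauchy sequences by formally inverting the eventually invertible morphisms (equivalently $\operatorname{Hom}_{\widehat{\mathcal C}}(X,Y)=\lim_i\operatorname{colim}_j\operatorname{Hom}(X_i,Y_j)$). $\mathcal C$ embeds fully faithfully via constant sequences, and the object $X\in\widehat{\mathcal C}$ is then $\operatorname{colim}_iX_i$. The suspension of $\widehat{\mathcal C}$ is induced by $(X_i)\mapsto(\Sigma X_i)$. The class of Cauchy sequences is phantomless if $\lim^1_i\operatorname{colim}_j\operatorname{Hom}(X_i,Y_j)=0$ for all Cauchy sequences $X,Y$ in $\mathcal C$. A triangulated category is algebraic if it is triangle equivalent to the stable category $\operatorname{St}(\mathcal A)$ of a Frobenius category $\mathcal A$; fix such an equivalence for $\mathcal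 C$. A morphism between exact triangles $(X\to Y\to Z\to\Sigma X)\to(X'\to Y'\to Z'\to\Sigma X')$ in $\operatorname{St}(\mathcal A)$ is coherent if it can be lifted to a morphism between (admissible) exact sequences $(0\to\tilde X\to\tilde Y\to\tilde Z\to0)\to(0\to\tilde X'\to\tilde Y'\to\tilde Z'\to0)$ in $\mathcal A$, i.e. the canonical functor $\mathcal A\to\operatorname{St}(\mathcal A)$ maps the latter diagram to the former. The colimits in question: given a sequence $\eta_0\to\eta_1\to\eta_2\to\cdots$ of coherent morphisms of exact triangles $\eta_i\colon X_i\to Y_i\to Z_i\to\Sigma X_i$ in $\mathcal C$ that is also a sequence of morphisms $X\to Y\to Z\to\Sigma X$ of Cauchy sequences, its colimit is the sequence $\operatorname{colim}_iX_i\to\operatorname{colim}_iY_i\to\operatorname{colim}_iZ_i\to\operatorname{colim}_i\Sigma X_i$ in $\widehat{\mathcal C}$.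
   Formalization: A sequence of coherent morphisms is required to lift jointly: consecutive morphisms share the exact sequence lifting the triangle between them (up to isomorphism of triangles); with separately chosen lifts for each morphism the claim is false. *)

(* Defs.v *)
From HB Require Import structures.
From mathcomp Require Import all_boot all_order all_algebra.
From mathcomp Require Import ring_quotient.
From mathcomp Require Import boolp.

Set Implicit Arguments.
Unset Strict Implicit.
Unset Printing Implicit Defensive.

Import GRing.Theory.
Local Open Scope ring_scope.
Local Open Scope quotient_scope.

Declare Scope cat_scope.
Delimit Scope cat_scope with cat.
Local Open Scope cat_scope.

Record preadditive := Preadditive {
  ob :> Type;
  hom : ob -> ob -> zmodType;
  idm : forall X, hom X X;
  comp : forall X Y Z, hom Y Z -> hom X Y -> hom X Z;
  compA : forall X Y Z W (h : hom Z W) (g : hom Y Z) (f : hom X Y),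
    comp h (comp g f) = comp (comp h g) f;
  comp1m : forall X Y (f : hom X Y), comp (idm Y) f = f;
  compm1 : forall X Y (f : hom X Y), comp f (idm X) = f;
  compDl : forall X Y Z (g g' : hom Y Z) (f : hom X Y),
    comp (g + g') f = comp g f + comp g' f;
  compDr : forall X Y Z (g : hom Y Z) (f f' : hom X Y),
    comp g (f + f') = comp g f + comp g f'
}.

Arguments idm {p} X.
Notation "g ∘ f" := (comp g f) (at level 40, left associativity) : cat_scope.

Section CategoryNotions.
Variable C : preadditive.

Definition is_iso (X Y : C) (f : hom X Y) : Prop :=
  exists g : hom Y X, g ∘ f = idm X /\ f ∘ g = idm Y.

Definition is_zero (Z : C) : Prop :=
  forall X : C, (forall f : hom X Z, f = 0) /\ (forall f : hom Z X, f = 0).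

Definition is_biproduct (X Y B : C) (i1 : hom X B) (i2 : hom Y B)
    (p1 : hom B X) (p2 : hom B Y) : Prop :=
  [/\ p1 ∘ i1 = idm X, p2 ∘ i2 = idm Y, p1 ∘ i2 = 0, p2 ∘ i1 = 0
    & i1 ∘ p1 + i2 ∘ p2 = idm B].

Definition additive_category : Prop :=
  (exists Z : C, is_zero Z) /\
  (forall X Y : C, exists (B : C) (i1 : hom X B) (i2 : hom Y B)
     (p1 : hom B X) (p2 : hom B Y), is_biproduct i1 i2 p1 p2).

Lemma comp0m (X Y Z : C) (f : hom X Y) : (0 : hom Y Z) ∘ f = 0.
Proof. by apply: (addrI (0 ∘ f)); rewrite -compDl !addr0. Qed.

Lemma compm0 (X Y Z : C) (g : hom Y Z) : g ∘ (0 : hom X Y) = 0.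
Proof. by apply: (addrI (g ∘ 0)); rewrite -compDr !addr0. Qed.

Lemma compNl (X Y Z : C) (g : hom Y Z) (f : hom X Y) : (- g) ∘ f = - (g ∘ f).
Proof. by apply: (addrI (g ∘ f)); rewrite -compDl !subrr comp0m. Qed.

Lemma compNr (X Y Z : C) (g : hom Y Z) (f : hom X Y) : g ∘ (- f) = - (g ∘ f).
Proof. by apply: (addrI (g ∘ f)); rewrite -compDr !subrr compm0. Qed.

Lemma compBl (X Y Z : C) (g g' : hom Y Z) (f : hom X Y) :
  (g - g') ∘ f = g ∘ f - g' ∘ f.
Proof. by rewrite compDl compNl. Qed.

Lemma compBr (X Y Z : C) (g : hom Y Z) (f f' : hom X Y) :
  g ∘ (f - f') = g ∘ f - g ∘ f'.
Proof. by rewrite compDr compNr. Qed.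

End CategoryNotions.

Record additive_functor (C D : preadditive) := AdditiveFunctor {
  fob :> C -> D;
  fmap : forall X Y, hom X Y -> hom (fob X) (fob Y);
  fmap1 : forall X, fmap (idm X) = idm (fob X);
  fmapM : forall X Y Z (g : hom Y Z) (f : hom X Y),
    fmap (g ∘ f) = fmap g ∘ fmap f;
  fmapD : forall X Y (f g : hom X Y), fmap (f + g) = fmap f + fmap g
}.
Arguments fmap {C D} a {X Y} f.

Definition is_equivalence (C D : preadditive) (F : additive_functor C D) : Prop :=
  (forall X Y : C, bijective (@fmap _ _ F X Y)) /\
  (forall Y : D, exists (X : C) (f : hom (F X) Y), is_iso f).

Record suspended := Suspended {
  susp_cat :> preadditive;
  susp : additive_functor susp_cat susp_cat
}.

Record triangle (C : suspended) := Triangle {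
  tri1 : C; tri2 : C; tri3 : C;
  tri_f : hom tri1 tri2;
  tri_g : hom tri2 tri3;
  tri_h : hom tri3 (susp C tri1)
}.
Arguments Triangle {C tri1 tri2 tri3} tri_f tri_g tri_h.

Record tri_mor (C : suspended) (T T' : triangle C) := TriMor {
  mor1 : hom (tri1 T) (tri1 T');
  mor2 : hom (tri2 T) (tri2 T');
  mor3 : hom (tri3 T) (tri3 T');
  mor_sqf : mor2 ∘ tri_f T = tri_f T' ∘ mor1;
  mor_sqg : mor3 ∘ tri_g T = tri_g T' ∘ mor2;
  mor_sqh : fmap (susp C) mor1 ∘ tri_h T = tri_h T' ∘ mor3
}.

Definition tri_is_iso (C : suspended) (T T' : triangle C) (m : tri_mor T T') :=
  [/\ is_iso (mor1 m), is_iso (mor2 m) & is_iso (mor3 m)].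

Definition tri_isomorphic (C : suspended) (T T' : triangle C) : Prop :=
  exists m : tri_mor T T', tri_is_iso m.

Record triangulated (C : suspended) (E : triangle C -> Prop) : Prop := Triangulated {
  triang_additive : additive_category C;
  triang_susp : is_equivalence (susp C);
  triang_iso : forall T T' : triangle C, tri_isomorphic T T' -> E T -> E T';
  triang_id : forall X Z : C, is_zero Z ->
    E (Triangle (idm X) (0 : hom X Z) 0);
  triang_cone : forall (X Y : C) (f : hom X Y),
    exists (Z : C) (g : hom Y Z) (h : hom Z (susp C X)), E (Triangle f g h);
  triang_rot : forall (X Y Z : C) (f : hom X Y) (g : hom Y Z) (h : hom Z (susp C X)),
    E (Triangle f g h) <-> E (Triangle g h (- fmap (susp C) f));
  triang_fill : forall (T T' : triangle C), E T -> E T' ->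
    forall (a : hom (tri1 T) (tri1 T')) (b : hom (tri2 T) (tri2 T')),
    b ∘ tri_f T = tri_f T' ∘ a ->
    exists m : tri_mor T T', mor1 m = a /\ mor2 m = b;
  triang_oct : forall (X Y Z X' Y' Z' : C) (u : hom X Y) (v : hom Y Z)
    (i : hom Y Z') (i' : hom Z' (susp C X))
    (j : hom Z X') (j' : hom X' (susp C Y))
    (k : hom Z Y') (k' : hom Y' (susp C X)),
    E (Triangle u i i') -> E (Triangle v j j') -> E (Triangle (v ∘ u) k k') ->
    exists (f : hom Z' Y') (g : hom Y' X'),
      [/\ E (Triangle f g (fmap (susp C) i ∘ j')),
          f ∘ i = k ∘ v, k' ∘ f = i', g ∘ k = j
        & j' ∘ g = fmap (susp C) u ∘ k']
}.

Record triangulated_category := TriangulatedCategory {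
  tri_cat :> suspended;
  exact_tri : triangle tri_cat -> Prop;
  tri_catP : triangulated exact_tri
}.

Section KernelsPushouts.
Variable C : preadditive.

Definition is_kernel (X Y Z : C) (u : hom X Y) (v : hom Y Z) : Prop :=
  v ∘ u = 0 /\
  (forall (W : C) (f : hom W Y), v ∘ f = 0 -> exists! g : hom W X, u ∘ g = f).

Definition is_cokernel (X Y Z : C) (u : hom X Y) (v : hom Y Z) : Prop :=
  v ∘ u = 0 /\
  (forall (W : C) (f : hom Y W), f ∘ u = 0 -> exists! g : hom Z W, g ∘ v = f).

Definition is_pushout (X Y X' Y' : C) (u : hom X Y) (f : hom X X')
    (u' : hom X' Y') (f' : hom Y Y') : Prop :=
  f' ∘ u = u' ∘ f /\
  (forall (W : C) (a : hom Y W) (b : hom X' W), a ∘ u = b ∘ f ->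
     exists! c : hom Y' W, c ∘ f' = a /\ c ∘ u' = b).

Definition is_pullback (Y Z Y' Z' : C) (v : hom Y Z) (f : hom Z' Z)
    (v' : hom Y' Z') (f' : hom Y' Y) : Prop :=
  v ∘ f' = f ∘ v' /\
  (forall (W : C) (a : hom W Y) (b : hom W Z'), v ∘ a = f ∘ b ->
     exists! c : hom W Y', f' ∘ c = a /\ v' ∘ c = b).

End KernelsPushouts.

Section Admissible.
Variables (C : preadditive)
  (conf : forall X Y Z : C, hom X Y -> hom Y Z -> Prop).

Definition adm_mono (X Y : C) (u : hom X Y) : Prop :=
  exists (Z : C) (v : hom Y Z), conf u v.

Definition adm_epi (Y Z : C) (v : hom Y Z) : Prop :=
  exists (X : C) (u : hom X Y), conf u v.

Definition injective_ob (I : C) : Prop :=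
  forall (X Y : C) (u : hom X Y), adm_mono u ->
  forall f : hom X I, exists g : hom Y I, g ∘ u = f.

Definition projective_ob (P : C) : Prop :=
  forall (Y Z : C) (v : hom Y Z), adm_epi v ->
  forall f : hom P Z, exists g : hom P Y, v ∘ g = f.

End Admissible.

(* [conf u v]: the pair 0 -> X -> Y -> Z -> 0 is an admissible exact sequence.
   The axioms are Quillen's, in Keller's and Buehler's form. *)
Record exact_category := ExactCategory {
  exact_cat :> preadditive;
  exact_additive : additive_category exact_cat;
  conf : forall X Y Z : exact_cat, hom X Y -> hom Y Z -> Prop;
  conf_ker : forall X Y Z (u : hom X Y) (v : hom Y Z), conf u v ->
    is_kernel u v /\ is_cokernel u v;
  conf_iso : forall X Y Z X' Y' Z' (u : hom X Y) (v : hom Y Z)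
    (u' : hom X' Y') (v' : hom Y' Z')
    (a : hom X X') (b : hom Y Y') (c : hom Z Z'),
    is_iso a -> is_iso b -> is_iso c -> b ∘ u = u' ∘ a -> c ∘ v = v' ∘ b ->
    conf u v -> conf u' v';
  adm_mono1 : forall X, adm_mono conf (idm X);
  adm_epi1 : forall X, adm_epi conf (idm X);
  adm_monoM : forall X Y Z (u : hom X Y) (v : hom Y Z),
    adm_mono conf u -> adm_mono conf v -> adm_mono conf (v ∘ u);
  adm_epiM : forall X Y Z (u : hom X Y) (v : hom Y Z),
    adm_epi conf u -> adm_epi conf v -> adm_epi conf (v ∘ u);
  adm_mono_pushout : forall X Y X' (u : hom X Y) (f : hom X X'),
    adm_mono conf u -> exists Y' (u' : hom X' Y') (f' : hom Y Y'),
      is_pushout u f u' f' /\ adm_mono conf u';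
  adm_epi_pullback : forall Y Z Z' (v : hom Y Z) (f : hom Z' Z),
    adm_epi conf v -> exists Y' (v' : hom Y' Z') (f' : hom Y' Y),
      is_pullback v f v' f' /\ adm_epi conf v'
}.
Arguments conf {e X Y Z}.

Definition injective (A : exact_category) : A -> Prop := injective_ob (@conf A).
Definition projective (A : exact_category) : A -> Prop := projective_ob (@conf A).

Record frobenius_category := FrobeniusCategory {
  frob_cat :> exact_category;
  enough_injectives : forall X : frob_cat,
    exists (I Z : frob_cat) (u : hom X I) (v : hom I Z), injective I /\ conf u v;
  enough_projectives : forall X : frob_cat,
    exists (P Z : frob_cat) (u : hom Z P) (v : hom P X), projective P /\ conf u v;
  proj_inj : forall X : frob_cat, projective X <-> injective X
}.

Record ses (A : exact_category) := Ses {
  ses1 : A; ses2 : A; ses3 : A;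
  ses_u : hom ses1 ses2;
  ses_v : hom ses2 ses3;
  sesP : conf ses_u ses_v
}.

Record ses_mor (A : exact_category) (E E' : ses A) := SesMor {
  ses_mor1 : hom (ses1 E) (ses1 E');
  ses_mor2 : hom (ses2 E) (ses2 E');
  ses_mor3 : hom (ses3 E) (ses3 E');
  ses_squ : ses_mor2 ∘ ses_u E = ses_u E' ∘ ses_mor1;
  ses_sqv : ses_mor3 ∘ ses_v E = ses_v E' ∘ ses_mor2
}.

Section Stable.
Variable A : frobenius_category.

Definition factors_projective (X Y : A) (f : hom X Y) : Prop :=
  exists (P : A) (a : hom X P) (b : hom P Y), projective P /\ f = b ∘ a.

Definition null_hom (X Y : A) : pred (hom X Y) := fun f => `[< factors_projective f >].

Lemma projective_biproduct (P Q B : A) (i1 : hom P B) (i2 : hom Q B)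
    (p1 : hom B P) (p2 : hom B Q) :
  is_biproduct i1 i2 p1 p2 -> projective P -> projective Q -> projective B.
Proof.
move=> [_ _ _ _ e] hP hQ Y Z v hv f.
have [g1 e1] := hP _ _ _ hv (f ∘ i1); have [g2 e2] := hQ _ _ _ hv (f ∘ i2).
exists (g1 ∘ p1 + g2 ∘ p2).
by rewrite compDr !compA e1 e2 -!compA -compDr e compm1.
Qed.

Lemma null_hom_zmod_closed (X Y : A) : zmod_closed (@null_hom X Y).
Proof.
split=> [|f g /asboolP[P [a [b [hP ->]]]] /asboolP[Q [a' [b' [hQ ->]]]]].
  have [P [Z [u [v [hP _]]]]] := enough_projectives X.
  by apply/asboolP; exists P, 0, 0; rewrite comp0m.
have [_ /(_ P Q)[B [i1 [i2 [p1 [p2 hB]]]]]] := exact_additive A.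
apply/asboolP; exists B, (i1 ∘ a + i2 ∘ a'), (b ∘ p1 - b' ∘ p2).
split; first exact: projective_biproduct hB hP hQ.
have [e11 e22 e12 e21 _] := hB.
rewrite compBl !compDr -!compA (compA p1) (compA p1) (compA p2) (compA p2).
by rewrite e11 e22 e12 e21 !comp0m !comp1m !compm0 addr0 add0r.
Qed.

HB.instance Definition _ (X Y : A) :=
  GRing.isZmodClosed.Build (hom X Y) (@null_hom X Y) (@null_hom_zmod_closed X Y).

Definition null_ideal (X Y : A) : zmodClosed (hom X Y) :=
  GRing.ZmodClosed.clone _ (@null_hom X Y) _.

Definition stable_hom (X Y : A) : zmodType := Quotient.quot (null_ideal X Y).

Definition stable_class (X Y : A) (f : hom X Y) : stable_hom X Y := \pi f.

Lemma stable_eqP (X Y : A) (f g : hom X Y) :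
  stable_class f = stable_class g <-> factors_projective (f - g).
Proof.
split=> [/eqP|] h; last by apply/eqP; rewrite -Quotient.idealrBE; apply/asboolP.
by apply/asboolP; move: h; rewrite -Quotient.idealrBE.
Qed.

Lemma stable_classK (X Y : A) (f : stable_hom X Y) : stable_class (repr f) = f.
Proof. exact: reprK. Qed.

Lemma stable_classD (X Y : A) (f g : hom X Y) :
  stable_class (f + g) = stable_class f + stable_class g.
Proof. by rewrite /stable_class [LHS]raddfD. Qed.

Lemma factors_projective_compl (X Y Z : A) (g : hom Y Z) (f : hom X Y) :
  factors_projective f -> factors_projective (g ∘ f).
Proof. by case=> P [a [b [hP ->]]]; exists P, a, (g ∘ b); rewrite compA. Qed.

Lemma factors_projective_compr (X Y Z : A) (g : hom Y Z) (f : hom X Y) :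
  factors_projective g -> factors_projective (g ∘ f).
Proof. by case=> P [a [b [hP ->]]]; exists P, (a ∘ f), b; rewrite compA. Qed.

Definition stable_comp (X Y Z : A) (g : stable_hom Y Z) (f : stable_hom X Y) :
  stable_hom X Z := stable_class (repr g ∘ repr f).

Lemma stable_compE (X Y Z : A) (g : hom Y Z) (f : hom X Y) :
  stable_comp (stable_class g) (stable_class f) = stable_class (g ∘ f).
Proof.
rewrite /stable_comp; set g' := repr _; set f' := repr _.
have eg : stable_class g' = stable_class g by rewrite stable_classK.
have ef : stable_class f' = stable_class f by rewrite stable_classK.
transitivity (stable_class (g ∘ f')); apply/stable_eqP.
  by rewrite -compBl; apply: factors_projective_compr; apply/stable_eqP.
by rewrite -compBr; apply: factors_projective_compl; apply/stable_eqP.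
Qed.

Lemma stable_ind (X Y : A) (P : stable_hom X Y -> Prop) :
  (forall f, P (stable_class f)) -> forall f, P f.
Proof. by move=> h f; rewrite -(stable_classK f). Qed.

Definition stable_preadditive : preadditive.
Proof.
refine (@Preadditive A stable_hom (fun X => stable_class (idm X)) stable_comp
  _ _ _ _ _).
- move=> X Y Z W; elim/stable_ind=> h; elim/stable_ind=> g; elim/stable_ind=> f.
  by rewrite !stable_compE compA.
- by move=> X Y; elim/stable_ind=> f; rewrite stable_compE comp1m.
- by move=> X Y; elim/stable_ind=> f; rewrite stable_compE compm1.
- move=> X Y Z; elim/stable_ind=> g; elim/stable_ind=> g'; elim/stable_ind=> f.
  by rewrite -stable_classD !stable_compE compDl stable_classD.
- move=> X Y Z; elim/stable_ind=> g; elim/stable_ind=> f; elim/stable_ind=> f'.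
  by rewrite -stable_classD !stable_compE compDr stable_classD.
Defined.

(* An admissible exact sequence 0 -> X -> I -> ΣX -> 0 with I injective. *)
Record hull (X : A) := Hull {
  hull_ob : A;
  hull_susp : A;
  hull_u : hom X hull_ob;
  hull_v : hom hull_ob hull_susp;
  hull_inj : injective hull_ob;
  hull_conf : conf hull_u hull_v
}.

Lemma hull_exists (X : A) : exists h : hull X, True.
Proof.
by have [I [Z [u [v [hI hc]]]]] := enough_injectives X; exists (Hull hI hc).
Qed.

Definition the_hull (X : A) : hull X := sval (cid (hull_exists X)).

Definition hull_ses (X : A) : ses A := Ses (hull_conf (the_hull X)).

(* [(a, b)] extends [f] to a morphism from [E] to [0 -> Y -> I -> ΣY -> 0]. *)
Definition hull_ext (E : ses A) (Y : A) (f : hom (ses1 E) Y)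
    (ab : hom (ses2 E) (hull_ob (the_hull Y)) *
          hom (ses3 E) (hull_susp (the_hull Y))) : Prop :=
  ab.1 ∘ ses_u E = hull_u (the_hull Y) ∘ f /\
  ab.2 ∘ ses_v E = hull_v (the_hull Y) ∘ ab.1.

Lemma hull_ext_exists (E : ses A) (Y : A) (f : hom (ses1 E) Y) :
  exists ab, hull_ext f ab.
Proof.
have mE : adm_mono (@conf A) (ses_u E).
  by exists (ses3 E), (ses_v E); exact: sesP.
have [a ea] := hull_inj (h := the_hull Y) mE (hull_u (the_hull Y) ∘ f).
have [[hv _] _] := conf_ker (hull_conf (the_hull Y)).
have [_ [_ hE]] := conf_ker (sesP E).
have [|b [eb _]] := hE _ (hull_v (the_hull Y) ∘ a).
  by rewrite -compA ea compA hv comp0m.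
by exists (a, b).
Qed.

Lemma hull_ext_unique (E : ses A) (Y : A) (f f' : hom (ses1 E) Y) ab ab' :
  hull_ext f ab -> hull_ext f' ab' ->
  stable_class f = stable_class f' -> stable_class ab.2 = stable_class ab'.2.
Proof.
case: ab ab' => [a b] [a' b'] [/= ea eb] [/= ea' eb'].
move=> /stable_eqP[P [p [q [hP ef]]]].
have mE : adm_mono (@conf A) (ses_u E).
  by exists (ses3 E), (ses_v E); exact: sesP.
have hPi : injective P by apply/proj_inj.
have [r er] := hPi _ _ _ mE p.
have [[hv _] _] := conf_ker (hull_conf (the_hull Y)).
have [_ [vu hE]] := conf_ker (sesP E).
pose d := a - a' - hull_u (the_hull Y) ∘ q ∘ r.
have du : d ∘ ses_u E = 0.
  by rewrite /d !compBl ea ea' -compBr ef -!compA er subrr.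
have [s [es _]] := hE _ d du.
apply/stable_eqP; exists (hull_ob (the_hull Y)), s, (hull_v (the_hull Y)).
split; first by apply/proj_inj/hull_inj.
have [|c [_ Uc]] := hE _ ((b - b') ∘ ses_v E).
  by rewrite -compA vu compm0.
rewrite -(Uc (b - b')) //; apply: Uc.
by rewrite -compA es /d !compBr compBl !compA hv !comp0m subr0 eb eb'.
Qed.

Definition ext_class (E : ses A) (Y : A) (f : hom (ses1 E) Y) :
    stable_hom (ses3 E) (hull_susp (the_hull Y)) :=
  stable_class (sval (cid (hull_ext_exists f))).2.

Lemma ext_classE (E : ses A) (Y : A) (f : hom (ses1 E) Y) ab :
  hull_ext f ab -> ext_class f = stable_class ab.2.
Proof. by rewrite /ext_class; case: cid => ab' /= h' h; apply: hull_ext_unique h' h _. Qed.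

Lemma ext_class_eq (E : ses A) (Y : A) (f f' : hom (ses1 E) Y) :
  stable_class f = stable_class f' -> ext_class f = ext_class f'.
Proof.
by rewrite /ext_class; do 2![case: cid => ? ?] => /=; apply: hull_ext_unique.
Qed.

(* Independent of the representative by [ext_class_eq]. *)
Definition stable_susp_map (X Y : A) (f : stable_hom X Y) :
    stable_hom (hull_susp (the_hull X)) (hull_susp (the_hull Y)) :=
  ext_class (E := hull_ses X) (repr f).

Lemma stable_susp_mapE (X Y : A) (f : hom X Y) ab :
  hull_ext (E := hull_ses X) f ab ->
  stable_susp_map (stable_class f) = stable_class ab.2.
Proof.
move=> h; rewrite -(ext_classE h).
exact: (ext_class_eq (E := hull_ses X) (stable_classK (stable_class f))).
Qed.

Definition stable_susp : additive_functor stable_preadditive stable_preadditive.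
Proof.
refine (@AdditiveFunctor stable_preadditive stable_preadditive
  (fun X => hull_susp (the_hull X)) stable_susp_map _ _ _).
- by move=> X; apply: (stable_susp_mapE (ab := (idm _, idm _))); split;
    rewrite /= comp1m compm1.
- move=> X Y Z; elim/stable_ind=> g; elim/stable_ind=> f.
  have [[a b] hf] := hull_ext_exists (E := hull_ses X) f.
  have [[a' b'] hg] := hull_ext_exists (E := hull_ses Y) g.
  rewrite [_ ∘ _]stable_compE (stable_susp_mapE hf) (stable_susp_mapE hg) /=.
  rewrite stable_compE; apply: (stable_susp_mapE (ab := (a' ∘ a, b' ∘ b))).
  case: hf hg => /= e1 e2 [/= e3 e4]; split => /=.
    by rewrite -compA e1 compA e3 compA.
  by rewrite -compA e2 compA e4 compA.
- move=> X Y; elim/stable_ind=> f; elim/stable_ind=> g.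
  have [[a b] hf] := hull_ext_exists (E := hull_ses X) f.
  have [[a' b'] hg] := hull_ext_exists (E := hull_ses X) g.
  rewrite -stable_classD (stable_susp_mapE hf) (stable_susp_mapE hg) /=.
  rewrite -stable_classD; apply: (stable_susp_mapE (ab := (a + a', b + b'))).
  by case: hf hg => /= e1 e2 [/= e3 e4]; split; rewrite /= compDl compDr ?e1 ?e2 ?e3 ?e4.
Defined.

Definition St : suspended := Suspended stable_susp.

(* The standard triangle of an exact sequence; its third map is induced by a
   morphism of exact sequences to the hull sequence extending the identity. *)
Definition ses_triangle (E : ses A) : triangle St :=
  @Triangle St (ses1 E) (ses2 E) (ses3 E)
    (stable_class (ses_u E)) (stable_class (ses_v E)) (ext_class (idm (ses1 E))).

Definition ses_tri_mor (E E' : ses A) (s : ses_mor E E') :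
  tri_mor (ses_triangle E) (ses_triangle E').
Proof.
refine (@TriMor St (ses_triangle E) (ses_triangle E')
  (stable_class (ses_mor1 s)) (stable_class (ses_mor2 s))
  (stable_class (ses_mor3 s)) _ _ _).
- by rewrite /= [LHS]stable_compE [RHS]stable_compE ses_squ.
- by rewrite /= [LHS]stable_compE [RHS]stable_compE ses_sqv.
have [[a b] h] := hull_ext_exists (E := E) (idm (ses1 E)).
have [[a' b'] h'] := hull_ext_exists (E := E') (idm (ses1 E')).
have [[c d] k] := hull_ext_exists (E := hull_ses (ses1 E)) (ses_mor1 s).
rewrite /= (ext_classE h) (ext_classE h') (stable_susp_mapE k) /=.
rewrite [LHS]stable_compE [RHS]stable_compE.
have l : hull_ext (E := E) (ses_mor1 s) (c ∘ a, d ∘ b).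
  case: h k => /= e1 e2 [/= e3 e4]; split => /=.
    by rewrite -compA e1 compm1 e3.
  by rewrite -compA e2 compA e4 compA.
have l' : hull_ext (E := E) (ses_mor1 s) (a' ∘ ses_mor2 s, b' ∘ ses_mor3 s).
  case: h' => /= e1 e2; split => /=.
    by rewrite -compA ses_squ compA e1 compm1.
  by rewrite -compA ses_sqv compA e2 compA.
exact: (hull_ext_unique l l').
Defined.

Definition stable_exact (T : triangle St) : Prop :=
  exists E : ses A, tri_isomorphic T (ses_triangle E).

End Stable.

Record triangle_equivalence (C : triangulated_category) (A : frobenius_category) :=
  TriangleEquivalence {
  te_fun :> additive_functor C (St A);
  te_equiv : is_equivalence te_fun;
  te_susp : forall X : C, hom (te_fun (susp C X)) (susp (St A) (te_fun X));
  te_susp_iso : forall X : C, is_iso (te_susp X);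
  te_susp_nat : forall (X Y : C) (f : hom X Y),
    te_susp Y ∘ fmap te_fun (fmap (susp C) f)
    = fmap (susp (St A)) (fmap te_fun f) ∘ te_susp X;
  te_exact : forall (X Y Z : C) (f : hom X Y) (g : hom Y Z) (h : hom Z (susp C X)),
    exact_tri (Triangle f g h) ->
    stable_exact (@Triangle (St A) (te_fun X) (te_fun Y) (te_fun Z)
      (fmap te_fun f) (fmap te_fun g) (te_susp X ∘ fmap te_fun h))
}.

Section Coherence.
Variables (C : triangulated_category) (A : frobenius_category).
Variable F : triangle_equivalence C A.

Definition te_triangle (T : triangle C) : triangle (St A) :=
  @Triangle (St A) (F (tri1 T)) (F (tri2 T)) (F (tri3 T))
    (fmap F (tri_f T)) (fmap F (tri_g T)) (te_susp F (tri1 T) ∘ fmap F (tri_h T)).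

Definition te_tri_mor (T T' : triangle C) (m : tri_mor T T') :
  tri_mor (te_triangle T) (te_triangle T').
Proof.
refine (@TriMor (St A) (te_triangle T) (te_triangle T')
  (fmap F (mor1 m)) (fmap F (mor2 m)) (fmap F (mor3 m)) _ _ _).
- by rewrite -(fmapM F) mor_sqf (fmapM F).
- by rewrite -(fmapM F) mor_sqg (fmapM F).
rewrite [LHS]compA -te_susp_nat -[LHS]compA -(fmapM F) mor_sqh (fmapM F).
exact: compA.
Defined.

End Coherence.

Section CoherentMorphisms.
Variable A : frobenius_category.

(* [s] is a lift to [A] of the morphism [m] of triangles in [St A], with respect
   to identifications of its source and target with the standard triangles. *)
Definition is_lift (T T' : triangle (St A)) (m : tri_mor T T') (E E' : ses A)
    (i : tri_mor T (ses_triangle E)) (i' : tri_mor T' (ses_triangle E'))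
    (s : ses_mor E E') : Prop :=
  [/\ mor1 (ses_tri_mor s) ∘ mor1 i = mor1 i' ∘ mor1 m,
      mor2 (ses_tri_mor s) ∘ mor2 i = mor2 i' ∘ mor2 m
    & mor3 (ses_tri_mor s) ∘ mor3 i = mor3 i' ∘ mor3 m].

Definition coherent (T T' : triangle (St A)) (m : tri_mor T T') : Prop :=
  exists (E E' : ses A) (i : tri_mor T (ses_triangle E))
    (i' : tri_mor T' (ses_triangle E')) (s : ses_mor E E'),
    [/\ tri_is_iso i, tri_is_iso i' & is_lift m i i' s].

(* The lifts of consecutive morphisms share the lift of the triangle in between.
   This does not follow from the coherence of each [m n]: two exact sequences
   lifting the same triangle are related by an isomorphism of triangles that need
   not be coherent, so separate lifts do not glue to a sequence in [A]. *)
Definition coherent_sequence (T : nat -> triangle (St A))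
    (m : forall n, tri_mor (T n) (T n.+1)) : Prop :=
  exists (E : nat -> ses A) (i : forall n, tri_mor (T n) (ses_triangle (E n)))
    (s : forall n, ses_mor (E n) (E n.+1)),
    (forall n, tri_is_iso (i n)) /\ (forall n, is_lift (m n) (i n) (i n.+1) (s n)).

Lemma coherent_sequence_coherent (T : nat -> triangle (St A)) m :
  coherent_sequence m -> forall n, coherent (m n : tri_mor (T n) (T n.+1)).
Proof.
move=> [E [i [s [hi hs]]]] n.
by exists (E n), (E n.+1), (i n), (i n.+1), (s n).
Qed.

End CoherentMorphisms.

Section SeqColim.
Variables (G : nat -> zmodType) (t : forall n, {additive G n -> G n.+1}).

Definition colim_step (x : {n & G n}) : {n & G n} :=
  Tagged G (t (tag x) (tagged x)).

Definition colim_rel (x y : {n & G n}) : bool :=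
  `[< exists k l, iter k colim_step x = iter l colim_step y >].

Lemma colim_rel_equiv : equiv_class_of colim_rel.
Proof.
split=> [x | x y | y x z].
- by apply/asboolP; exists 0, 0.
- by apply/asboolP/asboolP=> -[k [l e]]; exists l, k.
move=> /asboolP[k [l e]] /asboolP[k' [l' e']]; apply/asboolP.
exists (k' + k)%N, (l + l')%N; rewrite iterD e -iterD addnC iterD e'.
by rewrite -iterD.
Qed.

Canonical colim_equiv := EquivRelPack colim_rel_equiv.
Canonical colim_encModRel := defaultEncModRel colim_rel.

Definition seqcolim := {eq_quot colim_rel}.
HB.instance Definition _ : EqQuotient {n & G n} colim_rel seqcolim :=
  EqQuotient.on seqcolim.
HB.instance Definition _ := Choice.on seqcolim.

Definition colim_in n (a : G n) : seqcolim := \pi_seqcolim (Tagged G a).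

Fixpoint colim_tr n k : G n -> G (k + n) :=
  if k is k'.+1 then fun a => t (k' + n) (colim_tr k' a) else fun a => a.

Lemma colim_in_step n (a : G n) : colim_in (t n a) = colim_in a.
Proof. by apply/eqmodP/asboolP; exists 0, 1. Qed.

Lemma colim_in_tr n k (a : G n) : colim_in (colim_tr k a) = colim_in a.
Proof. by elim: k => //= k <-; rewrite colim_in_step. Qed.

Lemma colim_trD n k (a b : G n) : colim_tr k (a + b) = colim_tr k a + colim_tr k b.
Proof. by elim: k => //= k ->; rewrite raddfD. Qed.

Lemma iter_colim_step k n (a : G n) :
  iter k colim_step (Tagged G a) = Tagged G (colim_tr k a).
Proof. by elim: k => //= k ->. Qed.

Lemma colim_in_eqP n (a b : G n) :
  colim_in a = colim_in b <-> exists k, colim_tr k a = colim_tr k b.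
Proof.
split=> [/eqmodP/asboolP[k [l]] | [k e]]; last first.
  by rewrite -(colim_in_tr k a) e colim_in_tr.
rewrite !iter_colim_step => e.
have ekl : k = l by have := congr1 tag e => /= /addIn.
by exists k; move: e; rewrite -{l}ekl => /eqP; rewrite eq_Tagged => /eqP.
Qed.

Lemma colim_ind1 (x : seqcolim) : exists n (a : G n), x = colim_in a.
Proof.
by exists (tag (repr x)), (tagged (repr x)); rewrite /colim_in taggedK reprK.
Qed.

Lemma colim_raise n (a : G n) m : (n <= m)%N -> exists b : G m, colim_in a = colim_in b.
Proof.
move=> /subnK <-; exists (colim_tr (m - n) a); by rewrite colim_in_tr.
Qed.

Lemma colim_ind2 (x y : seqcolim) :
  exists n (a b : G n), x = colim_in a /\ y = colim_in b.
Proof.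
have [n [a ->]] := colim_ind1 x; have [m [b ->]] := colim_ind1 y.
have [a' ->] := colim_raise a (leq_maxl n m).
by have [b' ->] := colim_raise b (leq_maxr n m); exists (maxn n m), a', b'.
Qed.

Lemma colim_ind3 (x y z : seqcolim) :
  exists n (a b c : G n), [/\ x = colim_in a, y = colim_in b & z = colim_in c].
Proof.
have [n [a [b [-> ->]]]] := colim_ind2 x y; have [m [c ->]] := colim_ind1 z.
have [a' ->] := colim_raise a (leq_maxl n m).
have [b' ->] := colim_raise b (leq_maxl n m).
by have [c' ->] := colim_raise c (leq_maxr n m); exists (maxn n m), a', b', c'.
Qed.

(* Functions out of the colimit, from a compatible family. *)
Definition colim_desc (T : Type) (h : forall n, G n -> T) (x : seqcolim) : T :=
  h (tag (repr x)) (tagged (repr x)).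

Lemma colim_descE (T : Type) (h : forall n, G n -> T) :
  (forall n (a : G n), h n.+1 (t n a) = h n a) ->
  forall n (a : G n), colim_desc h (colim_in a) = h n a.
Proof.
move=> ht n a; rewrite /colim_desc.
have hs k (x : {n & G n}) :
    h (tag (iter k colim_step x)) (tagged (iter k colim_step x)) = h (tag x) (tagged x).
  by elim: k => //= k <-; rewrite ht.
have /eqmodP/asboolP[k [l e]] : \pi_seqcolim (repr (colim_in a)) = \pi_seqcolim (Tagged G a).
  by rewrite reprK.
by rewrite -(hs k) e hs.
Qed.

Lemma colim_in_add n m (a b : G n) (a' b' : G m) :
  colim_in a = colim_in a' -> colim_in b = colim_in b' ->
  colim_in (a + b) = colim_in (a' + b').
Proof.
have same p (c d c' d' : G p) : colim_in c = colim_in c' -> colim_in d = colim_in d' ->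
    colim_in (c + d) = colim_in (c' + d').
  move=> /colim_in_eqP[k ek] /colim_in_eqP[l el].
  rewrite -(colim_in_tr k (c + d)) -(colim_in_tr k (c' + d')) !colim_trD ek.
  have /colim_in_eqP[r er] : colim_in (colim_tr k d) = colim_in (colim_tr k d').
    by rewrite !colim_in_tr; apply/colim_in_eqP; exists l.
  by rewrite -(colim_in_tr r) -[RHS](colim_in_tr r) !colim_trD er.
have up p q (le : (p <= q)%N) (c d : G p) : exists c' d' : G q,
    [/\ colim_in c = colim_in c', colim_in d = colim_in d'
      & colim_in (c + d) = colim_in (c' + d')].
  move/subnK: le => <-; exists (colim_tr (q - p) c), (colim_tr (q - p) d).
  by rewrite -colim_trD !colim_in_tr.
have [c [d [-> -> ->]]] := up _ _ (leq_maxl n m) a b.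
by have [c' [d' [-> -> ->]]] := up _ _ (leq_maxr n m) a' b'; apply: same.
Qed.

Definition colim_add (x y : seqcolim) : seqcolim :=
  let: existT n a := repr x in
  let: existT m b := repr y in
  colim_in (colim_tr m a + ecast k (G k) (addnC n m) (colim_tr n b)).

Definition colim_opp (x : seqcolim) : seqcolim :=
  let: existT n a := repr x in colim_in (- a).

Lemma colim_addE n (a b : G n) :
  colim_add (colim_in a) (colim_in b) = colim_in (a + b).
Proof.
rewrite /colim_add; case ex : (repr _) => [k a']; case ey : (repr _) => [l b'].
have ea : colim_in a' = colim_in a by rewrite -[RHS]reprK ex.
have eb : colim_in b' = colim_in b by rewrite -[RHS]reprK ey.
by apply: colim_in_add; last case: _ / addnC; rewrite colim_in_tr.
Qed.

Lemma colim_in0 n m : colim_in (0 : G n) = colim_in (0 : G m).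
Proof.
have z p q : colim_in (0 : G (p + q)) = colim_in (0 : G q).
  rewrite -(colim_in_tr p (0 : G q)); congr colim_in.
  by elim: p => //= p <-; rewrite raddf0.
by rewrite -(z m n) -(z n m) addnC.
Qed.

Lemma colim_addA : associative colim_add.
Proof.
move=> x y z; have [n [a [b [c [-> -> ->]]]]] := colim_ind3 x y z.
by rewrite !colim_addE addrA.
Qed.

Lemma colim_addC : commutative colim_add.
Proof.
by move=> x y; have [n [a [b [-> ->]]]] := colim_ind2 x y; rewrite !colim_addE addrC.
Qed.

Lemma colim_add0 : left_id (colim_in (0 : G 0)) colim_add.
Proof.
by move=> x; have [n [a ->]] := colim_ind1 x; rewrite (colim_in0 0 n) colim_addE add0r.
Qed.

Lemma colim_addN : left_inverse (colim_in (0 : G 0)) colim_opp colim_add.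
Proof.
move=> x; rewrite -[X in colim_add _ X]reprK /colim_opp; case: (repr x) => n a.
by rewrite colim_addE addNr (colim_in0 n 0).
Qed.

HB.instance Definition _ :=
  GRing.isZmodule.Build seqcolim colim_addA colim_addC colim_add0 colim_addN.

Lemma colim_inD n (a b : G n) : colim_in (a + b) = colim_in a + colim_in b.
Proof. by rewrite -colim_addE. Qed.

End SeqColim.

Section SeqLim.
Variables (G : nat -> zmodType) (r : forall n, {additive G n.+1 -> G n}).

Record seqlim := SeqLim {
  lim_pr :> forall n, G n;
  lim_compat : forall n, r n (lim_pr n.+1) = lim_pr n
}.

Lemma seqlim_eq (x y : seqlim) : (forall n, x n = y n) -> x = y.
Proof.
case: x y => [x hx] [y hy] /= e.
have e' : x = y by apply: functional_extensionality_dep.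
by move: hx; rewrite e' => hx; congr SeqLim; apply: Prop_irrelevance.
Qed.

Definition lim_zero : seqlim := @SeqLim (fun=> 0) (fun n => raddf0 (r n)).

Lemma lim_opp_subproof (x : seqlim) n : r n (- x n.+1) = - x n.
Proof. by rewrite raddfN lim_compat. Qed.
Definition lim_opp (x : seqlim) : seqlim := SeqLim (lim_opp_subproof x).

Lemma lim_add_subproof (x y : seqlim) n : r n (x n.+1 + y n.+1) = x n + y n.
Proof. by rewrite raddfD !lim_compat. Qed.
Definition lim_add (x y : seqlim) : seqlim := SeqLim (lim_add_subproof x y).

HB.instance Definition _ := gen_eqMixin seqlim.
HB.instance Definition _ := gen_choiceMixin seqlim.

Lemma lim_addA : associative lim_add.
Proof. by move=> x y z; apply: seqlim_eq => n; apply: addrA. Qed.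
Lemma lim_addC : commutative lim_add.
Proof. by move=> x y; apply: seqlim_eq => n; apply: addrC. Qed.
Lemma lim_add0 : left_id lim_zero lim_add.
Proof. by move=> x; apply: seqlim_eq => n; apply: add0r. Qed.
Lemma lim_addN : left_inverse lim_zero lim_opp lim_add.
Proof. by move=> x; apply: seqlim_eq => n; apply: addNr. Qed.

HB.instance Definition _ :=
  GRing.isZmodule.Build seqlim lim_addA lim_addC lim_add0 lim_addN.

(* lim^1 is the cokernel of (x_n) |-> (x_n - r_n x_{n+1}). *)
Definition lim1_zero : Prop :=
  forall y : (forall n, G n), exists x : (forall n, G n),
    forall n, y n = x n - r n (x n.+1).

End SeqLim.

Section Sequences.
Variable C : preadditive.

Record sequence := Sequence {
  seq_ob :> nat -> C;
  seq_map : forall n, hom (seq_ob n) (seq_ob n.+1)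
}.

Definition cauchy (X : sequence) : Prop :=
  forall T : C, exists N, forall n, (N <= n)%N ->
    bijective (fun f : hom T (X n) => seq_map X n ∘ f).

Section PostComp.
Variables (T : C) (Y : sequence).

Definition post_map n (f : hom T (Y n)) : hom T (Y n.+1) := seq_map Y n ∘ f.

Lemma post_map_zmod n : zmod_morphism (@post_map n).
Proof. by move=> f g; rewrite /post_map compBr. Qed.

HB.instance Definition _ n :=
  GRing.isZmodMorphism.Build (hom T (Y n)) (hom T (Y n.+1)) (@post_map n)
    (@post_map_zmod n).

Definition post_tower n : {additive hom T (Y n) -> hom T (Y n.+1)} := @post_map n.

(* colim_j Hom(T, Y_j) *)
Definition hom_colim : zmodType := seqcolim post_tower.

Definition hom_in n (f : hom T (Y n)) : hom_colim := colim_in post_tower f.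

Lemma hom_inS n (f : hom T (Y n)) : hom_in (seq_map Y n ∘ f) = hom_in f.
Proof. exact: (colim_in_step post_tower f). Qed.

Lemma hom_inD n (f g : hom T (Y n)) : hom_in (f + g) = hom_in f + hom_in g.
Proof. exact: colim_inD. Qed.

Lemma hom_colim_ind (P : hom_colim -> Prop) :
  (forall n (f : hom T (Y n)), P (hom_in f)) -> forall x, P x.
Proof. by move=> h x; have [n [f ->]] := colim_ind1 x; apply: h. Qed.

Lemma hom_colim_ex2 (x y : hom_colim) :
  exists n (f g : hom T (Y n)), x = hom_in f /\ y = hom_in g.
Proof. exact: colim_ind2. Qed.

Definition hom_desc (U : Type) (h : forall n, hom T (Y n) -> U) (x : hom_colim) : U :=
  colim_desc h x.

Lemma hom_descE (U : Type) (h : forall n, hom T (Y n) -> U) :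
  (forall n (f : hom T (Y n)), h n.+1 (seq_map Y n ∘ f) = h n f) ->
  forall n (f : hom T (Y n)), hom_desc h (hom_in f) = h n f.
Proof. by move=> hh n f; apply: (colim_descE (t := post_tower) (h := h) hh f). Qed.

End PostComp.

(* Precomposition Hom(T', Y_j) -> Hom(T, Y_j), in the colimit over j. *)
Definition precomp (Y : sequence) (T T' : C) (f : hom T T') :
    hom_colim T' Y -> hom_colim T Y :=
  hom_desc (fun n (g : hom T' (Y n)) => hom_in (g ∘ f)).

Lemma precompE (Y : sequence) (T T' : C) (f : hom T T') n (g : hom T' (Y n)) :
  precomp f (hom_in g) = hom_in (g ∘ f).
Proof. by apply: hom_descE => m h; rewrite -compA hom_inS. Qed.

Lemma precomp_zmod (Y : sequence) (T T' : C) (f : hom T T') :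
  zmod_morphism (@precomp Y T T' f).
Proof.
move=> x y; have [n [g [h [-> ->]]]] := hom_colim_ex2 x y.
have B (S : C) (a b : hom S (Y n)) : hom_in (a - b) = hom_in a - hom_in b.
  by apply: (addIr (hom_in b)); rewrite subrK -hom_inD subrK.
by rewrite -B !precompE compBl B.
Qed.

HB.instance Definition _ (Y : sequence) (T T' : C) (f : hom T T') :=
  GRing.isZmodMorphism.Build (hom_colim T' Y) (hom_colim T Y) (@precomp Y T T' f)
    (@precomp_zmod Y T T' f).

Lemma precompM (Y : sequence) (T T' T'' : C) (g : hom T' T'') (f : hom T T')
    (x : hom_colim T'' Y) : precomp (g ∘ f) x = precomp f (precomp g x).
Proof. by elim/hom_colim_ind: x => n h; rewrite !precompE compA. Qed.

Lemma precomp1 (Y : sequence) (T : C) (x : hom_colim T Y) : precomp (idm T) x = x.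
Proof. by elim/hom_colim_ind: x => n h; rewrite precompE compm1. Qed.

Lemma precompDl (Y : sequence) (T T' : C) (f g : hom T T') (x : hom_colim T' Y) :
  precomp (f + g) x = precomp f x + precomp g x.
Proof. by elim/hom_colim_ind: x => n h; rewrite !precompE compDr hom_inD. Qed.

Definition hom_tower (X Y : sequence) (n : nat) :
    {additive hom_colim (X n.+1) Y -> hom_colim (X n) Y} :=
  @precomp Y _ _ (seq_map X n).

Definition phantomless : Prop :=
  forall X Y : sequence, cauchy X -> cauchy Y -> lim1_zero (hom_tower X Y).

(* lim_i colim_j Hom(X_i, Y_j) *)
Definition seq_hom (X Y : sequence) : zmodType := seqlim (hom_tower X Y).

Definition seq_id_pr (X : sequence) n : hom_colim (X n) X := hom_in (idm (X n)).

Lemma seq_id_compat (X : sequence) n :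
  hom_tower X X n (seq_id_pr X n.+1) = seq_id_pr X n.
Proof. by rewrite /= /seq_id_pr precompE comp1m -[seq_map X n]compm1 hom_inS. Qed.

Definition seq_id (X : sequence) : seq_hom X X := SeqLim (@seq_id_compat X).

Section Act.
Variables (T : C) (Y Z : sequence) (y : seq_hom Y Z).

(* [f : T -> Y_j] is sent to the composite of [f] with the j-th component of [y]. *)
Definition seq_act : hom_colim T Y -> hom_colim T Z :=
  hom_desc (fun n (f : hom T (Y n)) => precomp f (lim_pr y n)).

Lemma seq_actE n (f : hom T (Y n)) : seq_act (hom_in f) = precomp f (lim_pr y n).
Proof.
by apply: hom_descE => m g; rewrite precompM -(lim_compat y m).
Qed.

End Act.

Lemma seq_act_precomp (T T' : C) (Y Z : sequence) (y : seq_hom Y Z)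
    (f : hom T T') (x : hom_colim T' Y) :
  precomp f (seq_act y x) = seq_act y (precomp f x).
Proof. by elim/hom_colim_ind: x => n g; rewrite precompE !seq_actE precompM. Qed.

Lemma seq_comp_compat (X Y Z : sequence) (y : seq_hom Y Z) (x : seq_hom X Y) n :
  hom_tower X Z n (seq_act y (lim_pr x n.+1)) = seq_act y (lim_pr x n).
Proof. by rewrite /= seq_act_precomp -(lim_compat x n). Qed.

Definition seq_comp (X Y Z : sequence) (y : seq_hom Y Z) (x : seq_hom X Y) :
  seq_hom X Z := SeqLim (seq_comp_compat y x).

(* The morphism given by a levelwise morphism of sequences. *)
Lemma seq_level_compat (X Y : sequence) (f : forall n, hom (X n) (Y n)) :
  (forall n, f n.+1 ∘ seq_map X n = seq_map Y n ∘ f n) ->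
  forall n, hom_tower X Y n (hom_in (f n.+1)) = hom_in (f n).
Proof. by move=> h n; rewrite /= precompE h hom_inS. Qed.

Definition seq_level (X Y : sequence) (f : forall n, hom (X n) (Y n))
    (hf : forall n, f n.+1 ∘ seq_map X n = seq_map Y n ∘ f n) : seq_hom X Y :=
  SeqLim (seq_level_compat hf).

End Sequences.

Record cauchy_sequence (C : preadditive) := CauchySequence {
  cs_seq :> sequence C;
  cs_cauchy : cauchy cs_seq
}.

Lemma seq_actDl (C : preadditive) (T : C) (Y Z : sequence C) (y y' : seq_hom Y Z)
    (x : hom_colim T Y) : seq_act (y + y') x = seq_act y x + seq_act y' x.
Proof. by elim/hom_colim_ind: x => n f; rewrite !seq_actE /= raddfD. Qed.

Lemma seq_actDr (C : preadditive) (T : C) (Y Z : sequence C) (y : seq_hom Y Z)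
    (x x' : hom_colim T Y) : seq_act y (x + x') = seq_act y x + seq_act y x'.
Proof.
have [n [f [g [-> ->]]]] := hom_colim_ex2 x x'.
by rewrite -hom_inD !seq_actE precompDl.
Qed.

Lemma seq_actM (C : preadditive) (T : C) (X Y Z : sequence C) (z : seq_hom Y Z)
    (y : seq_hom X Y) (x : hom_colim T X) :
  seq_act z (seq_act y x) = seq_act (seq_comp z y) x.
Proof. by elim/hom_colim_ind: x => n f; rewrite (seq_actE y) -seq_act_precomp seq_actE. Qed.

Lemma seq_act1 (C : preadditive) (T : C) (Y : sequence C) (x : hom_colim T Y) :
  seq_act (seq_id Y) x = x.
Proof. by elim/hom_colim_ind: x => n f; rewrite seq_actE precompE comp1m. Qed.

Definition completion (C : preadditive) : preadditive.
Proof.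
refine (@Preadditive (cauchy_sequence C) (fun X Y => seq_hom X Y)
  (fun X => seq_id X) (fun X Y Z => @seq_comp C X Y Z) _ _ _ _ _).
- by move=> X Y Z W h g f; apply: seqlim_eq => n; apply: seq_actM.
- by move=> X Y f; apply: seqlim_eq => n; apply: seq_act1.
- by move=> X Y f; apply: seqlim_eq => n; rewrite /= seq_actE precomp1.
- by move=> X Y Z g g' f; apply: seqlim_eq => n; apply: seq_actDl.
- by move=> X Y Z g f f'; apply: seqlim_eq => n; apply: seq_actDr.
Defined.

Section CompletionSuspension.
Variable C : triangulated_category.
Local Notation S := (susp C).

Definition seq_susp (X : sequence C) : sequence C :=
  Sequence (fun n => fmap S (seq_map X n)).

Lemma iso_precomp_bij (D : preadditive) (X Y Z : D) (a : hom X Y) :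
  is_iso a -> bijective (fun f : hom Y Z => f ∘ a).
Proof.
move=> [b [ba ab]]; exists (fun f => f ∘ b) => f; rewrite -compA ?ab ?ba compm1 //.
Qed.

Lemma cauchy_susp (X : sequence C) : cauchy X -> cauchy (seq_susp X).
Proof.
move=> hX T; have [ff es] := triang_susp (tri_catP C).
have [T' [a [b [ba ab]]]] := es T; have [N hN] := hX T'; exists N => n le.
have [g gl gr] := hN n le.
have [p pl pr] := ff T' (X n); have [q ql qr] := ff T' (X n.+1).
exists (fun f => fmap S (g (q (f ∘ a))) ∘ b) => f /=.
  have <- : fmap S (seq_map X n ∘ p (f ∘ a)) = fmap S (seq_map X n) ∘ f ∘ a.
    by rewrite fmapM pr compA.
  by rewrite ql gl pr -compA ab compm1.
by rewrite compA -fmapM gr qr -compA ab compm1.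
Qed.

Definition cs_susp (X : cauchy_sequence C) : cauchy_sequence C :=
  CauchySequence (cauchy_susp (cs_cauchy X)).

(* colim_j Hom(T, Y_j) -> colim_j Hom(ΣT, ΣY_j) *)
Definition colim_susp (T : C) (Y : sequence C) :
    hom_colim T Y -> hom_colim (S T) (seq_susp Y) :=
  hom_desc (fun n (f : hom T (Y n)) => hom_in (Y := seq_susp Y) (fmap S f)).

Lemma colim_suspE (T : C) (Y : sequence C) n (f : hom T (Y n)) :
  colim_susp (hom_in f) = hom_in (Y := seq_susp Y) (fmap S f).
Proof.
apply: hom_descE => m g; rewrite fmapM.
exact: (hom_inS (Y := seq_susp Y) (fmap S g)).
Qed.

Lemma colim_susp_precomp (T T' : C) (Y : sequence C) (f : hom T T')
    (x : hom_colim T' Y) :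
  colim_susp (precomp f x) = precomp (fmap S f) (colim_susp x).
Proof.
by elim/hom_colim_ind: x => n g; rewrite precompE !colim_suspE precompE fmapM.
Qed.

Lemma seq_susp_compat (X Y : sequence C) (f : seq_hom X Y) n :
  hom_tower (seq_susp X) (seq_susp Y) n (colim_susp (lim_pr f n.+1))
  = colim_susp (lim_pr f n).
Proof. by rewrite /= -colim_susp_precomp -(lim_compat f n). Qed.

Definition seq_susp_map (X Y : sequence C) (f : seq_hom X Y) :
  seq_hom (seq_susp X) (seq_susp Y) := SeqLim (seq_susp_compat f).

Lemma colim_susp_act (T : C) (Y Z : sequence C) (y : seq_hom Y Z) (x : hom_colim T Y) :
  colim_susp (seq_act y x) = seq_act (seq_susp_map y) (colim_susp x).
Proof.
by elim/hom_colim_ind: x => n f; rewrite seq_actE colim_suspE seq_actE /= colim_susp_precomp.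
Qed.

Lemma colim_suspD (T : C) (Y : sequence C) (x y : hom_colim T Y) :
  colim_susp (x + y) = colim_susp x + colim_susp y.
Proof.
have [n [f [g [-> ->]]]] := hom_colim_ex2 x y.
by rewrite -hom_inD !colim_suspE fmapD hom_inD.
Qed.

Definition completion_susp : additive_functor (completion C) (completion C).
Proof.
refine (@AdditiveFunctor (completion C) (completion C) cs_susp
  (fun X Y => @seq_susp_map X Y) _ _ _).
- by move=> X; apply: seqlim_eq => n /=; rewrite colim_suspE fmap1.
- by move=> X Y Z g f; apply: seqlim_eq => n; apply: colim_susp_act.
- by move=> X Y f g; apply: seqlim_eq => n; apply: colim_suspD.
Defined.

Definition suspended_completion : suspended := Suspended completion_susp.

End CompletionSuspension.

Record triangle_sequence (C : triangulated_category) := TriangleSequence {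
  ts_tri :> nat -> triangle C;
  ts_mor : forall n, tri_mor (ts_tri n) (ts_tri n.+1);
  ts_exact : forall n, exact_tri (ts_tri n);
  ts_cauchy1 : cauchy (Sequence (fun n => mor1 (ts_mor n)));
  ts_cauchy2 : cauchy (Sequence (fun n => mor2 (ts_mor n)));
  ts_cauchy3 : cauchy (Sequence (fun n => mor3 (ts_mor n)))
}.

Section ColimitTriangle.
Variables (C : triangulated_category) (T : triangle_sequence C).

Definition ts_seq1 : cauchy_sequence C := CauchySequence (ts_cauchy1 T).
Definition ts_seq2 : cauchy_sequence C := CauchySequence (ts_cauchy2 T).
Definition ts_seq3 : cauchy_sequence C := CauchySequence (ts_cauchy3 T).

Definition colimit_triangle : triangle (suspended_completion C) :=
  @Triangle (suspended_completion C) ts_seq1 ts_seq2 ts_seq3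
    (seq_level (X := ts_seq1) (Y := ts_seq2) (f := fun n => tri_f (T n))
       (fun n => esym (mor_sqf (ts_mor T n))))
    (seq_level (X := ts_seq2) (Y := ts_seq3) (f := fun n => tri_g (T n))
       (fun n => esym (mor_sqg (ts_mor T n))))
    (seq_level (X := ts_seq3) (Y := cs_susp ts_seq1) (f := fun n => tri_h (T n))
       (fun n => esym (mor_sqh (ts_mor T n)))).

Definition ts_coherent (A : frobenius_category) (F : triangle_equivalence C A) : Prop :=
  coherent_sequence (fun n => te_tri_mor F (ts_mor T n)).

End ColimitTriangle.

(* Main.v *)
From HB Require Import structures.
From mathcomp Require Import all_boot all_algebra.
From mathcomp Require Import boolp.
Require Import Defs.

(** A class of triangles is determined by its members, so the content of the theorem is
    that the triangles isomorphic to colimits of coherent sequences satisfy the axioms.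

    Every construction is made levelwise in the Frobenius category, where it is
    functorial.  Two steps bring an arbitrary morphism of the completion to that form.
    By passing to a subsequence of the target, it becomes a sequence of morphisms that
    commute with the transition maps of the sequences ([reindex_level]).  These squares
    commute in the stable category only; but if the horizontal maps of a square are
    admissible monomorphisms, then changing one vertical map by a map that factors
    through an injective object makes the square commute strictly
    ([ses_mor_strictify]), and adding an injective object to its target turns any
    morphism into an admissible monomorphism ([adm_mono_replace]).  Hence every morphism
    of the completion is isomorphic to one that comes from a strictly commuting sequence
    of admissible monomorphisms ([realize_adm_mono]).  Its cokernels give a cone; their
    sequence is Cauchy by the five lemma ([cauchy_third]).  Two composable morphisms are
    realized in the same way, and the Noether isomorphism for the two monomorphisms and
    their composite is an octahedron ([colimit_exact_octahedron]).  Rotation is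
    functorial because it is given by a pushout along an injective hull
    ([rot_ses_mor]).

    The axiom that depends on the vanishing of lim^1 is the completion of a commutative
    square (a, b) to a morphism (a, b, c) of triangles ([colimit_fill]).  Represent a and
    b at each level n by a square that commutes in the triangulated category, lift it to
    the Frobenius category, and let c_n be the induced map of cokernels.  The c_n need
    not be compatible with the transition maps x, y, z of the first sequence.  The
    difference of the two composites of consecutive levels is again induced by a
    morphism of exact sequences, whose first two components vanish stably; such a
    morphism has third component g' e h for some e from the suspension of the first
    object to the second object ([ses_mor_null], [lifted_null]).  So, in the colimit
    over the levels of the target, c_{n+1} z_n - c_n = g' e_n h_n.  Vanishing of lim^1
    provides t_n with e_n = t_n - t_{n+1} (Σ x_n), and c_n + g' t_n h_n is compatible.
    It still completes the square, since h g and h' g' vanish.  Coherence is what gives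
    the difference this form: for arbitrary fillers c_n, composing it with g and h' only
    yields zero, which is weaker.

    Given isomorphism invariance, forward rotation, fillers, cones and one octahedron
    for each composable pair, the remaining axioms are formal
    ([pretriangulated_triangulated]).  The stable category satisfies the same list up to
    fillers, and so has a five lemma as well; this is how a triangle in the given
    category is recognized as exact from its image in the stable category
    ([exact_tri_reflect]). *)

Set Implicit Arguments.
Unset Strict Implicit.
Unset Printing Implicit Defensive.

Import GRing.Theory.
Local Open Scope ring_scope.
Local Open Scope cat_scope.

(* Simplification would replace these projections, applied to the stable category or to
   the completion, by the underlying operations, which hides the category they belong
   to. *)
Arguments comp : simpl never.
Arguments fmap : simpl never.
Arguments idm : simpl never.

(** * Preadditive categories and functors *)

Lemma bijective_surj (T U : Type) (f : T -> U) : bijective f -> forall y, exists x, f x = y.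
Proof. by move=> [g _ gK] y; exists (g y). Qed.

Lemma inj_surj_bijective (T U : Type) (f : T -> U) :
  ssrfun.injective f -> (forall y, exists x, f x = y) -> bijective f.
Proof.
move=> fi fs; pose g y := sval (cid (fs y)).
have gK : cancel g f by move=> y; rewrite /g; case: cid.
by exists g => // x; apply: fi; rewrite gK.
Qed.

Lemma dependent_choice (I : Type) (T : I -> Type) (P : forall i, T i -> Prop) :
  (forall i, exists y, P i y) -> exists f : forall i, T i, forall i, P i (f i).
Proof.
by move=> h; exists (fun i => sval (cid (h i))) => i; apply: svalP (cid (h i)).
Qed.

Section Isomorphisms.
Variable D : preadditive.

Lemma is_iso_idm (X : D) : is_iso (idm X).
Proof. by exists (idm X); rewrite comp1m. Qed.

Lemma is_iso_comp (X Y Z : D) (g : hom Y Z) (f : hom X Y) :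
  is_iso g -> is_iso f -> is_iso (g ∘ f).
Proof.
move=> [g' [gl gr]] [f' [fl fr]]; exists (f' ∘ g').
by split; rewrite -compA (compA g' g f, compA f f' g') ?gl ?fr comp1m.
Qed.

Lemma is_iso_inv (X Y : D) (f : hom X Y) (g : hom Y X) :
  g ∘ f = idm X -> f ∘ g = idm Y -> is_iso g.
Proof. by exists f. Qed.

Lemma is_iso_mono (X Y W : D) (f : hom X Y) (a b : hom W X) :
  is_iso f -> f ∘ a = f ∘ b -> a = b.
Proof. by move=> [g [l _]] e; rewrite -[a]comp1m -[b]comp1m -l -!compA e. Qed.

Lemma is_iso_epi (X Y W : D) (f : hom X Y) (a b : hom Y W) :
  is_iso f -> a ∘ f = b ∘ f -> a = b.
Proof. by move=> [g [_ r]] e; rewrite -[a]compm1 -[b]compm1 -r !compA e. Qed.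

Lemma is_iso_fmap (D' : preadditive) (F : additive_functor D D') (X Y : D)
    (f : hom X Y) : is_iso f -> is_iso (fmap F f).
Proof. by move=> [g [l r]]; exists (fmap F g); rewrite -!fmapM l r !fmap1. Qed.

Lemma is_zeroP (Z : D) : idm Z = 0 -> is_zero Z.
Proof.
by move=> z X; split=> f; [rewrite -[f]comp1m z comp0m | rewrite -[f]compm1 z compm0].
Qed.

Lemma zero_into (Z X : D) (f g : hom X Z) : is_zero Z -> f = g.
Proof. by move=> /(_ X)[z _]; rewrite (z f) (z g). Qed.

Lemma zero_from (Z X : D) (f g : hom Z X) : is_zero Z -> f = g.
Proof. by move=> /(_ X)[_ z]; rewrite (z f) (z g). Qed.

End Isomorphisms.

Section Functors.
Variables (D D' : preadditive) (F : additive_functor D D').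

Lemma fmap0 (X Y : D) : fmap F (0 : hom X Y) = 0.
Proof. by apply: (addrI (fmap F (0 : hom X Y))); rewrite -fmapD !addr0. Qed.

Lemma fmapN (X Y : D) (f : hom X Y) : fmap F (- f) = - fmap F f.
Proof. by apply: (addrI (fmap F f)); rewrite -fmapD !subrr fmap0. Qed.

Lemma fmapB (X Y : D) (f g : hom X Y) : fmap F (f - g) = fmap F f - fmap F g.
Proof. by rewrite fmapD fmapN. Qed.

Hypothesis hF : is_equivalence F.

Lemma equiv_full (X Y : D) (g : hom (F X) (F Y)) : exists f : hom X Y, fmap F f = g.
Proof. by have [[h _ r] _] := (hF.1 X Y, tt); exists (h g). Qed.

Lemma equiv_faithful (X Y : D) (f g : hom X Y) : fmap F f = fmap F g -> f = g.
Proof. by have [h l _] := hF.1 X Y => e; rewrite -(l f) e l. Qed.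

Lemma equiv_iso (X Y : D) (f : hom X Y) : is_iso (fmap F f) -> is_iso f.
Proof.
move=> [g' [l r]]; have [g eg] := equiv_full g'; exists g.
by split; apply: equiv_faithful; rewrite fmapM eg (l, r) fmap1.
Qed.

End Functors.

(** * Triangles *)

Section Triangles.
Variable D : suspended.

Lemma tri_isomorphic_sym (T T' : triangle D) : tri_isomorphic T T' -> tri_isomorphic T' T.
Proof.
case: T T' => [X Y Z f g h] [X' Y' Z' f' g' h'].
move=> [[a b c /= ef eg eh] [/= ia ib ic]].
have := (ia, ib, ic) => -[[[a' [al ar]] [b' [bl br]]] [c' [cl cr]]].
have e1 : b' ∘ f' = f ∘ a'.
  by apply: (is_iso_mono ib); rewrite !compA br ef comp1m -compA ar compm1.
have e2 : c' ∘ g' = g ∘ b'.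
  by apply: (is_iso_mono ic); rewrite !compA cr eg comp1m -compA br compm1.
have e3 : fmap (susp D) a' ∘ h' = h ∘ c'.
  apply: (is_iso_mono (is_iso_fmap (susp D) ia)).
  by rewrite !compA -fmapM ar fmap1 eh comp1m -compA cr compm1.
exists (@TriMor D (Triangle f' g' h') (Triangle f g h) a' b' c' e1 e2 e3).
by split; [exists a | exists b | exists c].
Qed.

Lemma tri_isomorphic_trans (T T' T'' : triangle D) :
  tri_isomorphic T T' -> tri_isomorphic T' T'' -> tri_isomorphic T T''.
Proof.
case: T T' T'' => [X Y Z f g h] [X' Y' Z' f' g' h'] [X2 Y2 Z2 f2 g2 h2].
move=> [[a b c /= ef eg eh] [/= ia ib ic]] [[a' b' c' /= ef' eg' eh'] [/= ia' ib' ic']].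
have e1 : (b' ∘ b) ∘ f = f2 ∘ (a' ∘ a) by rewrite -compA ef !compA ef'.
have e2 : (c' ∘ c) ∘ g = g2 ∘ (b' ∘ b) by rewrite -compA eg !compA eg'.
have e3 : fmap (susp D) (a' ∘ a) ∘ h = h2 ∘ (c' ∘ c).
  by rewrite fmapM -compA eh !compA eh'.
exists (@TriMor D (Triangle f g h) (Triangle f2 g2 h2) _ _ _ e1 e2 e3).
by split; apply: is_iso_comp.
Qed.

Lemma tri_isomorphicP (X Y Z X' Y' Z' : D) f g h f' g' h'
    (a : hom X X') (b : hom Y Y') (c : hom Z Z') :
  is_iso a -> is_iso b -> is_iso c ->
  b ∘ f = f' ∘ a -> c ∘ g = g' ∘ b -> fmap (susp D) a ∘ h = h' ∘ c ->
  tri_isomorphic (Triangle f g h) (Triangle f' g' h').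
Proof.
move=> ia ib ic e1 e2 e3.
by exists (@TriMor D (Triangle f g h) (Triangle f' g' h') _ _ _ e1 e2 e3).
Qed.

Definition fills (T T' : triangle D) : Prop :=
  forall (a : hom (tri1 T) (tri1 T')) (b : hom (tri2 T) (tri2 T')),
  b ∘ tri_f T = tri_f T' ∘ a -> exists m : tri_mor T T', mor1 m = a /\ mor2 m = b.

(** Fillers are transported along isomorphisms by conjugation, so it is enough to
    construct them between standard triangles. *)
Lemma fills_iso (T T' U U' : triangle D) :
  tri_isomorphic T U -> tri_isomorphic T' U' -> fills U U' -> fills T T'.
Proof.
case: T T' U U' => [X Y Z f g h] [X' Y' Z' f' g' h'] [P Q R k l m] [P' Q' R' k' l' m'].
move=> [[i1 i2 i3 /= e1 e2 e3] [/= ii1 ii2 ii3]].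
move=> [[j1 j2 j3 /= e1' e2' e3'] [/= ij1 ij2 ij3]] fi a b /= sq.
have [i1' [l1 r1]] := ii1; have [i2' [l2 r2]] := ii2; have [j3' [l3 r3]] := ij3.
have [|[a1 b1 c s1 s2 s3] /= [? ?]] := fi (j1 ∘ a ∘ i1') (j2 ∘ b ∘ i2').
  apply: (is_iso_epi ii1); rewrite /= -!compA -e1 l1 compm1.
  by rewrite (compA i2') l2 comp1m sq !compA e1'.
subst a1 b1; rewrite /= in s1 s2 s3.
have q2 : (j3' ∘ c ∘ i3) ∘ g = g' ∘ b.
  apply: (is_iso_mono ij3); rewrite !compA r3 comp1m -compA e2 !compA s2.
  by rewrite -!compA l2 compm1 !compA e2'.
have q3 : fmap (susp D) a ∘ h = h' ∘ (j3' ∘ c ∘ i3).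
  apply: (is_iso_mono (is_iso_fmap (susp D) ij1)).
  rewrite [RHS]compA e3' -!compA (compA j3) r3 comp1m (compA m') -s3.
  rewrite -[RHS]compA -e3 !compA -!fmapM; congr (fmap _ _ ∘ h).
  by rewrite -!compA l1 compm1.
by exists (@TriMor D (Triangle f g h) (Triangle f' g' h') a b _ sq q2 q3).
Qed.

End Triangles.

(** The part of the axioms that already gives exact Hom sequences and the five lemma.
    Only the forward direction of the rotation axiom is included: the converse follows
    from it once cones exist. *)
Record pretriangulated (D : suspended) (E : triangle D -> Prop) : Prop := Pretriangulated {
  pt_additive : additive_category D;
  pt_susp : is_equivalence (susp D);
  pt_iso : forall T T' : triangle D, tri_isomorphic T T' -> E T -> E T';
  pt_id : forall X Z : D, is_zero Z -> E (Triangle (idm X) (0 : hom X Z) 0);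
  pt_rot : forall (X Y Z : D) (f : hom X Y) (g : hom Y Z) (h : hom Z (susp D X)),
    E (Triangle f g h) -> E (Triangle g h (- fmap (susp D) f));
  pt_fill : forall (T T' : triangle D), E T -> E T' -> fills T T'
}.

Lemma triangulated_pretriangulated (D : suspended) (E : triangle D -> Prop) :
  triangulated E -> pretriangulated E.
Proof. by case=> ? ? ? ? ? rot ? ?; split=> // X Y Z f g h /rot. Qed.

Section Pretriangulated.
Variables (D : suspended) (E : triangle D -> Prop).
Hypothesis hE : pretriangulated E.
Local Notation S := (susp D).

Lemma pt_fillP (X Y Z X' Y' Z' : D) f g h f' g' h'
    (a : hom X X') (b : hom Y Y') :
  E (Triangle f g h) -> E (Triangle f' g' h') -> b ∘ f = f' ∘ a ->
  exists c : hom Z Z', c ∘ g = g' ∘ b /\ fmap S a ∘ h = h' ∘ c.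
Proof.
move=> e e' s; have [[a1 b1 c e1 e2 e3] /= [? ?]] := pt_fill hE e e' s; subst a1 b1.
by exists c.
Qed.

(** The filler of (id, f) from the triangle on the identity of X factors g f through a
    zero object. *)
Lemma pt_comp0 (X Y Z : D) f g h : E (@Triangle D X Y Z f g h) -> g ∘ f = 0.
Proof.
move=> e; have [[Z0 z0] _] := pt_additive hE.
have [|c [/= <- _]] := pt_fillP (pt_id hE X z0) e (a := idm X) (b := f) => //.
exact: compm0.
Qed.

Lemma pt_comp0' (X Y Z : D) f g h : E (@Triangle D X Y Z f g h) -> h ∘ g = 0.
Proof. by move/(pt_rot hE)/pt_comp0. Qed.

(** A map a with g a = 0 gives a morphism from the rotated triangle on the identity of W
    to the rotation of the given triangle; the filler between the suspensions of W and X
    desuspends to a lift of a. *)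
Lemma pt_exact (X Y Z : D) f g h (W : D) (a : hom W Y) :
  E (@Triangle D X Y Z f g h) -> g ∘ a = 0 -> exists c, f ∘ c = a.
Proof.
move=> e ga; have [[Z0 z0] _] := pt_additive hE.
have [|c [_ /= ec]] :=
  pt_fillP (pt_rot hE (pt_id hE W z0)) (pt_rot hE e) (a := a) (b := 0).
  by rewrite compm0 ga.
have [c0 ec0] := equiv_full (pt_susp hE) c; exists c0.
apply: (equiv_faithful (pt_susp hE)); rewrite fmapM ec0.
by apply: oppr_inj; rewrite -compNl -ec fmap1 compNr compm1.
Qed.

Lemma pt_exact3 (X Y Z : D) f g h (W : D) (a : hom W Z) :
  E (@Triangle D X Y Z f g h) -> h ∘ a = 0 -> exists c, g ∘ c = a.
Proof. by move/(pt_rot hE)/pt_exact; apply. Qed.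

Lemma pt_exact1 (X Y Z : D) f g h (W : D) (a : hom W (S X)) :
  E (@Triangle D X Y Z f g h) -> fmap S f ∘ a = 0 -> exists c, h ∘ c = a.
Proof.
move/(pt_rot hE)/(pt_rot hE)/pt_exact => ex ea; apply: ex.
by rewrite compNl ea oppr0.
Qed.

Definition hom_inj (W X Y : D) (f : hom X Y) : Prop :=
  forall a : hom W X, f ∘ a = 0 -> a = 0.

Definition hom_surj (W X Y : D) (f : hom X Y) : Prop :=
  forall b : hom W Y, exists a, f ∘ a = b.

(** The diagram chase for a single test object W.  The hypotheses concern W only, since
    the transition maps of a Cauchy sequence are bijective on Hom(W, -) from an index
    on that depends on W. *)
Lemma pt_five (X Y Z X' Y' Z' W : D) f g h f' g' h'
    (a : hom X X') (b : hom Y Y') (c : hom Z Z') :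
  E (Triangle f g h) -> E (Triangle f' g' h') ->
  b ∘ f = f' ∘ a -> c ∘ g = g' ∘ b -> fmap S a ∘ h = h' ∘ c ->
  hom_surj W a -> hom_inj W b -> hom_surj W b ->
  hom_inj W (fmap S a) -> hom_surj W (fmap S a) -> hom_inj W (fmap S b) ->
  hom_inj W c /\ hom_surj W c.
Proof.
move=> e e' s1 s2 s3 sa ib sb ia' sa' ib'; split=> [z cz | z'].
  have hz : h ∘ z = 0 by apply: ia'; rewrite compA s3 -compA cz compm0.
  have [y ey] := pt_exact3 e hz.
  have gby : g' ∘ (b ∘ y) = 0 by rewrite compA -s2 -compA ey.
  have [x' ex'] := pt_exact e' gby; have [x ex] := sa x'.
  have : b ∘ (y - f ∘ x) = 0 by rewrite compBr compA s1 -compA ex ex' subrr.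
  move/ib/eqP; rewrite subr_eq0 => /eqP eyx.
  by rewrite -ey eyx compA (pt_comp0 e) comp0m.
have [x ex] := sa' (h' ∘ z').
have hx : fmap S f ∘ x = 0.
  apply: ib'; rewrite compA -fmapM s1 fmapM -compA ex compA.
  have := pt_comp0 (pt_rot hE (pt_rot hE e')).
  by rewrite compNl => /eqP; rewrite oppr_eq0 => /eqP ->; rewrite comp0m.
have [z ez] := pt_exact1 e hx.
have : h' ∘ (z' - c ∘ z) = 0 by rewrite compBr compA -s3 -compA ez ex subrr.
move/(pt_exact3 e') => [y' ey']; have [y ey] := sb y'.
by exists (z + g ∘ y); rewrite compDr compA s2 -compA ey ey' addrC subrK.
Qed.

Lemma is_iso_hom_inj (W X Y : D) (f : hom X Y) : is_iso f -> hom_inj W f.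
Proof. by move=> i a fa; apply: (is_iso_mono i); rewrite fa compm0. Qed.

Lemma is_iso_hom_surj (W X Y : D) (f : hom X Y) : is_iso f -> hom_surj W f.
Proof. by move=> [g [_ r]] b; exists (g ∘ b); rewrite compA r comp1m. Qed.

Lemma hom_bij_is_iso (X Y : D) (f : hom X Y) :
  (forall W, hom_inj W f /\ hom_surj W f) -> is_iso f.
Proof.
move=> h; have [g eg] := (h Y).2 (idm Y); exists g; split=> //.
apply/eqP; rewrite -subr_eq0; apply/eqP; apply: (h X).1.
by rewrite compBr compA eg comp1m compm1 subrr.
Qed.

Lemma pt_five_iso (X Y Z X' Y' Z' : D) f g h f' g' h'
    (a : hom X X') (b : hom Y Y') (c : hom Z Z') :
  E (Triangle f g h) -> E (Triangle f' g' h') ->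
  b ∘ f = f' ∘ a -> c ∘ g = g' ∘ b -> fmap S a ∘ h = h' ∘ c ->
  is_iso a -> is_iso b -> is_iso c.
Proof.
move=> e e' s1 s2 s3 ia ib; apply: hom_bij_is_iso => W.
have [ia' ib'] := (is_iso_fmap S ia, is_iso_fmap S ib).
by apply: (pt_five e e' s1 s2 s3); (apply: is_iso_hom_inj || apply: is_iso_hom_surj).
Qed.

Lemma pt_fill_iso (X Y Z X' Y' Z' : D) f g h f' g' h'
    (a : hom X X') (b : hom Y Y') :
  E (Triangle f g h) -> E (Triangle f' g' h') -> is_iso a -> is_iso b ->
  b ∘ f = f' ∘ a ->
  exists c : hom Z Z', [/\ is_iso c, c ∘ g = g' ∘ b & fmap S a ∘ h = h' ∘ c].
Proof.
move=> e e' ia ib s; have [c [s2 s3]] := pt_fillP e e' s.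
by exists c; split=> //; apply: pt_five_iso e e' s s2 s3 ia ib.
Qed.

Hypothesis cone : forall (X Y : D) (f : hom X Y),
  exists (Z : D) (g : hom Y Z) (h : hom Z (S X)), E (Triangle f g h).

(** Compare three rotations of a cone of f with two more rotations of the given
    triangle: both start with the negative of the suspension of f, so their third
    objects are isomorphic, and this isomorphism desuspends. *)
Lemma pt_rot_inv (X Y Z : D) (f : hom X Y) (g : hom Y Z) (h : hom Z (S X)) :
  E (Triangle g h (- fmap S f)) -> E (Triangle f g h).
Proof.
move=> e; have [Z' [g' [h' e']]] := cone f.
have r1 := pt_rot hE (pt_rot hE e).
have r2 := pt_rot hE (pt_rot hE (pt_rot hE e')).
have [] := pt_fill_iso r1 r2 (is_iso_idm _) (is_iso_idm _); first by rewrite comp1m compm1.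
move=> c' [ic]; have [c ec] := equiv_full (pt_susp hE) c'; subst c'.
have {}ic := equiv_iso (pt_susp hE) ic.
rewrite compm1 fmap1 comp1m !compNr -fmapM compNl -fmapM.
move=> /oppr_inj/(equiv_faithful (pt_susp hE)) s2.
move=> /oppr_inj/(equiv_faithful (pt_susp hE)) s3.
apply: (pt_iso hE _ e'); apply: tri_isomorphic_sym.
apply: (tri_isomorphicP (is_iso_idm _) (is_iso_idm _) ic).
- by rewrite comp1m compm1.
- by rewrite compm1.
- by rewrite fmap1 comp1m.
Qed.

Definition octahedron (X Y Z : D) (u : hom X Y) (v : hom Y Z) : Prop :=
  exists (X' Y' Z' : D)
    (i : hom Y Z') (i' : hom Z' (S X)) (j : hom Z X') (j' : hom X' (S Y))
    (k : hom Z Y') (k' : hom Y' (S X)) (f : hom Z' Y') (g : hom Y' X'),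
  [/\ E (Triangle u i i'), E (Triangle v j j'), E (Triangle (v ∘ u) k k')
    & [/\ E (Triangle f g (fmap S i ∘ j')),
          f ∘ i = k ∘ v, k' ∘ f = i', g ∘ k = j
        & j' ∘ g = fmap S u ∘ k']].

Hypothesis octa : forall (X Y Z : D) (u : hom X Y) (v : hom Y Z),
  exists (X1 Y1 Z1 : D) (u1 : hom X1 Y1) (v1 : hom Y1 Z1)
    (a : hom X X1) (b : hom Y Y1) (c : hom Z Z1),
  [/\ is_iso a, is_iso b & is_iso c] /\
  [/\ b ∘ u = u1 ∘ a, c ∘ v = v1 ∘ b & octahedron u1 v1].

(** Since cones are unique up to isomorphism of triangles, an octahedron for one choice
    of cones, and for a pair isomorphic to (u, v), can be moved to any other choice by
    conjugation. *)
Lemma pretriangulated_triangulated : triangulated E.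
Proof.
split; [by case: hE..| exact: cone | | by case: hE |].
  by move=> X Y Z f g h; split; [apply: pt_rot | apply: pt_rot_inv].
move=> X Y Z X' Y' Z' u v i i' j j' k k' eu ev evu.
have [X1 [Y1 [Z1 [u1 [v1 [a [b [c [[ia ib ic] [su sv]]]]]]]]]] := octa u v.
move=> [X1' [Y1' [Z1' [i1 [i1' [j1 [j1' [k1 [k1' [f1 [g1]]]]]]]]]]].
move=> [eu1 ev1 evu1 [e1 r1 r2 r3 r4]].
have [p [ip p1 p2]] := pt_fill_iso eu eu1 ia ib su.
have [q [iq q1 q2]] := pt_fill_iso ev ev1 ib ic sv.
have [|r [ir s1 s2]] := pt_fill_iso evu evu1 ia ic.
  by rewrite compA sv -compA su compA.
have [r' [rl rr]] := ir; have [q' [ql qr]] := iq.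
exists (r' ∘ f1 ∘ p), (q' ∘ g1 ∘ r); split.
- apply: (pt_iso hE _ e1); apply: tri_isomorphic_sym.
  apply: (tri_isomorphicP ip ir iq).
  + by rewrite !compA rr comp1m.
  + by rewrite !compA qr comp1m.
  + by rewrite !compA -fmapM p1 fmapM -!compA q2 !compA.
- by apply: (is_iso_mono ir); rewrite !compA rr comp1m s1 -!compA p1 sv !compA r1.
- apply: (is_iso_mono (is_iso_fmap S ia)).
  by rewrite !compA s2 -(compA k1') rr compm1 r2 -p2.
- by apply: (is_iso_mono iq); rewrite !compA qr comp1m -!compA s1 q1 compA r3.
- apply: (is_iso_mono (is_iso_fmap S ib)).
  rewrite !compA q2 -(compA j1') qr compm1 r4 -fmapM su fmapM.
  by rewrite -!compA s2.
Qed.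

End Pretriangulated.

(** * Exact categories *)

Section ExactCategories.
Variable A : exact_category.

Lemma conf0 (X Y Z : A) (u : hom X Y) (v : hom Y Z) : conf u v -> v ∘ u = 0.
Proof. by move/conf_ker => [[]]. Qed.

Lemma conf_desc (X Y Z W : A) (u : hom X Y) (v : hom Y Z) (a : hom Y W) :
  conf u v -> a ∘ u = 0 -> exists b, b ∘ v = a.
Proof. by move=> /conf_ker[_ [_ h]] /h[b [e _]]; exists b. Qed.

Lemma conf_epi (X Y Z W : A) (u : hom X Y) (v : hom Y Z) (a b : hom Z W) :
  conf u v -> a ∘ v = b ∘ v -> a = b.
Proof.
move=> c e; have [_ [vu h]] := conf_ker c.
have [|d [_ U]] := h _ (a ∘ v); first by rewrite -compA vu compm0.
by rewrite -(U a) // -(U b).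
Qed.

Lemma conf_adm_mono (X Y Z : A) (u : hom X Y) (v : hom Y Z) :
  conf u v -> adm_mono (@conf A) u.
Proof. by exists Z, v. Qed.

Lemma adm_mono_iso (X Y Y' : A) (u : hom X Y) (t : hom Y Y') :
  is_iso t -> adm_mono (@conf A) u -> adm_mono (@conf A) (t ∘ u).
Proof.
move=> it [Z [v c]]; have := it => -[t' [tl tr]]; exists Z, (v ∘ t').
apply: (conf_iso (is_iso_idm X) it (is_iso_idm Z) _ _ c).
  by rewrite compm1.
by rewrite -compA tl comp1m compm1.
Qed.

(** An admissible monomorphism is part of a conflation with some cokernel, and cokernels
    are unique up to isomorphism. *)
Lemma adm_mono_coker (X Y Z : A) (u : hom X Y) (v : hom Y Z) :
  adm_mono (@conf A) u -> is_cokernel u v -> conf u v.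
Proof.
move=> [Z0 [v0 c]] [vu h].
have [a ea] := conf_desc c vu.
have [b [eb _]] := h _ _ (conf0 c).
have ab : a ∘ b = idm Z.
  have [d [_ U]] := h _ _ vu.
  by rewrite -(U (a ∘ b)) -?compA ?eb // (U (idm Z)) // comp1m.
have ba : b ∘ a = idm Z0 by apply: (conf_epi c); rewrite -compA ea eb comp1m.
have ia : is_iso a by exists b.
apply: (conf_iso (is_iso_idm X) (is_iso_idm Y) ia _ _ c).
  by rewrite comp1m compm1.
by rewrite compm1.
Qed.

Lemma pushout_epi (X Y X' Y' W : A) (u : hom X Y) (f : hom X X')
    (u' : hom X' Y') (f' : hom Y Y') (a b : hom Y' W) :
  is_pushout u f u' f' -> a ∘ f' = b ∘ f' -> a ∘ u' = b ∘ u' -> a = b.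
Proof.
move=> [s h] e e'; have [|c [_ U]] := h _ (a ∘ f') (a ∘ u').
  by rewrite -!compA s.
by rewrite -(U a) // -(U b).
Qed.

Lemma pushout_desc (X Y X' Y' W : A) (u : hom X Y) (f : hom X X')
    (u' : hom X' Y') (f' : hom Y Y') (a : hom Y W) (b : hom X' W) :
  is_pushout u f u' f' -> a ∘ u = b ∘ f -> exists c, c ∘ f' = a /\ c ∘ u' = b.
Proof. by move=> [_ h] /h[c [e _]]; exists c. Qed.

(** The exact structure provides a pushout along an admissible monomorphism that is
    again one; any other pushout is isomorphic to it, and pushouts preserve cokernels. *)
Lemma pushout_conf (X Y Z X' Y' : A) (u : hom X Y) (v : hom Y Z) (f : hom X X')
    (u' : hom X' Y') (f' : hom Y Y') :
  conf u v -> is_pushout u f u' f' ->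
  exists v' : hom Y' Z, conf u' v' /\ v' ∘ f' = v.
Proof.
move=> c po.
have [Y0 [u0 [f0 [po0 m0]]]] := adm_mono_pushout f (conf_adm_mono c).
have [t [t1 t2]] := pushout_desc po0 po.1.
have [r [r1 r2]] := pushout_desc po po0.1.
have it : is_iso t.
  exists r; split.
    by apply: (pushout_epi po0); rewrite -compA (t1, t2) (r1, r2) comp1m.
  by apply: (pushout_epi po); rewrite -compA (r1, r2) (t1, t2) comp1m.
have m : adm_mono (@conf A) u' by rewrite -t2; apply: adm_mono_iso.
have [|v' [v1 v2]] := pushout_desc po (a := v) (b := 0).
  by rewrite (conf0 c) comp0m.
exists v'; split=> //; apply: adm_mono_coker => //; split=> // W a au.
have [|s es] := conf_desc c (a := a ∘ f').
  by rewrite -compA po.1 compA au comp0m.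
exists s; split.
  by apply: (pushout_epi po); rewrite -compA ?v1 ?v2 ?compm0.
by move=> s' es'; apply: (conf_epi c); rewrite es -es' -compA v1.
Qed.

(** The inclusion of a summand is a pushout of the inflation from zero into the other
    summand. *)
Lemma biproduct_adm_mono (X Y B : A) (i1 : hom X B) (i2 : hom Y B)
    (p1 : hom B X) (p2 : hom B Y) :
  is_biproduct i1 i2 p1 p2 -> adm_mono (@conf A) i2.
Proof.
move=> [e11 e22 e12 e21 e].
have [K [k ck]] := adm_epi1 X.
have k0 : k = 0 by rewrite -[k]comp1m (conf0 ck).
(* The kernel of the identity of X is a zero object. *)
have po : is_pushout k (0 : hom K Y) i2 i1.
  split=> [|W a b _]; first by rewrite k0 !compm0.
  exists (a ∘ p1 + b ∘ p2); split.
    by rewrite !compDl -!compA e11 e22 e12 e21 !compm1 !compm0 addr0 add0r.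
  by move=> c [<- <-]; rewrite -!compA -compDr e compm1.
by have [v' [c _]] := pushout_conf ck po; apply: conf_adm_mono c.
Qed.

(** The sum of an identity and j is a pushout of j along the inclusion of the summand. *)
Lemma biproduct_adm_mono_r (X Y I B B' : A) (j : hom X I)
    (i1 : hom Y B) (i2 : hom X B) (p1 : hom B Y) (p2 : hom B X)
    (i1' : hom Y B') (i2' : hom I B') (p1' : hom B' Y) (p2' : hom B' I) :
  is_biproduct i1 i2 p1 p2 -> is_biproduct i1' i2' p1' p2' ->
  adm_mono (@conf A) j -> adm_mono (@conf A) (i1' ∘ p1 + i2' ∘ j ∘ p2).
Proof.
move=> [e11 e22 e12 e21 e] [e11' e22' e12' e21' e'] [Z [w c]].
set m := (_ + _).
have m1 : m ∘ i1 = i1' by rewrite compDl -!compA e11 e21 !compm0 compm1 addr0.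
have m2 : m ∘ i2 = i2' ∘ j by rewrite compDl -!compA e12 e22 compm0 compm1 add0r.
have pm1 : p1' ∘ m = p1.
  by rewrite compDr !compA e11' e12' comp1m !comp0m addr0.
have pm2 : p2' ∘ m = j ∘ p2.
  by rewrite compDr !compA e21' e22' comp1m !comp0m add0r.
have po : is_pushout j i2 m i2'.
  split=> // W a b s; exists (b ∘ i1 ∘ p1' + a ∘ p2'); split.
    rewrite !compDl -!compA e12' e22' !compm0 add0r compm1; split=> //.
    by rewrite pm1 pm2 (compA a) s -!compA -compDr e compm1.
  by move=> d [<- <-]; rewrite -(compA d m) m1 -!compA -compDr e' compm1.
by have [v' [c' _]] := pushout_conf c po; apply: conf_adm_mono c'.
Qed.

(** The map (f, j) is the inclusion of the second summand of Y (+) X, followed by the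
    shear automorphism of f and by the sum of the identity of Y and j. *)
Lemma adm_mono_graph (X Y I : A) (f : hom X Y) (j : hom X I) :
  adm_mono (@conf A) j ->
  exists (B : A) (i1 : hom Y B) (i2 : hom I B) (p1 : hom B Y) (p2 : hom B I),
    is_biproduct i1 i2 p1 p2 /\ adm_mono (@conf A) (i1 ∘ f + i2 ∘ j).
Proof.
move=> mj; have [_ bi] := exact_additive A.
have [B [i1 [i2 [p1 [p2 hB]]]]] := bi Y X.
have [B' [i1' [i2' [p1' [p2' hB']]]]] := bi Y I.
exists B', i1', i2', p1', p2'; split=> //.
have := hB => -[e11 e22 e12 e21 e].
(* The shear, and its inverse. *)
pose t := idm B + i1 ∘ f ∘ p2; pose t' := idm B - i1 ∘ f ∘ p2.
have z : (i1 ∘ f ∘ p2) ∘ (i1 ∘ f ∘ p2) = 0.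
  by rewrite -!compA (compA p2) e21 !(comp0m, compm0).
have it : is_iso t.
  exists t'; rewrite /t /t'; split.
    by rewrite compBl !compDr comp1m !compm1 comp1m z addr0 addrK.
  by rewrite compBr !compDl compm1 !comp1m compm1 z addr0 addrK.
have := adm_monoM (adm_mono_iso it (biproduct_adm_mono hB))
  (biproduct_adm_mono_r hB hB' mj).
have -> : t ∘ i2 = i2 + i1 ∘ f by rewrite compDl comp1m -!compA e22 compm1.
rewrite compDr !compDl -!compA (compA p1 i1) (compA p2 i1) e11 e22 e12 e21.
by rewrite !comp0m !comp1m !compm1 !compm0 add0r addr0 addrC.
Qed.

(** The map f between the cokernels of u and of v u is a pushout of v along i. *)
Lemma noether_conf (X Y Z U V W : A) (u : hom X Y) (i : hom Y U)
    (v : hom Y Z) (j : hom Z V) (k : hom Z W) (f : hom U W) (g : hom W V) :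
  conf u i -> conf v j -> conf (v ∘ u) k -> f ∘ i = k ∘ v -> g ∘ k = j ->
  conf f g.
Proof.
move=> cu cv cvu fi gk.
have po : is_pushout v i f k.
  split=> // T a b s.
  have [|c ec] := conf_desc cvu (a := a).
    by rewrite compA s -compA (conf0 cu) compm0.
  exists c; split.
    by split=> //; apply: (conf_epi cu); rewrite -compA fi compA ec s.
  by move=> c' [ec' _]; apply: (conf_epi cvu); rewrite ec ec'.
have [g' [c eg]] := pushout_conf cv po.
suff -> : g = g' by [].
by apply: (conf_epi cvu); rewrite gk eg.
Qed.

Lemma conf_opp (X Y Z : A) (u : hom X Y) (v : hom Y Z) : conf u v -> conf u (- v).
Proof.
move=> c; have i : is_iso (- idm Z).
  by exists (- idm Z); rewrite compNl compNr opprK comp1m.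
apply: (conf_iso (is_iso_idm X) (is_iso_idm Y) i _ _ c).
  by rewrite comp1m compm1.
by rewrite compNl comp1m compm1.
Qed.

End ExactCategories.

(** * The stable category of a Frobenius category *)

Section StableCategory.
Variable A : frobenius_category.
Local Notation S := (susp (St A)).
Local Notation "[ f ]" := (stable_class f : @hom (St A) _ _) (f at level 99).

Lemma stable_classM (X Y Z : A) (g : hom Y Z) (f : hom X Y) :
  [g ∘ f] = [g] ∘ [f].
Proof. by rewrite [RHS]stable_compE. Qed.

Lemma stable_class0 (X Y : A) : [0 : hom X Y] = 0.
Proof. by apply: (addrI [0 : hom X Y]); rewrite -stable_classD !addr0. Qed.

Lemma stable_classN (X Y : A) (f : hom X Y) : [- f] = - [f].
Proof. by apply: (addrI [f]); rewrite -stable_classD !subrr stable_class0. Qed.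

Lemma stable_classB (X Y : A) (f g : hom X Y) : [f - g] = [f] - [g].
Proof. by rewrite stable_classD stable_classN. Qed.

Lemma stable_class_proj (X Y P : A) (b : hom P Y) (a : hom X P) :
  projective P -> [b ∘ a] = 0.
Proof.
move=> hP; rewrite -(stable_class0 X Y); apply/stable_eqP; rewrite subr0.
by exists P, a, b.
Qed.

Lemma stable_class_eq0 (X Y : A) (f : hom X Y) : [f] = 0 -> factors_projective f.
Proof. by rewrite -(stable_class0 X Y) => /stable_eqP; rewrite subr0. Qed.

Lemma hull_proj (X : A) : projective (hull_ob (the_hull X)).
Proof. by apply/proj_inj/hull_inj. Qed.

Lemma stable_repr (X Y : A) (f : @hom (St A) X Y) : exists f', [f'] = f.
Proof. by exists (repr f); exact: stable_classK. Qed.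

Lemma proj_extend (X Y P Z : A) (u : hom X Y) (v : hom Y Z) (p : hom X P) :
  conf u v -> projective P -> exists r : hom Y P, r ∘ u = p.
Proof. by move=> c /proj_inj h; apply: h; exists Z, v. Qed.

(** Take (f, j) with j an injective hull; the projection to Y is a stable isomorphism,
    because its kernel is injective, hence projective. *)
Lemma adm_mono_replace (X Y : A) (f : hom X Y) :
  exists (Y' : A) (u : hom X Y') (q : hom Y' Y),
    [/\ adm_mono (@conf A) u, q ∘ u = f & is_iso [q]].
Proof.
have mj := conf_adm_mono (hull_conf (the_hull X)).
have [B [i1 [i2 [p1 [p2 [[e11 e22 e12 e21 e] m]]]]]] := adm_mono_graph f mj.
exists B, (i1 ∘ f + i2 ∘ hull_u (the_hull X)), p1; split=> //.
  by rewrite compDr !compA e11 e12 comp1m comp0m addr0.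
exists [i1]; rewrite -!stable_classM e11; split=> //.
transitivity [idm B] => //.
by rewrite -e stable_classD (stable_class_proj i2 p2 (@hull_proj X)) addr0.
Qed.

Definition ses_w (E : ses A) : @hom (St A) (ses3 E) (S (ses1 E)) :=
  ext_class (idm (ses1 E)).

Lemma ses_wP (E : ses A) : exists (a : hom (ses2 E) (hull_ob (the_hull (ses1 E)))) b,
  [/\ a ∘ ses_u E = hull_u _, b ∘ ses_v E = hull_v _ ∘ a & ses_w E = [b]].
Proof.
have [[a b] h] := hull_ext_exists (idm (ses1 E)); exists a, b.
by have [/= e1 e2] := h; rewrite e1 compm1 e2 /ses_w (ext_classE h).
Qed.

(** The defect of commutativity factors through a projective, hence injective, object P.
    The map to P extends along the admissible monomorphism, and subtracting the
    extension removes the defect without changing the stable class of b. *)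
Lemma ses_mor_strictify (E E' : ses A) (a : hom (ses1 E) (ses1 E'))
    (b : hom (ses2 E) (ses2 E')) :
  [b] ∘ [ses_u E] = [ses_u E'] ∘ [a] ->
  exists s : ses_mor E E', ses_mor1 s = a /\ [ses_mor2 s] = [b].
Proof.
rewrite -!stable_classM => /stable_eqP[P [p [q [hP e]]]].
have [r er] := proj_extend p (sesP E) hP.
pose b' := b - q ∘ r.
have sq : b' ∘ ses_u E = ses_u E' ∘ a.
  by rewrite compBl -compA er -e opprB addrC subrK.
have [|c ec] := conf_desc (sesP E) (a := ses_v E' ∘ b').
  by rewrite -compA sq compA (conf0 (sesP E')) comp0m.
exists (SesMor sq ec); split=> //=.
by rewrite /b' stable_classB stable_class_proj // subr0.
Qed.

(** Correcting the middle component by a null map that agrees with it on X, one sees that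
    the third component is v' δ for some δ with δ v null.  Write δ v as a map from Y to
    a projective P, followed by another map.  The restriction to X of the map to P
    extends over the injective hull I of X, so the map to P is the sum of one through
    Y -> I and one through v.  After subtracting a null map from δ, the composite δ v
    therefore factors through Y -> I, and the factor from I induces the required e. *)
Lemma ses_mor_null (E E' : ses A) (s : ses_mor E E') :
  [ses_mor1 s] = 0 -> [ses_mor2 s] = 0 ->
  exists e : @hom (St A) (S (ses1 E)) (ses2 E'),
    [ses_mor3 s] = [ses_v E'] ∘ e ∘ ses_w E.
Proof.
move=> /stable_class_eq0[P [p [q [hP e1]]]] /stable_class_eq0[P' [l0 [m0 [hP' e2]]]].
have cE := sesP E.
have [r er] := proj_extend p cE hP.
pose d := ses_mor2 s - ses_u E' ∘ q ∘ r.
have [|δ eδ] := conf_desc cE (a := d).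
  by rewrite compBl ses_squ e1 -!compA er subrr.
have s3 : ses_mor3 s = ses_v E' ∘ δ.
  apply: (conf_epi cE); rewrite ses_sqv -compA eδ compBr !compA.
  by rewrite (conf0 (sesP E')) !comp0m subr0.
have [a [b [ea eb ew]]] := ses_wP E.
have [k ek] := proj_extend (l0 ∘ ses_u E) (hull_conf (the_hull (ses1 E))) hP'.
have [k2 ek2] := proj_extend (r ∘ ses_u E) (hull_conf (the_hull (ses1 E))) hP.
have [|t et] := conf_desc cE (a := l0 - k ∘ a).
  by rewrite compBl -compA ea ek subrr.
have [|t2 et2] := conf_desc cE (a := r - k2 ∘ a).
  by rewrite compBl -compA ea ek2 subrr.
(* δ' differs from δ by null maps, and δ' v factors through the hull of X as n a. *)
pose δ' := δ - m0 ∘ t + ses_u E' ∘ q ∘ t2.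
pose n := m0 ∘ k - ses_u E' ∘ q ∘ k2.
have eδ' : δ' ∘ ses_v E = n ∘ a.
  have aux (V : zmodType) (x y z w : V) : x - y - (x - z) + (y - w) = z - w.
    by rewrite opprB [x - y + _]addrC !addrA !subrK.
  by rewrite compDl !compBl -!compA eδ et et2 /d e2 !compBr !compA aux.
have [|e0 ee0] := conf_desc (hull_conf (the_hull (ses1 E))) (a := n).
  by rewrite -ea compA -eδ' -compA (conf0 cE) compm0.
have e0b : e0 ∘ b = δ'.
  by apply: (conf_epi cE); rewrite eδ' -ee0 -!compA eb.
exists [e0]; rewrite ew s3 stable_classM -compA -(stable_classM e0 b) e0b.
congr (_ ∘ _); rewrite /δ' stable_classD stable_classB.
by rewrite (stable_class_proj m0 t hP') subr0 (stable_class_proj (_ ∘ q) t2 hP) addr0.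
Qed.

(** The pushout P of the conflation X -> Y -> Z along the injective hull X -> I is an
    extension both of the suspension of X by Y and of Z by I.  The second extension
    splits, so P represents Z in the stable category, and the first one represents the
    rotated triangle.  The sign of the rotated triangle is put on the map from P to the
    suspension. *)
Record rotation (E : ses A) := Rotation {
  rt_ob : A;
  rt_f : hom (ses2 E) rt_ob;
  rt_u : hom (hull_ob (the_hull (ses1 E))) rt_ob;
  rt_p : hom rt_ob (hull_susp (the_hull (ses1 E)));
  rt_v : hom rt_ob (ses3 E);
  rt_pushout : is_pushout (hull_u (the_hull (ses1 E))) (ses_u E) rt_f rt_u;
  rt_pf : rt_p ∘ rt_f = 0;
  rt_pu : rt_p ∘ rt_u = hull_v _;
  rt_vf : rt_v ∘ rt_f = ses_v E;
  rt_vu : rt_v ∘ rt_u = 0;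
  rt_conf : conf rt_f (- rt_p);
  rt_v_iso : is_iso [rt_v]
}.

Lemma is_pushout_sym (X Y X' Y' : A) (u : hom X Y) (f : hom X X')
    (u' : hom X' Y') (f' : hom Y Y') :
  is_pushout u f u' f' -> is_pushout f u f' u'.
Proof.
move=> [s h]; split=> // W a b e; have [c [[c1 c2] U]] := h _ b a (esym e).
by exists c; split=> // c' [? ?]; apply: U.
Qed.

(** The section s of v comes from a retraction of the inflation from the injective hull,
    and s v differs from the identity by a map through that hull. *)
Lemma rotation_exists (E : ses A) : exists r : rotation E, True.
Proof.
have cE := sesP E; have cH := hull_conf (the_hull (ses1 E)).
have [P [f [u [po _]]]] := adm_mono_pushout (ses_u E) (conf_adm_mono cH).
have [p [cp pu]] := pushout_conf cH po.
have [v [cv vf]] := pushout_conf cE (is_pushout_sym po).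
suff iv : is_iso [v].
  by exists (Rotation po (conf0 cp) pu vf (conf0 cv) (conf_opp cp) iv).
have [r er] := proj_extend (idm _) cv (@hull_proj (ses1 E)).
have [|s es] := conf_desc cv (a := idm P - u ∘ r).
  by rewrite compBl comp1m -compA er compm1 subrr.
exists [s]; rewrite -!stable_classM es; split.
  by rewrite stable_classB (stable_class_proj _ _ (@hull_proj _)) subr0.
suff -> : v ∘ s = idm _ by [].
apply: (conf_epi cv); rewrite -compA es compBr compA (conf0 cv) comp0m subr0.
by rewrite compm1 comp1m.
Qed.

Definition the_rotation (E : ses A) : rotation E := sval (cid (rotation_exists E)).
Definition rot_ses (E : ses A) : ses A := Ses (rt_conf (the_rotation E)).

(** On both legs of the pushout, b v + p agrees with the composite through the hull
    of the map that extends a and the identity. *)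
Lemma rot_ses_v (E : ses A) : [ses_v (rot_ses E)] = ses_w E ∘ [rt_v (the_rotation E)].
Proof.
have [a [b [ea eb ->]]] := ses_wP E; set R := the_rotation E.
have po := rt_pushout R.
(* k is the identity on the hull and a on the middle term. *)
have [|k [k1 k2]] := pushout_desc po (a := idm _) (b := a); first by rewrite comp1m.
rewrite -stable_classM /= -/R; apply/esym/eqP; rewrite -subr_eq0 -stable_classB opprK.
suff -> : b ∘ rt_v R + rt_p R = hull_v _ ∘ k.
  by rewrite stable_class_proj //; apply: hull_proj.
apply: (pushout_epi po); rewrite compDl -!compA.
  by rewrite rt_vu rt_pu k1 compm0 add0r compm1.
by rewrite rt_vf rt_pf k2 addr0.
Qed.

Lemma rot_ses_w (E : ses A) : ses_w (rot_ses E) = - fmap S [ses_u E].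
Proof.
set R := the_rotation E; have po := rt_pushout R.
have [[c d] k] := hull_ext_exists (E := hull_ses (ses1 E)) (ses_u E).
have -> : fmap S [ses_u E] = [d] by apply: (stable_susp_mapE k).
have [/= k1 k2] := k.
have [a' [a1 a2]] := pushout_desc po k1.
rewrite -stable_classN.
apply: (ext_classE (E := rot_ses E) (ab := (a', - d))); split=> /=.
  by rewrite compm1.
rewrite compNl compNr opprK; apply: (pushout_epi po); rewrite -!compA.
  by rewrite rt_pu a1.
by rewrite rt_pf a2 compm0 (conf0 (hull_conf _)).
Qed.

(** The pushout property makes rotation functorial on strict morphisms. *)
Lemma rot_ses_mor (E E' : ses A) (s : ses_mor E E') :
  exists t : ses_mor (rot_ses E) (rot_ses E'),
  [/\ ses_mor1 t = ses_mor2 s,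
      rt_v (the_rotation E') ∘ ses_mor2 t = ses_mor3 s ∘ rt_v (the_rotation E)
    & [ses_mor3 t] = fmap S [ses_mor1 s]].
Proof.
set R := the_rotation E; set R' := the_rotation E'.
have po := rt_pushout R; have po' := rt_pushout R'.
have [[c d] k] := hull_ext_exists (E := hull_ses (ses1 E)) (ses_mor1 s).
have [/= k1 k2] := k.
have [|y [y1 y2]] := pushout_desc po (a := rt_u R' ∘ c) (b := rt_f R' ∘ ses_mor2 s).
  by rewrite -!compA k1 ses_squ !compA po'.1.
have sq2 : d ∘ - rt_p R = - rt_p R' ∘ y.
  rewrite compNl compNr; congr (- _); apply: (pushout_epi po); rewrite -!compA.
    by rewrite rt_pu y1 compA rt_pu k2.
  by rewrite rt_pf y2 compA rt_pf compm0 comp0m.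
exists (@SesMor _ (rot_ses E) (rot_ses E') (ses_mor2 s) y d y2 sq2).
split=> //=; last exact/esym/(stable_susp_mapE k).
apply: (pushout_epi po); rewrite -!compA.
  by rewrite y1 (compA (rt_v R')) !rt_vu comp0m compm0.
by rewrite y2 (compA (rt_v R')) !rt_vf ses_sqv.
Qed.

(** An identification of a triangle with the standard triangle of E rotates: the new
    middle component is determined by c through the stable isomorphism from P to Z. *)
Lemma rot_tri (X Y Z : St A) (f : hom X Y) (g : hom Y Z) (h : hom Z (S X)) (E : ses A)
    (a : @hom (St A) X (ses1 E)) (b : @hom (St A) Y (ses2 E)) (c : @hom (St A) Z (ses3 E)) :
  is_iso a -> is_iso b -> is_iso c ->
  b ∘ f = [ses_u E] ∘ a -> c ∘ g = [ses_v E] ∘ b -> fmap S a ∘ h = ses_w E ∘ c ->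
  exists c' : @hom (St A) Z (ses2 (rot_ses E)),
    [/\ is_iso c', [rt_v (the_rotation E)] ∘ c' = c,
      c' ∘ g = [ses_u (rot_ses E)] ∘ b,
      fmap S a ∘ h = [ses_v (rot_ses E)] ∘ c' &
      fmap S b ∘ - fmap S f = ses_w (rot_ses E) ∘ fmap S a].
Proof.
move=> ia ib ic e1 e2 e3; set R := the_rotation E.
have iv := rt_v_iso R; have [s [sv vs]] := iv; exists (s ∘ c).
have r : [rt_v R] ∘ (s ∘ c) = c by rewrite compA vs comp1m.
split=> //.
- by apply: is_iso_comp ic; exists [rt_v R].
- by apply: (is_iso_mono iv); rewrite !compA vs comp1m e2 -stable_classM rt_vf.
- by rewrite rot_ses_v e3 -compA r.
- by rewrite rot_ses_w compNr compNl -!fmapM e1.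
Qed.

Lemma stable_zero (Z : A) : is_zero Z -> is_zero (Z : St A).
Proof.
move=> z; apply: is_zeroP; have /(_ (idm Z)) e := (z Z).1.
by change ([idm Z] = 0); rewrite e stable_class0.
Qed.

Lemma stable_additive : additive_category (St A).
Proof.
have [[Z z] bi] := exact_additive A; split; first by exists Z; apply: stable_zero.
move=> X Y; have [B [i1 [i2 [p1 [p2 [e1 e2 e3 e4 e]]]]]] := bi X Y.
exists B, [i1], [i2], [p1], [p2]; split; rewrite -!stable_classM ?e1 ?e2 ?e3 ?e4 //.
- exact: stable_class0.
- exact: stable_class0.
- by rewrite -stable_classD e.
Qed.

Lemma stable_exactP (T : triangle (St A)) (E : ses A)
    (a : @hom (St A) (tri1 T) (ses1 E)) (b : @hom (St A) (tri2 T) (ses2 E))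
    (c : @hom (St A) (tri3 T) (ses3 E)) :
  is_iso a -> is_iso b -> is_iso c ->
  b ∘ tri_f T = [ses_u E] ∘ a -> c ∘ tri_g T = [ses_v E] ∘ b ->
  fmap S a ∘ tri_h T = ses_w E ∘ c -> stable_exact T.
Proof.
case: T a b c => X Y Z f g h /= a b c ia ib ic e1 e2 e3; exists E.
exact: (@tri_isomorphicP (St A) _ _ _ (ses1 E) (ses2 E) (ses3 E)
  f g h [ses_u E] [ses_v E] (ses_w E) a b c).
Qed.

Lemma id_conf (X : A) : exists (Z : A) (v : hom X Z), is_zero Z /\ conf (idm X) v.
Proof.
have [Z [v c]] := adm_mono1 X; exists Z, v; split=> //; apply: is_zeroP.
apply: (conf_epi c); rewrite comp0m comp1m.
by rewrite -[v]compm1 (conf0 c).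
Qed.

(** Fillers between standard triangles come from strictifying a square.  The suspension
    is assumed to be an equivalence here because this is inherited from the given
    triangulated category. *)
Lemma stable_pretriangulated :
  is_equivalence S -> pretriangulated (@stable_exact A).
Proof.
move=> hS; split=> //.
- exact: stable_additive.
- move=> T T' i [E j]; exists E; apply: tri_isomorphic_trans j.
  exact: tri_isomorphic_sym.
- move=> X Z z; have [Z' [v [/stable_zero z' c]]] := id_conf X.
  apply: (@stable_exactP (@Triangle (St A) X X Z (idm (X : St A)) 0 0) (Ses c)
    (idm (X : St A)) (idm (X : St A)) 0).
  + exact: is_iso_idm.
  + exact: is_iso_idm.
  + by exists 0; split; [apply: zero_into z | apply: zero_into z'].
  + by [].
  + exact: zero_into z'.
  + exact: zero_from z.
- move=> X Y Z f g h [E [[a b c /= e1 e2 e3] [/= ia ib ic]]].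
  have [c' [ic' _ r1 r2 r3]] := rot_tri ia ib ic e1 e2 e3.
  exact: (@stable_exactP (@Triangle (St A) Y Z (S X) g h (- fmap S f)) (rot_ses E)
    b c' (fmap S a) ib ic' (is_iso_fmap S ia) r1 r2 r3).
move=> T T' [E i] [E' i']; apply: (fills_iso i i') => a b sq.
have [a0 ea] := stable_repr a; have [b0 eb] := stable_repr b.
have [|s [s1 s2]] := @ses_mor_strictify E E' a0 b0; first by rewrite ea eb.
by exists (ses_tri_mor s); rewrite /= s1 s2.
Qed.

End StableCategory.

(** * Transport along the equivalence with the stable category *)

Section Transfer.
Variables (C : triangulated_category) (A : frobenius_category).
Variable F : triangle_equivalence C A.
Local Notation S := (susp C).
Local Notation SA := (susp (St A)).
Local Notation "[ f ]" := (stable_class f : @hom (St A) _ _) (f at level 99).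

Let hF : is_equivalence F := te_equiv F.

(** Up to the isomorphisms of F with the suspensions, the suspension of the stable
    category is the one of C. *)
Lemma stable_susp_equiv : is_equivalence SA.
Proof.
have hS := triang_susp (tri_catP C).
split=> [P Q|Q]; last first.
  have [Y [q iq]] := hF.2 Q; have [X [x ix]] := hS.2 Y.
  have [t [tl tr]] := te_susp_iso F X.
  exists (F X), (q ∘ fmap F x ∘ t); apply: is_iso_comp; last by exists (te_susp F X).
  by apply: is_iso_comp iq _; apply: is_iso_fmap.
have [X [p ip]] := hF.2 P; have [Y [q iq]] := hF.2 Q.
have [p' [pl pr]] := ip; have [q' [ql qr]] := iq.
have [iX iY] := (te_susp_iso F X, te_susp_iso F Y).
apply: inj_surj_bijective => [f f' e|k].
  have [g eg] := equiv_full hF (q' ∘ f ∘ p).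
  have [g' eg'] := equiv_full hF (q' ∘ f' ∘ p).
  suff : g = g'.
    move=> gg; have : q' ∘ f ∘ p = q' ∘ f' ∘ p by rewrite -eg -eg' gg.
    by move/(is_iso_epi ip)/(is_iso_mono (is_iso_inv ql qr)).
  apply: (equiv_faithful hS); apply: (equiv_faithful hF); apply: (is_iso_mono iY).
  by rewrite !te_susp_nat eg eg' !fmapM e.
have [tY [tYl tYr]] := iY; have [tX [tXl tXr]] := iX.
have [g1 eg1] := equiv_full hF (tY ∘ fmap SA q' ∘ k ∘ fmap SA p ∘ te_susp F X).
have [g eg] := equiv_full hS g1.
exists (q ∘ fmap F g ∘ p').
apply: (is_iso_epi (is_iso_fmap SA ip)); rewrite -fmapM -compA pl compm1 fmapM.
apply: (is_iso_epi iX); rewrite -compA -te_susp_nat eg eg1.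
by rewrite !compA -(compA _ _ tY) tYr compm1 -fmapM qr fmap1 comp1m.
Qed.

Let ptA := stable_pretriangulated stable_susp_equiv.
Let ptC := triangulated_pretriangulated (tri_catP C).

Lemma te_exact_tri (T : triangle C) : exact_tri T -> stable_exact (te_triangle F T).
Proof. by case: T => X Y Z f g h e; apply: te_exact. Qed.

(** Compare with the image of an exact triangle on the same first map; the isomorphism
    between the two comes from C because F is fully faithful. *)
Lemma exact_tri_reflect (T : triangle C) : stable_exact (te_triangle F T) -> exact_tri T.
Proof.
case: T => X Y Z f g h e; have [Z' [g' [h' e']]] := triang_cone (tri_catP C) f.
have [c [ic]] := pt_fill_iso ptA e (te_exact_tri e') (is_iso_idm _) (is_iso_idm _)
  (etrans (comp1m _) (esym (compm1 _))).
rewrite compm1 fmap1 comp1m /=.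
have [c0 ec] := equiv_full hF c; subst c; rewrite -fmapM => /(equiv_faithful hF) e1.
rewrite -compA -fmapM => /(is_iso_mono (te_susp_iso F X))/(equiv_faithful hF) e2.
apply: (pt_iso ptC) e'; apply: tri_isomorphic_sym.
apply: (tri_isomorphicP (is_iso_idm _) (is_iso_idm _) (equiv_iso hF ic)).
- by rewrite comp1m compm1.
- by rewrite compm1.
- by rewrite fmap1 comp1m.
Qed.

Definition qi_ob (P : St A) : C := sval (cid (hF.2 P)).
Definition qi_iso (P : St A) : hom (F (qi_ob P)) P := sval (cid (svalP (cid (hF.2 P)))).
Lemma qi_isoP (P : St A) : is_iso (qi_iso P).
Proof. exact: svalP (cid (svalP (cid (hF.2 P)))). Qed.

Lemma qi_full (P : St A) (X : C) (p : hom (F X) P) :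
  exists g : hom X (qi_ob P), qi_iso P ∘ fmap F g = p.
Proof.
have [e' [l r]] := qi_isoP P; have [g eg] := equiv_full hF (e' ∘ p).
by exists g; rewrite eg compA r comp1m.
Qed.

Lemma qi_faithful (P : St A) (X : C) (g g' : hom X (qi_ob P)) :
  qi_iso P ∘ fmap F g = qi_iso P ∘ fmap F g' -> g = g'.
Proof. by move/(is_iso_mono (qi_isoP P))/(equiv_faithful hF). Qed.

Definition qi_map (P Q : St A) (f : hom P Q) : hom (qi_ob P) (qi_ob Q) :=
  sval (cid (qi_full (f ∘ qi_iso P))).

Lemma qi_map_nat (P Q : St A) (f : hom P Q) :
  qi_iso Q ∘ fmap F (qi_map f) = f ∘ qi_iso P.
Proof. exact: svalP (cid (qi_full _)). Qed.

Definition quasi_inverse : additive_functor (St A) C.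
Proof.
refine (@AdditiveFunctor (St A) C qi_ob qi_map _ _ _).
- by move=> X; apply: qi_faithful; rewrite qi_map_nat fmap1 comp1m compm1.
- move=> X Y Z g f; apply: qi_faithful.
  by rewrite qi_map_nat fmapM compA qi_map_nat -!compA qi_map_nat.
- move=> X Y f g; apply: qi_faithful.
  by rewrite qi_map_nat fmapD compDl compDr !qi_map_nat.
Defined.
Local Notation G := quasi_inverse.

Lemma quasi_inverse_nat (P Q : St A) (f : hom P Q) :
  qi_iso Q ∘ fmap F (fmap G f) = f ∘ qi_iso P.
Proof. exact: qi_map_nat. Qed.

Lemma qi_susp_iso (P : St A) : is_iso (fmap SA (qi_iso P) ∘ te_susp F (G P)).
Proof. apply: is_iso_comp (te_susp_iso F _); apply: is_iso_fmap; exact: qi_isoP. Qed.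

Lemma qi_w_exists (E : ses A) : exists h : hom (G (ses3 E)) (S (G (ses1 E))),
  fmap SA (qi_iso _) ∘ (te_susp F _ ∘ fmap F h) = ses_w E ∘ qi_iso _.
Proof.
have [t [l r]] := qi_susp_iso (ses1 E).
have [h eh] := equiv_full hF (t ∘ (ses_w E ∘ qi_iso _)).
by exists h; rewrite eh !compA r comp1m.
Qed.

(** The third map is the preimage of the class of the extension under the
    identifications of F G with the identity and of the two suspensions. *)
Definition qi_w (E : ses A) := sval (cid (qi_w_exists E)).
Lemma qi_wP (E : ses A) :
  fmap SA (qi_iso _) ∘ (te_susp F _ ∘ fmap F (qi_w E)) = ses_w E ∘ qi_iso _.
Proof. exact: svalP (cid (qi_w_exists E)). Qed.

Definition qi_triangle (E : ses A) : triangle C :=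
  Triangle (fmap G [ses_u E]) (fmap G [ses_v E]) (qi_w E).

Definition qi_lift (E : ses A) : tri_mor (te_triangle F (qi_triangle E)) (ses_triangle E) :=
  @TriMor (St A) (te_triangle F (qi_triangle E)) (ses_triangle E)
    (qi_iso _) (qi_iso _) (qi_iso _)
    (quasi_inverse_nat _) (quasi_inverse_nat _) (qi_wP E).

Lemma qi_lift_iso (E : ses A) : tri_is_iso (qi_lift E).
Proof. by split; apply: qi_isoP. Qed.

Lemma qi_triangle_exact (E : ses A) : exact_tri (qi_triangle E).
Proof.
by apply: exact_tri_reflect; exists E, (qi_lift E); apply: qi_lift_iso.
Qed.

Lemma qi_triangle_mor_h (E E' : ses A) (s : ses_mor E E') :
  fmap S (fmap G [ses_mor1 s]) ∘ qi_w E = qi_w E' ∘ fmap G [ses_mor3 s].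
Proof.
apply: (equiv_faithful hF); apply: (is_iso_mono (qi_susp_iso _)).
have m3 : fmap SA [ses_mor1 s] ∘ ses_w E = ses_w E' ∘ [ses_mor3 s] :=
  mor_sqh (ses_tri_mor s).
rewrite !fmapM -!compA (compA (te_susp F _) (fmap F (qi_w E'))).
rewrite (compA (fmap SA _) _ (fmap F (fmap G _))) qi_wP.
rewrite -[RHS]compA quasi_inverse_nat [RHS]compA -m3 -[RHS]compA -qi_wP.
rewrite (compA (te_susp F _)) te_susp_nat !compA.
by rewrite -(fmapM SA (qi_iso _) (fmap F _)) quasi_inverse_nat fmapM.
Qed.

Definition qi_tri_mor (E E' : ses A) (s : ses_mor E E') :
  tri_mor (qi_triangle E) (qi_triangle E').
Proof.
refine (@TriMor C (qi_triangle E) (qi_triangle E')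
  (fmap G [ses_mor1 s]) (fmap G [ses_mor2 s]) (fmap G [ses_mor3 s]) _ _
  (qi_triangle_mor_h s)).
- by rewrite -!(fmapM G) -!stable_classM ses_squ.
- by rewrite -!(fmapM G) -!stable_classM ses_sqv.
Defined.

Lemma qi_is_lift (E E' : ses A) (s : ses_mor E E') :
  is_lift (te_tri_mor F (qi_tri_mor s)) (qi_lift E) (qi_lift E') s.
Proof. by split; rewrite /= quasi_inverse_nat. Qed.

Section Lifted.

(** A triple of maps is lifted if it comes from a morphism of exact sequences under the
    given identifications with standard triangles.  Unlike a morphism of triangles,
    it is recorded with three separate components, because these are varied and
    subtracted individually. *)
Definition lifted (T T' : triangle C) (E E' : ses A)
    (i : tri_mor (te_triangle F T) (ses_triangle E))
    (i' : tri_mor (te_triangle F T') (ses_triangle E'))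
    (a : hom (tri1 T) (tri1 T')) (b : hom (tri2 T) (tri2 T'))
    (c : hom (tri3 T) (tri3 T')) : Prop :=
  exists s : ses_mor E E',
    [/\ [ses_mor1 s] ∘ mor1 i = mor1 i' ∘ fmap F a,
        [ses_mor2 s] ∘ mor2 i = mor2 i' ∘ fmap F b
      & [ses_mor3 s] ∘ mor3 i = mor3 i' ∘ fmap F c].

Lemma lifted_comp (T T' T'' : triangle C) (E E' E'' : ses A)
    (i : tri_mor (te_triangle F T) (ses_triangle E))
    (i' : tri_mor (te_triangle F T') (ses_triangle E'))
    (i'' : tri_mor (te_triangle F T'') (ses_triangle E'')) a b c a' b' c' :
  lifted i i' a b c -> lifted i' i'' a' b' c' ->
  lifted i i'' (a' ∘ a) (b' ∘ b) (c' ∘ c).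
Proof.
move=> [s [s1 s2 s3]] [t [t1 t2 t3]].
have q1 : (ses_mor2 t ∘ ses_mor2 s) ∘ ses_u E = ses_u E'' ∘ (ses_mor1 t ∘ ses_mor1 s).
  by rewrite -compA ses_squ !compA ses_squ.
have q2 : (ses_mor3 t ∘ ses_mor3 s) ∘ ses_v E = ses_v E'' ∘ (ses_mor2 t ∘ ses_mor2 s).
  by rewrite -compA ses_sqv !compA ses_sqv.
exists (SesMor q1 q2); split; rewrite /= stable_classM (fmapM F) -compA.
- by rewrite s1 !compA t1.
- by rewrite s2 !compA t2.
- by rewrite s3 !compA t3.
Qed.

Lemma lifted_sub (T T' : triangle C) (E E' : ses A)
    (i : tri_mor (te_triangle F T) (ses_triangle E))
    (i' : tri_mor (te_triangle F T') (ses_triangle E')) a b c a' b' c' :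
  lifted i i' a b c -> lifted i i' a' b' c' ->
  lifted i i' (a - a') (b - b') (c - c').
Proof.
move=> [s [s1 s2 s3]] [t [t1 t2 t3]].
have q1 : (ses_mor2 s - ses_mor2 t) ∘ ses_u E = ses_u E' ∘ (ses_mor1 s - ses_mor1 t).
  by rewrite compBl compBr !ses_squ.
have q2 : (ses_mor3 s - ses_mor3 t) ∘ ses_v E = ses_v E' ∘ (ses_mor2 s - ses_mor2 t).
  by rewrite compBl compBr !ses_sqv.
exists (SesMor q1 q2).
by split; rewrite /= stable_classB fmapB compBl compBr (s1, s2, s3) (t1, t2, t3).
Qed.

Variables (T T' : triangle C) (E E' : ses A).
Variables (i : tri_mor (te_triangle F T) (ses_triangle E))
    (i' : tri_mor (te_triangle F T') (ses_triangle E')).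
Hypotheses (ii : tri_is_iso i) (ii' : tri_is_iso i').

Lemma lifted_fill a b :
  b ∘ tri_f T = tri_f T' ∘ a -> exists c, lifted i i' a b c.
Proof.
move=> sq; have [i1 i2 i3] := ii; have [i1' i2' i3'] := ii'.
have [j1 [l1 r1]] := i1; have [j2 [l2 r2]] := i2; have [j3 [l3 r3]] := i3'.
have [a0 ea] := stable_repr (mor1 i' ∘ fmap F a ∘ j1).
have [b0 eb] := stable_repr (mor2 i' ∘ fmap F b ∘ j2).
have ef : mor2 i ∘ fmap F (tri_f T) = [ses_u E] ∘ mor1 i := mor_sqf i.
have ef' : mor2 i' ∘ fmap F (tri_f T') = [ses_u E'] ∘ mor1 i' := mor_sqf i'.
have [|s [s1 s2]] := @ses_mor_strictify A E E' a0 b0.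
  apply: (is_iso_epi i1); rewrite ea eb -!compA -ef l1 compm1.
  by rewrite (compA j2) l2 comp1m -fmapM sq fmapM (compA (mor2 i')) ef' -compA.
have [c ec] := equiv_full hF (j3 ∘ [ses_mor3 s] ∘ mor3 i).
exists c, s; rewrite s1 s2 ea eb ec -!compA l1 l2 !compm1; split=> //.
by rewrite (compA (mor3 i')) r3 comp1m.
Qed.

Lemma lifted_mor a b c : lifted i i' a b c ->
  c ∘ tri_g T = tri_g T' ∘ b /\ fmap S a ∘ tri_h T = tri_h T' ∘ c.
Proof.
move=> [s [s1 s2 s3]]; have [i1' i2' i3'] := ii'.
have eg : mor3 i ∘ fmap F (tri_g T) = [ses_v E] ∘ mor2 i := mor_sqg i.
have eg' : mor3 i' ∘ fmap F (tri_g T') = [ses_v E'] ∘ mor2 i' := mor_sqg i'.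
have eh : fmap SA (mor1 i) ∘ (te_susp F _ ∘ fmap F (tri_h T)) = ses_w E ∘ mor3 i :=
  mor_sqh i.
have eh' : fmap SA (mor1 i') ∘ (te_susp F _ ∘ fmap F (tri_h T')) = ses_w E' ∘ mor3 i' :=
  mor_sqh i'.
have mg : [ses_mor3 s] ∘ [ses_v E] = [ses_v E'] ∘ [ses_mor2 s] := mor_sqg (ses_tri_mor s).
have mh : fmap SA [ses_mor1 s] ∘ ses_w E = ses_w E' ∘ [ses_mor3 s] :=
  mor_sqh (ses_tri_mor s).
split; apply: (equiv_faithful hF).
  apply: (is_iso_mono i3'); rewrite !(fmapM F) !compA -s3 eg' -[LHS]compA eg.
  by rewrite compA mg -compA s2 compA.
apply: (is_iso_mono (te_susp_iso F _)).
apply: (is_iso_mono (is_iso_fmap SA i1')).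
have -> : fmap SA (mor1 i') ∘ (te_susp F _ ∘ fmap F (tri_h T' ∘ c))
    = fmap SA [ses_mor1 s] ∘ (fmap SA (mor1 i) ∘ (te_susp F _ ∘ fmap F (tri_h T))).
  by rewrite fmapM (compA (te_susp F _)) compA eh' -[LHS]compA -s3 [LHS]compA -mh
    -[LHS]compA eh.
rewrite fmapM (compA (te_susp F _)) te_susp_nat !compA.
by rewrite -(fmapM SA (mor1 i') (fmap F _)) -s1 fmapM.
Qed.

(** The property of lifted triples that fails for arbitrary morphisms of triangles: there
    c g = 0 and h' c = 0 do not give a factorization through both h and g'. *)
Lemma lifted_null c : lifted i i' 0 0 c ->
  exists e : hom (S (tri1 T)) (tri2 T'), c = tri_g T' ∘ e ∘ tri_h T.
Proof.
move=> [s]; rewrite !fmap0 !compm0 => -[s1 s2 s3].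
have [i1 i2 i3] := ii; have [i1' i2' i3'] := ii'.
have z1 : [ses_mor1 s] = 0 by apply: (is_iso_epi i1); rewrite s1 comp0m.
have z2 : [ses_mor2 s] = 0 by apply: (is_iso_epi i2); rewrite s2 comp0m.
have [e ee] := ses_mor_null z1 z2.
have [j2 [l2 r2]] := i2'.
have eg' : mor3 i' ∘ fmap F (tri_g T') = [ses_v E'] ∘ mor2 i' := mor_sqg i'.
have eh : fmap SA (mor1 i) ∘ (te_susp F _ ∘ fmap F (tri_h T)) = ses_w E ∘ mor3 i :=
  mor_sqh i.
have [e0 ee0] := equiv_full hF (j2 ∘ e ∘ fmap SA (mor1 i) ∘ te_susp F _).
exists e0; apply: (equiv_faithful hF); apply: (is_iso_mono i3').
rewrite -s3 ee !(fmapM F) ee0 !compA eg' -!compA (compA (mor2 i')) r2 comp1m.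
by rewrite -eh.
Qed.

End Lifted.

End Transfer.

(** * Cauchy sequences and the completion *)

Section Sequences.
Variable C : preadditive.
Implicit Types X Y Z : sequence C.

Section Transitions.
Variable X : sequence C.

(** The transition map from X_m to X_n.  It is total in m and n, with value zero for
    n < m, so that maps into X_n arising from different indices can be compared without
    casts between the objects. *)
Fixpoint transition m n : hom (X m) (X n) :=
  if m =P n is ReflectT e then ecast k (hom (X m) (X k)) e (idm (X m))
  else if n is k.+1 then seq_map X k ∘ transition m k else 0.

Lemma transition_id m : transition m m = idm (X m).
Proof. by case: m => [|m] /=; case: eqP => // e; rewrite (eq_axiomK e). Qed.

Lemma transitionS m n : (m <= n)%N -> transition m n.+1 = seq_map X n ∘ transition m n.
Proof.
by move=> le /=; case: eqP => // e; exfalso; rewrite e ltnn in le.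
Qed.

Arguments transition : simpl never.

Lemma transition1 n : transition n n.+1 = seq_map X n.
Proof. by rewrite transitionS // transition_id compm1. Qed.

Lemma transition_comp m n k : (m <= n <= k)%N -> transition n k ∘ transition m n = transition m k.
Proof.
case/andP=> mn; elim: k => [|k IH]; first by case: n mn => // mn _; rewrite transition_id comp1m.
rewrite leq_eqVlt => /orP[/eqP e|nk]; first by rewrite -e transition_id comp1m.
by rewrite !transitionS // ?(leq_trans mn) // -compA IH.
Qed.

Lemma hom_in_transition (T : C) m n (f : hom T (X m)) :
  (m <= n)%N -> hom_in (transition m n ∘ f) = hom_in f.
Proof.
elim: n => [|n IH]; first by case: m f => // f _; rewrite transition_id comp1m.
rewrite leq_eqVlt => /orP[/eqP e|mn]; first by subst m; rewrite transition_id comp1m.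
by rewrite transitionS // -compA hom_inS IH.
Qed.

Lemma colim_tr_transition (T : C) n k (f : hom T (X n)) :
  colim_tr (post_tower T X) k f = transition n (k + n) ∘ f.
Proof.
elim: k => [|k IH]; first by rewrite transition_id comp1m.
rewrite [LHS]/= IH; transitivity (seq_map X (k + n) ∘ (transition n (k + n) ∘ f)) => //.
by rewrite compA -transitionS ?leq_addl.
Qed.

Lemma hom_in_eq (T : C) m n (f : hom T (X m)) (g : hom T (X n)) :
  hom_in f = hom_in g ->
  exists N, forall k, (N <= k)%N -> transition m k ∘ f = transition n k ∘ g.
Proof.
have [lm ln] := (leq_maxl m n, leq_maxr m n).
rewrite -(hom_in_transition f lm) -(hom_in_transition g ln) => /colim_in_eqP[p].
rewrite !colim_tr_transition !compA !transition_comp ?leq_addl ?lm ?ln // => e.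
have l q : (q <= maxn m n -> q <= p + maxn m n)%N.
  by move=> h; apply: leq_trans h (leq_addl _ _).
exists (p + maxn m n)%N => k le.
rewrite -(transition_comp (m := m) (n := p + maxn m n)) ?l // -compA e.
by rewrite compA transition_comp // l.
Qed.

Hypothesis cX : cauchy X.

Lemma cauchy_transition (T : C) :
  exists N, forall m n, (N <= m <= n)%N -> bijective (fun f : hom T (X m) => transition m n ∘ f).
Proof.
have [N hN] := cX T; exists N => m n /andP[Nm]; elim: n => [|n IH].
  rewrite leqn0 => /eqP e; subst m; exists id => f; rewrite transition_id comp1m //.
rewrite leq_eqVlt => /orP[/eqP e|mn].
  by subst m; exists id => f; rewrite transition_id comp1m.
apply: (eq_bij (bij_comp (hN n (leq_trans Nm mn)) (IH mn))) => f /=.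
by rewrite transitionS // compA.
Qed.

End Transitions.

Lemma hom_in0 (T : C) X n : hom_in (0 : hom T (X n)) = 0.
Proof. by apply: (addrI (hom_in (0 : hom T (X n)))); rewrite -hom_inD !addr0. Qed.

Lemma hom_inN (T : C) X n (f : hom T (X n)) : hom_in (- f) = - hom_in f.
Proof. by apply: (addrI (hom_in f)); rewrite -hom_inD !subrr hom_in0. Qed.

Lemma hom_inB (T : C) X n (f g : hom T (X n)) : hom_in (f - g) = hom_in f - hom_in g.
Proof. by rewrite hom_inD hom_inN. Qed.

Arguments transition : simpl never.

Local Notation Ch := (completion C).

Definition level (X Y : Ch) (f : forall n, hom (X n) (Y n))
    (hf : forall n, f n.+1 ∘ seq_map X n = seq_map Y n ∘ f n) : @hom Ch X Y :=
  seq_level hf.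

Arguments level {X Y} f hf.

Lemma completion_eq (X Y : Ch) (u v : @hom Ch X Y) :
  (forall n, lim_pr u n = lim_pr v n) -> u = v.
Proof. exact: seqlim_eq. Qed.

Lemma completion_compE (X Y Z : Ch) (v : @hom Ch Y Z) (u : @hom Ch X Y) n m
    (f : hom (X n) (Y m)) :
  lim_pr u n = hom_in f -> lim_pr (v ∘ u) n = precomp f (lim_pr v m).
Proof. by move=> e; rewrite /= e seq_actE. Qed.

Arguments completion_compE {X Y Z} v u {n m} f _.

Lemma level_eq (X Y : Ch) (f g : forall n, hom (X n) (Y n)) hf hg :
  (forall n, f n = g n) -> level f hf = level g hg :> @hom Ch X Y.
Proof. by move=> e; apply: completion_eq => n; rewrite /= e. Qed.

Lemma level_comp (X Y Z : Ch) (g : forall n, hom (Y n) (Z n)) hg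
    (f : forall n, hom (X n) (Y n)) hf (k : forall n, hom (X n) (Z n)) hk :
  (forall n, g n ∘ f n = k n) ->
  (level g hg : @hom Ch Y Z) ∘ (level f hf : @hom Ch X Y) = level k hk.
Proof.
move=> e; apply: completion_eq => n.
by rewrite (completion_compE _ _ (f n)) //= precompE e.
Qed.

Lemma level_compP (X Y Z : Ch) (g : forall n, hom (Y n) (Z n)) hg
    (f : forall n, hom (X n) (Y n)) hf :
  exists hgf, (level g hg : @hom Ch Y Z) ∘ (level f hf : @hom Ch X Y)
  = level (fun n => g n ∘ f n) hgf.
Proof.
have h n : (g n.+1 ∘ f n.+1) ∘ seq_map X n = seq_map Z n ∘ (g n ∘ f n).
  by rewrite -compA hf !compA hg.
by exists h; apply: level_comp.
Qed.

Lemma level_square (X Y X' Y' : Ch) (f : forall n, hom (X n) (Y n)) hf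
    (f' : forall n, hom (X' n) (Y' n)) hf'
    (a : forall n, hom (X n) (X' n)) ha (b : forall n, hom (Y n) (Y' n)) hb :
  (forall n, b n ∘ f n = f' n ∘ a n) ->
  (level b hb : @hom Ch Y Y') ∘ (level f hf : @hom Ch X Y)
  = (level f' hf' : @hom Ch X' Y') ∘ (level a ha : @hom Ch X X').
Proof. by move=> e; have [h ->] := level_compP hf' ha; apply: level_comp. Qed.

Lemma level_id (X : Ch) h : level (fun n => idm (X n)) h = idm X.
Proof. exact: completion_eq. Qed.

Lemma level_iso (X Y : Ch) (f : forall n, hom (X n) (Y n)) hf :
  (forall n, is_iso (f n)) -> is_iso (level f hf : @hom Ch X Y).
Proof.
move=> i; pose g n := sval (cid (i n)).
have gl n : g n ∘ f n = idm _ by case: (svalP (cid (i n))).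
have gr n : f n ∘ g n = idm _ by case: (svalP (cid (i n))).
have hg n : g n.+1 ∘ seq_map Y n = seq_map X n ∘ g n.
  by apply: (is_iso_mono (i n.+1)); rewrite !compA gr hf -compA gr comp1m compm1.
exists (level g hg); split.
  have [h ->] := level_compP hg hf;
  rewrite -(@level_id X (fun n => etrans (comp1m _) (esym (compm1 _)))).
  exact: level_eq.
have [h ->] := level_compP hf hg;
rewrite -(@level_id Y (fun n => etrans (comp1m _) (esym (compm1 _)))).
exact: level_eq.
Qed.

Lemma cauchy_iso X Y (f : forall n, hom (X n) (Y n)) :
  (forall n, f n.+1 ∘ seq_map X n = seq_map Y n ∘ f n) ->
  (forall n, is_iso (f n)) -> cauchy X -> cauchy Y.
Proof.
move=> hf i cX T; have [N hN] := cX T; exists N => n le.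
have [bi bs] := (bij_inj (hN n le), bijective_surj (hN n le)).
have [g [l r]] := i n.
apply: inj_surj_bijective => [a b /= e | b].
  suff : g ∘ a = g ∘ b by apply: is_iso_mono; exists (f n).
  apply: bi; apply: (is_iso_mono (i n.+1)).
  by rewrite !(compA (f n.+1)) hf -!(compA _ (f n)) !(compA (f n)) r !comp1m.
have [g' [l' r']] := i n.+1; have [a ea] := bs (g' ∘ b).
by exists (f n ∘ a); rewrite compA -hf -compA ea compA r' comp1m.
Qed.

Section Reindex.
Variables (Y : Ch) (phi : nat -> nat).
Hypotheses (phi_mono : forall n, (phi n <= phi n.+1)%N) (phi_ge : forall n, (n <= phi n)%N).

Definition reindex_seq : sequence C :=
  Sequence (fun n => transition Y (phi n) (phi n.+1)).

Lemma phi_le m n : (m <= n)%N -> (phi m <= phi n)%N.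
Proof.
elim: n => [|n IH]; first by case: m.
rewrite leq_eqVlt => /orP[/eqP -> //|mn].
by apply: leq_trans (IH mn) (phi_mono n).
Qed.

Lemma reindex_cauchy : cauchy reindex_seq.
Proof.
move=> T; have [N hN] := cauchy_transition (cs_cauchy Y) T; exists N => n le /=.
by apply: hN; rewrite (leq_trans le (phi_ge n)) phi_mono.
Qed.

Definition reindex : Ch := CauchySequence reindex_cauchy.

Lemma transition_reindex m n : (m <= n)%N -> transition reindex m n = transition Y (phi m) (phi n).
Proof.
elim: n => [|n IH]; first by case: m => // _; rewrite !transition_id.
rewrite leq_eqVlt => /orP[/eqP -> //|mn]; first by rewrite !transition_id.
by rewrite transitionS // IH //= transition_comp // phi_le // phi_mono.
Qed.

Lemma reindex_in_compat n :
  hom_tower reindex Y n (hom_in (idm (Y (phi n.+1)))) = hom_in (idm (Y (phi n))).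
Proof.
by rewrite /= (@precompE C Y (Y (phi n))) comp1m -[transition _ _ _]compm1 hom_in_transition.
Qed.

(** The identities of the objects Y_(phi n), as elements of the colimits, form the
    inverse of the transition maps from Y to its subsequence. *)
Definition reindex_in : @hom Ch reindex Y := SeqLim reindex_in_compat.

Lemma reindex_out_compat n :
  transition Y n.+1 (phi n.+1) ∘ seq_map Y n = seq_map reindex n ∘ transition Y n (phi n).
Proof.
rewrite /= -transition1 !transition_comp ?phi_ge ?phi_mono ?leqnSn //.
Qed.

Definition reindex_out : @hom Ch Y reindex :=
  level (X := Y) (Y := reindex) (fun n => transition Y n (phi n)) reindex_out_compat.

Lemma reindex_in_iso : is_iso reindex_in.
Proof.
exists reindex_out; split; apply: completion_eq => n.
  rewrite (completion_compE (n := n) reindex_out reindex_in (idm (Y (phi n))) (erefl _)).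
  rewrite precomp1 /= /seq_id_pr -(@transition_id reindex n).
  rewrite -(hom_in_transition (X := reindex) (m := n) _ (phi_ge n)).
  by rewrite !transition_reindex // transition_id compm1.
rewrite (completion_compE (n := n) (m := n) reindex_in reindex_out
  (transition Y n (phi n)) (erefl _)).
by rewrite /= (@precompE C Y) comp1m -[transition _ _ _]compm1 hom_in_transition.
Qed.

End Reindex.

(** Component n of u is represented at some index j n of Y, and the representatives at n
    and n + 1 agree after a further index N n.  Any monotone phi above j, N and the
    identity works; it is taken to be a running maximum. *)
Lemma reindex_level (X Y : Ch) (u : @hom Ch X Y) :
  exists (Y' : Ch) (g : @hom Ch Y' Y) (f : forall n, hom (X n) (Y' n))
    (hf : forall n, f n.+1 ∘ seq_map X n = seq_map Y' n ∘ f n),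
    is_iso g /\ u = g ∘ level f hf.
Proof.
have [jf jfP] := choice (fun n => colim_ind1 (lim_pr u n)).
have [f0 {}jfP] := dependent_choice jfP.
have ex n : exists N, forall k, (N <= k)%N ->
    transition Y (jf n.+1) k ∘ (f0 n.+1 ∘ seq_map X n) = transition Y (jf n) k ∘ f0 n.
  apply: hom_in_eq; have := lim_compat u n.
  rewrite (jfP n) (jfP n.+1) => e; apply: etrans e.
  exact/esym/(precompE (Y := Y)).
have [N hN] := choice ex.
(* The maximum with n makes the subsequence cofinal. *)
pose M n := maxn (jf n) (maxn (N n) n); pose phi n := (\max_(i < n.+1) M i)%N.
have phi_mono n : (phi n <= phi n.+1)%N by rewrite /phi [leqRHS]big_ord_recr leq_maxl.
have phi_M n : (M n <= phi n)%N by rewrite /phi big_ord_recr leq_maxr.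
have phi_j n : (jf n <= phi n)%N by apply: leq_trans (phi_M n); rewrite leq_max leqnn.
have phi_N n : (N n <= phi n)%N by apply: leq_trans (phi_M n); rewrite !leq_max leqnn orbT.
have phi_ge n : (n <= phi n)%N by apply: leq_trans (phi_M n); rewrite !leq_max leqnn !orbT.
pose f n : hom (X n) (reindex Y phi_mono phi_ge n) := transition Y (jf n) (phi n) ∘ f0 n.
have hf n : f n.+1 ∘ seq_map X n = seq_map (reindex Y phi_mono phi_ge) n ∘ f n.
  rewrite /f -compA hN ?(leq_trans (phi_N n)) // [RHS]/= compA transition_comp //.
  by rewrite phi_j phi_mono.
exists (reindex Y phi_mono phi_ge), (reindex_in Y phi_mono phi_ge), f, hf.
split; first exact: reindex_in_iso.
apply: completion_eq => n.
rewrite (completion_compE (n := n) (m := n) _ (level f hf) (f n) (erefl _)).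
by rewrite [RHS](precompE (Y := Y)) comp1m (hom_in_transition (X := Y)) ?phi_j ?jfP.
Qed.

(** Biproducts of the terms form a Cauchy sequence because the transition maps act on
    Hom(T, -) componentwise. *)
Lemma completion_additive : additive_category C -> additive_category Ch.
Proof.
move=> [[Z z] bi]; split.
  have cZ : cauchy (Sequence (fun _ : nat => idm Z)).
    by move=> T; exists 0%N => n _; exists id => f /=; rewrite comp1m.
  exists (CauchySequence cZ); apply: is_zeroP; apply: completion_eq => n /=.
  pose X : sequence C := Sequence (fun _ : nat => idm Z).
  exact: etrans (congr1 (@hom_in C Z X n) (zero_into _ _ z)) (@hom_in0 Z X n).
move=> X Y.
have [B {}bi] := dependent_choice (fun n => bi (X n) (Y n)).
have [i1 {}bi] := dependent_choice bi.
have [i2 {}bi] := dependent_choice bi.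
have [p1 {}bi] := dependent_choice bi.
have [p2 {}bi] := dependent_choice bi.
have e11 n : p1 n ∘ i1 n = idm _ by case: (bi n).
have e22 n : p2 n ∘ i2 n = idm _ by case: (bi n).
have e12 n : p1 n ∘ i2 n = 0 by case: (bi n).
have e21 n : p2 n ∘ i1 n = 0 by case: (bi n).
have e n : i1 n ∘ p1 n + i2 n ∘ p2 n = idm _ by case: (bi n).
pose b n := i1 n.+1 ∘ seq_map X n ∘ p1 n + i2 n.+1 ∘ seq_map Y n ∘ p2 n.
have hi1 n : i1 n.+1 ∘ seq_map X n = b n ∘ i1 n.
  by rewrite /b compDl -!compA e11 e21 !compm0 compm1 addr0.
have hi2 n : i2 n.+1 ∘ seq_map Y n = b n ∘ i2 n.
  by rewrite /b compDl -!compA e12 e22 !compm0 compm1 add0r.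
have hp1 n : p1 n.+1 ∘ b n = seq_map X n ∘ p1 n.
  by rewrite /b compDr !compA e11 e12 !comp0m comp1m addr0.
have hp2 n : p2 n.+1 ∘ b n = seq_map Y n ∘ p2 n.
  by rewrite /b compDr !compA e21 e22 !comp0m comp1m add0r.
have cB : cauchy (Sequence b).
  move=> T; have [N hN] := cs_cauchy X T; have [M hM] := cs_cauchy Y T.
  exists (maxn N M) => n; rewrite geq_max => /andP[/hN bX /hM bY].
  apply: inj_surj_bijective => [f g /= efg | h] /=.
    rewrite -[f]comp1m -[g]comp1m -e !compDl -!compA.
    have -> : p1 n ∘ f = p1 n ∘ g.
      by apply: (bij_inj bX); rewrite /= !compA -hp1 -!compA efg.
    suff -> : p2 n ∘ f = p2 n ∘ g by [].
    by apply: (bij_inj bY); rewrite /= !compA -hp2 -!compA efg.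
  have [k ek] := bijective_surj bX (p1 n.+1 ∘ h).
  have [l el] := bijective_surj bY (p2 n.+1 ∘ h).
  exists (i1 n ∘ k + i2 n ∘ l); rewrite compDr !compA -hi1 -hi2 -!compA ek el.
  by rewrite !compA -compDl e comp1m.
pose Bc : Ch := CauchySequence cB.
exists Bc, (level (X := X) (Y := Bc) i1 hi1), (level (X := Y) (Y := Bc) i2 hi2),
  (level (X := Bc) (Y := X) p1 hp1), (level (X := Bc) (Y := Y) p2 hp2).
have zero (U V : Ch) (f : forall n, hom (U n) (V n)) hf :
    (forall n, f n = 0) -> level f hf = 0.
  by move=> f0; apply: completion_eq => n /=; rewrite f0 hom_in0.
have one (U : Ch) (f : forall n, hom (U n) (U n)) hf :
    (forall n, f n = idm _) -> level f hf = idm U.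
  by move=> f0; apply: completion_eq => n /=; rewrite f0.
split.
- by have [? ->] := @level_compP X Bc X p1 hp1 i1 hi1; apply: one.
- by have [? ->] := @level_compP Y Bc Y p2 hp2 i2 hi2; apply: one.
- by have [? ->] := @level_compP Y Bc X p1 hp1 i2 hi2; apply: zero.
- by have [? ->] := @level_compP X Bc Y p2 hp2 i1 hi1; apply: zero.
have [h1 ->] := @level_compP Bc X Bc i1 hi1 p1 hp1.
have [h2 ->] := @level_compP Bc Y Bc i2 hi2 p2 hp2.
by apply: completion_eq => n; rewrite /= -hom_inD e.
Qed.

End Sequences.

Arguments level {C X Y} f hf.
Arguments completion_compE {C X Y Z} v u {n m} f _.
Arguments transition : simpl never.

Section CompletionSuspension.
Variable C : triangulated_category.
Local Notation S := (susp C).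
Local Notation Ch := (suspended_completion C).
Local Notation Sh := (susp Ch).

Let hS : is_equivalence S := triang_susp (tri_catP C).

Lemma transition_susp (X : sequence C) m n :
  (m <= n)%N -> transition (seq_susp X) m n = fmap S (transition X m n).
Proof.
elim: n => [|n IH]; first by case: m => // _; rewrite !transition_id fmap1.
rewrite leq_eqVlt => /orP[/eqP -> //|mn]; first by rewrite !transition_id fmap1.
by rewrite !transitionS // IH // fmapM.
Qed.

Lemma colim_susp_inj (T : C) (Y : sequence C) : ssrfun.injective (@colim_susp C T Y).
Proof.
move=> x y; have [n [f [g [-> ->]]]] := hom_colim_ex2 x y.
rewrite !colim_suspE => /hom_in_eq[N /(_ (maxn N n))].
rewrite leq_maxl => /(_ isT); rewrite !transition_susp ?leq_maxr // -!fmapM.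
move=> /(equiv_faithful hS) e.
by rewrite -(hom_in_transition f (leq_maxr N n)) e hom_in_transition ?leq_maxr.
Qed.

Lemma colim_susp_surj (T : C) (Y : sequence C) (y : hom_colim (S T) (seq_susp Y)) :
  exists x, colim_susp x = y.
Proof.
elim/hom_colim_ind: y => n g; have [f <-] := equiv_full hS g.
by exists (hom_in f); rewrite colim_suspE.
Qed.

(** Morphisms desuspend at each level, because an equality in the colimit already holds
    at a finite index; objects desuspend term by term. *)
Lemma completion_susp_equiv : is_equivalence Sh.
Proof.
split=> [X Y|Y].
  apply: inj_surj_bijective => [f g e | k].
    apply: completion_eq => n; apply: colim_susp_inj.
    by have := congr1 (fun s => lim_pr s n) e.
  have [u hu] := dependent_choice (fun n => colim_susp_surj (lim_pr k n)).
  have cu n : hom_tower X Y n (u n.+1) = u n.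
    by apply: colim_susp_inj; rewrite colim_susp_precomp !hu; apply: (lim_compat k n).
  by exists (SeqLim cu); apply: completion_eq => n; apply: hu.
have [X hX] := dependent_choice (fun n => hS.2 (Y n)).
have [q iq] := dependent_choice hX.
have ex n : exists x : hom (X n) (X n.+1), q n.+1 ∘ fmap S x = seq_map Y n ∘ q n.
  have [r [rl rr]] := iq n.+1; have [x ex] := equiv_full hS (r ∘ (seq_map Y n ∘ q n)).
  by exists x; rewrite ex compA rr comp1m.
have [x hx] := dependent_choice ex.
have cSX : cauchy (seq_susp (Sequence x)).
  have ir n : is_iso (sval (cid (iq n))).
    by case: cid => r [rl rr] /=; exists (q n).
  apply: (@cauchy_iso _ Y (seq_susp (Sequence x)) (fun n => sval (cid (iq n)))) ir (cs_cauchy Y).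
  move=> n; apply: (is_iso_mono (iq n.+1)).
  have k m : q m ∘ sval (cid (iq m)) = idm _ by case: cid => r [].
  by rewrite /= !compA hx k comp1m -compA k compm1.
have cX : cauchy (Sequence x).
  move=> T; have [N hN] := cSX (S T); exists N => n le; have b := hN n le.
  apply: inj_surj_bijective => [f g /= e | g].
    by apply: (equiv_faithful hS); apply: (bij_inj b); rewrite /= -!fmapM e.
  have [f ef] := bijective_surj b (fmap S g); have [f0 ef0] := equiv_full hS f.
  by exists f0; apply: (equiv_faithful hS); rewrite fmapM ef0.
exists (CauchySequence cX), (level (X := cs_susp (CauchySequence cX)) (Y := Y) q hx).
exact: level_iso.
Qed.

End CompletionSuspension.

(** * Completing squares to morphisms of colimit triangles *)

Section SeqAct.
Variable C : preadditive.

Lemma precomp0l (Y : sequence C) (T T' : C) (x : hom_colim T' Y) :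
  precomp (0 : hom T T') x = 0.
Proof. by elim/hom_colim_ind: x => n f; rewrite precompE compm0 hom_in0. Qed.

Lemma seq_act0l (Y Z : sequence C) (T : C) (x : hom_colim T Y) :
  seq_act (0 : seq_hom Y Z) x = 0.
Proof. by elim/hom_colim_ind: x => n f; rewrite seq_actE raddf0. Qed.

Lemma seq_act0r (Y Z : sequence C) (T : C) (y : seq_hom Y Z) :
  seq_act y (0 : hom_colim T Y) = 0.
Proof. by apply: (addrI (seq_act y 0)); rewrite -seq_actDr !addr0. Qed.

Lemma seq_actB (Y Z : sequence C) (T : C) (y : seq_hom Y Z) (a b : hom_colim T Y) :
  seq_act y (a - b) = seq_act y a - seq_act y b.
Proof. by apply: (addIr (seq_act y b)); rewrite -seq_actDr !subrK. Qed.

Lemma transition_level (X Y : sequence C) (f : forall n, hom (X n) (Y n)) m n :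
  (forall n, f n.+1 ∘ seq_map X n = seq_map Y n ∘ f n) -> (m <= n)%N ->
  f n ∘ transition X m n = transition Y m n ∘ f m.
Proof.
move=> hf; elim: n => [|n IH]; first by case: m => // _; rewrite !transition_id compm1 comp1m.
rewrite leq_eqVlt => /orP[/eqP e|mn]; first by subst m; rewrite !transition_id compm1 comp1m.
by rewrite !transitionS // compA hf -!compA IH.
Qed.

End SeqAct.

Section Fill.
Variables (C : triangulated_category) (A : frobenius_category).
Variables (F : triangle_equivalence C A) (hC : phantomless C).
Local Notation S := (susp C).
Local Notation Ch := (suspended_completion C).
Let ptC := triangulated_pretriangulated (tri_catP C).

Lemma lifted_id (T : triangle C) (E : ses A)
    (i : tri_mor (te_triangle F T) (ses_triangle E)) :
  lifted i i (idm _) (idm _) (idm _).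
Proof.
have q1 : idm (ses2 E) ∘ ses_u E = ses_u E ∘ idm _ by rewrite comp1m compm1.
have q2 : idm (ses3 E) ∘ ses_v E = ses_v E ∘ idm _ by rewrite comp1m compm1.
exists (SesMor q1 q2); split; rewrite fmap1 compm1; exact: (@comp1m (St A)).
Qed.

Section Lifts.
Variable T : triangle_sequence C.
Variables (E : nat -> ses A)
  (i : forall n, tri_mor (te_triangle F (T n)) (ses_triangle (E n)))
  (s : forall n, ses_mor (E n) (E n.+1)).
Hypothesis hs : forall n, is_lift (te_tri_mor F (ts_mor T n)) (i n) (i n.+1) (s n).

Lemma lifted_transition m n : (m <= n)%N ->
  lifted (i m) (i n) (transition (ts_seq1 T) m n) (transition (ts_seq2 T) m n)
    (transition (ts_seq3 T) m n).
Proof.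
elim: n => [|n IH]; first by case: m => // _; rewrite !transition_id; apply: lifted_id.
rewrite leq_eqVlt => /orP[/eqP ->|mn]; first by rewrite !transition_id; apply: lifted_id.
rewrite !transitionS //; apply: lifted_comp (IH mn) _.
by exists (s n); apply: hs.
Qed.

End Lifts.

Variables (T T' : triangle_sequence C).
Hypotheses (hT : ts_coherent T F) (hT' : ts_coherent T' F).
Local Notation X := (ts_seq1 T).
Local Notation Y := (ts_seq2 T).
Local Notation Z := (ts_seq3 T).
Local Notation X' := (ts_seq1 T').
Local Notation Y' := (ts_seq2 T').
Local Notation Z' := (ts_seq3 T').
Local Notation f := (tri_f (colimit_triangle T)).
Local Notation g := (tri_g (colimit_triangle T)).
Local Notation h := (tri_h (colimit_triangle T)).
Local Notation f' := (tri_f (colimit_triangle T')).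
Local Notation g' := (tri_g (colimit_triangle T')).
Local Notation h' := (tri_h (colimit_triangle T')).

Lemma colimit_hg0 : h' ∘ g' = 0.
Proof.
apply: (@completion_eq C) => n.
rewrite (completion_compE (C := C) (n := n) (m := n) h' g' (tri_g (T' n)) (erefl _)).
rewrite /= precompE.
have -> : tri_h (T' n) ∘ tri_g (T' n) = 0.
  by have := ts_exact T' n; case: (T' n) => ? ? ? ? ? ? /(pt_comp0' ptC).
exact: (@hom_in0 _ _ (cs_susp X')).
Qed.

(** The square commutes in the colimit over the levels of the target, so it commutes at a
    finite level. *)
Lemma square_representatives (a : hom (X : Ch) X') (b : hom (Y : Ch) Y') n :
  b ∘ f = f' ∘ a ->
  exists (j : nat) (a1 : hom (X n) (X' j)) (b1 : hom (Y n) (Y' j)),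
    [/\ lim_pr a n = hom_in a1, lim_pr b n = hom_in b1
      & b1 ∘ tri_f (T n) = tri_f (T' j) ∘ a1].
Proof.
move=> sq; have [p [a0 ea]] := colim_ind1 (lim_pr a n).
have [q [b0 eb]] := colim_ind1 (lim_pr b n).
have : lim_pr (b ∘ f) n = lim_pr (f' ∘ a) n by rewrite sq.
rewrite (completion_compE (C := C) (n := n) (m := n) b f (tri_f (T n)) (erefl _)).
rewrite (completion_compE (C := C) (n := n) (m := p) f' a a0 ea).
rewrite eb [precomp _ _ as X in X = _](precompE (Y := Y')) [RHS](precompE (Y := Y')).
move=> /hom_in_eq[N hN].
pose k := maxn N (maxn p q).
have pk : (p <= k)%N by rewrite !leq_max leqnn !orbT.
have qk : (q <= k)%N by rewrite !leq_max leqnn !orbT.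
exists k, (transition X' p k ∘ a0), (transition Y' q k ∘ b0).
rewrite ea (hom_in_transition (X := X')) // (hom_in_transition (X := Y')) //; split=> //.
rewrite -compA (hN k) ?leq_maxl // !compA; congr (_ ∘ _); apply/esym.
apply: (transition_level (X := X') (Y := Y') (f := fun n => tri_f (T' n))) pk.
by move=> m; apply: esym (mor_sqf (ts_mor T' m)).
Qed.

Lemma colimit_fill (a : hom (X : Ch) X') (b : hom (Y : Ch) Y') :
  b ∘ f = f' ∘ a ->
  exists c : hom (Z : Ch) Z', c ∘ g = g' ∘ b /\ fmap (susp Ch) a ∘ h = h' ∘ c.
Proof.
move=> sq; have [E [i [s [hi hs]]]] := hT; have [E' [i' [s' [hi' hs']]]] := hT'.
have ex n : exists (j : nat) (a1 : hom (X n) (X' j)) (b1 : hom (Y n) (Y' j))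
    (c1 : hom (Z n) (Z' j)), [/\ lim_pr a n = hom_in a1, lim_pr b n = hom_in b1
      & lifted (i n) (i' j) a1 b1 c1].
  have [j [a1 [b1 [ea eb e]]]] := square_representatives n sq.
  have [c1 lc] := lifted_fill (hi n) (hi' j) e.
  by exists j, a1, b1, c1.
have [j {}ex] := dependent_choice ex.
have [a1 {}ex] := dependent_choice ex.
have [b1 {}ex] := dependent_choice ex.
have [c1 {}ex] := dependent_choice ex.
have ea n : lim_pr a n = hom_in (a1 n) by case: (ex n).
have eb n : lim_pr b n = hom_in (b1 n) by case: (ex n).
have lc n : lifted (i n) (i' (j n)) (a1 n) (b1 n) (c1 n) by case: (ex n).
have defect n : exists e : hom_colim (S (X n)) Y',
    hom_in (c1 n.+1 ∘ seq_map Z n) - hom_in (c1 n) = seq_act g' (precomp (tri_h (T n)) e).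
  have [N1 hN1] : exists N, forall k, (N <= k)%N ->
      transition X' (j n.+1) k ∘ (a1 n.+1 ∘ seq_map X n) = transition X' (j n) k ∘ a1 n.
    apply: hom_in_eq; rewrite -ea -(lim_compat a n) ea.
    exact/esym/(precompE (Y := X')).
  have [N2 hN2] : exists N, forall k, (N <= k)%N ->
      transition Y' (j n.+1) k ∘ (b1 n.+1 ∘ seq_map Y n) = transition Y' (j n) k ∘ b1 n.
    apply: hom_in_eq; rewrite -eb -(lim_compat b n) eb.
    exact/esym/(precompE (Y := Y')).
  (* At level k both squares and both fillers can be compared. *)
  pose k := maxn (maxn N1 N2) (maxn (j n) (j n.+1)).
  have k1 : (N1 <= k)%N by rewrite !leq_max leqnn.
  have k2 : (N2 <= k)%N by rewrite !leq_max leqnn !orbT.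
  have kj : (j n <= k)%N by rewrite !leq_max leqnn !orbT.
  have kj' : (j n.+1 <= k)%N by rewrite !leq_max leqnn !orbT.
  have ls : lifted (i n) (i n.+1) (seq_map X n) (seq_map Y n) (seq_map Z n).
    by exists (s n); apply: hs.
  have l1 := lifted_comp (lifted_comp ls (lc n.+1)) (lifted_transition hs' kj').
  have l2 := lifted_comp (lc n) (lifted_transition hs' kj).
  have := lifted_sub l1 l2; rewrite hN1 // hN2 // !subrr.
  move=> /(lifted_null (hi n) (hi' k))[e ee]; exists (hom_in (Y := Y') e).
  rewrite -(hom_in_transition (X := Z') _ kj) -(hom_in_transition (X := Z') _ kj').
  rewrite -(hom_inB (X := Z')) ee (precompE (Y := Y')) seq_actE.
  by rewrite -compA; apply/esym/(precompE (Y := Z')).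
have [e he] := dependent_choice defect.
have [t ht] := hC (cauchy_susp (cs_cauchy X)) (cs_cauchy Y') e.
pose c0 n := hom_in (c1 n) + seq_act g' (precomp (tri_h (T n)) (t n)).
have hc n : hom_tower Z Z' n (c0 n.+1) = c0 n.
  rewrite /= /c0 raddfD /= (precompE (Y := Z')) seq_act_precomp -precompM.
  (* Transport the defect through h_(n+1) z_n = (Σ x_n) h_n. *)
  have := he n; rewrite (ht n) raddfB seq_actB /= -precompM.
  have -> : fmap S (seq_map X n) ∘ tri_h (T n) = tri_h (T n.+1) ∘ seq_map Z n.
    exact: mor_sqh (ts_mor T n).
  by move/eqP; rewrite subr_eq => /eqP ->; rewrite addrAC addrNK addrC.
have [lm1 lm2] : (forall n, c1 n ∘ tri_g (T n) = tri_g (T' (j n)) ∘ b1 n) /\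
    (forall n, fmap S (a1 n) ∘ tri_h (T n) = tri_h (T' (j n)) ∘ c1 n).
  by split=> n; have [] := lifted_mor (hi' (j n)) (lc n).
exists (SeqLim hc); split; apply: (@completion_eq C) => n.
  rewrite (completion_compE (C := C) (n := n) (m := n) _ g (tri_g (T n)) (erefl _)).
  rewrite (completion_compE (C := C) (n := n) (m := j n) _ b (b1 n) (eb n)).
  rewrite [RHS](precompE (Y := Z')) -lm1 /= /c0 raddfD /= (precompE (Y := Z')).
  rewrite seq_act_precomp -precompM.
  have -> : tri_h (T n) ∘ tri_g (T n) = 0.
    by have := ts_exact T n; case: (T n) => ? ? ? ? ? ? /(pt_comp0' ptC).
  by rewrite precomp0l seq_act0r addr0.
rewrite (completion_compE (C := C) (n := n) (m := n) _ h (tri_h (T n)) (erefl _)).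
transitivity (seq_act h' (c0 n)) => //.
rewrite /c0 seq_actDr seq_actM.
have -> : seq_comp h' g' = 0 by exact: colimit_hg0.
rewrite seq_act0l addr0 seq_actE.
transitivity (precomp (tri_h (T n)) (colim_susp (lim_pr a n))) => //.
rewrite ea colim_suspE (precompE (Y := seq_susp X')) lm2.
exact/esym/(precompE (Y := seq_susp X')).
Qed.

End Fill.

(** * Colimits of coherent sequences *)

Section Main.
Variables (C : triangulated_category) (A : frobenius_category).
Variables (F : triangle_equivalence C A).
Local Notation S := (susp C).
Local Notation SA := (susp (St A)).
Local Notation Ch := (suspended_completion C).
Local Notation G := (quasi_inverse F).
Local Notation "[ f ]" := (stable_class f : @hom (St A) _ _) (f at level 99).
Let ptC := triangulated_pretriangulated (tri_catP C).

Definition colimit_exact (T : triangle Ch) : Prop :=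
  exists U : triangle_sequence C, ts_coherent U F /\ tri_isomorphic T (colimit_triangle U).

Lemma colimit_exact_iso (T T' : triangle Ch) :
  tri_isomorphic T T' -> colimit_exact T -> colimit_exact T'.
Proof.
move=> i [U [hU j]]; exists U; split=> //; apply: tri_isomorphic_trans j.
exact: tri_isomorphic_sym.
Qed.

Lemma tri_isomorphic_refl (T : triangle Ch) : tri_isomorphic T T.
Proof.
case: T => X Y Z f g h.
by apply: (tri_isomorphicP (is_iso_idm _) (is_iso_idm _) (is_iso_idm _));
  rewrite ?fmap1 comp1m compm1.
Qed.

Lemma colimit_exact_colimit (U : triangle_sequence C) :
  ts_coherent U F -> colimit_exact (colimit_triangle U).
Proof. by exists U; split=> //; apply: tri_isomorphic_refl. Qed.

(** The five lemma applied to Hom(W, -) and the consecutive triangles T_n and T_(n+1). *)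
Lemma cauchy_third (T : nat -> triangle C) (m : forall n, tri_mor (T n) (T n.+1)) :
  (forall n, exact_tri (T n)) ->
  cauchy (Sequence (fun n => mor1 (m n))) -> cauchy (Sequence (fun n => mor2 (m n))) ->
  cauchy (Sequence (fun n => mor3 (m n))).
Proof.
move=> eT c1 c2 W.
have [N1 h1] := c1 W; have [N2 h2] := c2 W.
have [N3 h3] := cauchy_susp c1 W; have [N4 h4] := cauchy_susp c2 W.
exists (maxn (maxn N1 N2) (maxn N3 N4)) => n; rewrite !geq_max.
case/andP=> /andP[/h1/= b1 /h2/= b2] /andP[/h3/= b3 /h4/= b4].
have bi (X Y : C) (f : hom X Y) : bijective (fun a : hom W X => f ∘ a) -> hom_inj W f.
  by move=> b a fa; apply: (bij_inj b); rewrite /= fa compm0.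
have bs (X Y : C) (f : hom X Y) : bijective (fun a : hom W X => f ∘ a) -> hom_surj W f.
  exact: bijective_surj.
have [||ci cs] := @pt_five _ _ ptC _ _ _ _ _ _ W (tri_f (T n)) (tri_g (T n)) (tri_h (T n))
  (tri_f (T n.+1)) (tri_g (T n.+1)) (tri_h (T n.+1)) (mor1 (m n)) (mor2 (m n)) (mor3 (m n))
  _ _ (mor_sqf _) (mor_sqg _) (mor_sqh _)
  (bs _ _ _ b1) (bi _ _ _ b2) (bs _ _ _ b2) (bi _ _ _ b3) (bs _ _ _ b3) (bi _ _ _ b4).
- by have := eT n; case: (T n).
- by have := eT n.+1; case: (T n.+1).
apply: inj_surj_bijective => //= a b e.
by apply/eqP; rewrite -subr_eq0; apply/eqP; apply: ci; rewrite compBr e subrr.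
Qed.

Definition rot_tri_mor (T T' : triangle C) (m : tri_mor T T') :
  tri_mor (Triangle (tri_g T) (tri_h T) (- fmap S (tri_f T)))
    (Triangle (tri_g T') (tri_h T') (- fmap S (tri_f T'))).
Proof.
refine (@TriMor C (Triangle (tri_g T) (tri_h T) (- fmap S (tri_f T)))
  (Triangle (tri_g T') (tri_h T') (- fmap S (tri_f T')))
  (mor2 m) (mor3 m) (fmap S (mor1 m)) (mor_sqg m) (mor_sqh m) _).
by rewrite /= compNr compNl -!fmapM mor_sqf.
Defined.

Section Rotate.
Variable U : triangle_sequence C.

Lemma rot_ts_exact n :
  exact_tri (Triangle (tri_g (U n)) (tri_h (U n)) (- fmap S (tri_f (U n)))).
Proof. by have := ts_exact U n; case: (U n) => ? ? ? ? ? ? /(pt_rot ptC). Qed.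

Definition rot_ts : triangle_sequence C :=
  @TriangleSequence C _ (fun n => rot_tri_mor (ts_mor U n)) rot_ts_exact
    (ts_cauchy2 U) (ts_cauchy3 U) (cauchy_susp (ts_cauchy1 U)).

Lemma rot_lift (T : triangle C) (E : ses A)
    (i : tri_mor (te_triangle F T) (ses_triangle E)) :
  tri_is_iso i ->
  exists j : tri_mor (te_triangle F
      (Triangle (tri_g T) (tri_h T) (- fmap S (tri_f T)))) (ses_triangle (rot_ses E)),
  [/\ tri_is_iso j, mor1 j = mor2 i, [rt_v (the_rotation E)] ∘ mor2 j = mor3 i
    & mor3 j = fmap SA (mor1 i) ∘ te_susp F _].
Proof.
case: i => a b c e1 e2 e3 [/= ia ib ic].
have [c' [ic' r r1 r2 r3]] := rot_tri ia ib ic e1 e2 e3.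
have q3 : fmap SA b ∘ (te_susp F _ ∘ fmap F (- fmap S (tri_f T)))
    = ses_w (rot_ses E) ∘ (fmap SA a ∘ te_susp F _).
  have {}r3 : fmap SA b ∘ - fmap SA (fmap F (tri_f T)) = ses_w (rot_ses E) ∘ fmap SA a := r3.
  by rewrite [RHS]compA -r3 fmapN [te_susp F _ ∘ _]compNr te_susp_nat !compNr compNl compA.
have q2 : (fmap SA a ∘ te_susp F _) ∘ fmap F (tri_h T) = [ses_v (rot_ses E)] ∘ c'.
  by rewrite -r2 -compA.
exists (@TriMor (St A) (te_triangle F (Triangle (tri_g T) (tri_h T) (- fmap S (tri_f T))))
  (ses_triangle (rot_ses E)) b c' (fmap SA a ∘ te_susp F _) r1 q2 q3).
split=> //; split=> //=; apply: is_iso_comp (te_susp_iso F _).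
exact: is_iso_fmap.
Qed.

(** The same exact sequences, rotated: the third component of the rotated strict
    morphism is the suspension of the first component, as the rotated triangles
    require.  Arbitrary lifts of the rotated triangles would not ensure this. *)
Lemma rot_ts_coherent : ts_coherent U F -> ts_coherent rot_ts F.
Proof.
move=> [E [i [s [hi hs]]]].
have [j hj] := dependent_choice (fun n => rot_lift (hi n)).
have [t ht] := dependent_choice (fun n => rot_ses_mor (s n)).
exists (fun n => rot_ses (E n)), j, t; split=> n; first by case: (hj n).
have [_ j1 j2 j3] := hj n; have [_ k1 k2 k3] := hj n.+1.
have [t1 t2 t3] := ht n; have [s1 s2 s3] := hs n; split.
- by rewrite j1 k1 /= t1.
- apply: (is_iso_mono (rt_v_iso (the_rotation (E n.+1)))).
  rewrite [LHS]compA [RHS]compA k2 -s3 /= -stable_classM t2 stable_classM.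
  by rewrite -j2 compA.
- have s1' : [ses_mor1 (s n)] ∘ mor1 (i n) = mor1 (i n.+1) ∘ fmap F (mor1 (ts_mor U n)) := s1.
  rewrite j3 k3 [mor3 (ses_tri_mor _)]/= t3 compA -fmapM s1' fmapM -[RHS]compA.
  by rewrite [mor3 _]/= te_susp_nat compA.
Qed.

Lemma rot_ts_colimit (f := tri_f (colimit_triangle U)) :
  tri_isomorphic (Triangle (tri_g (colimit_triangle U)) (tri_h (colimit_triangle U))
    (- fmap (susp Ch) f)) (colimit_triangle rot_ts).
Proof.
apply: (@tri_isomorphicP Ch _ _ _ _ _ _ _ _ _ _ _ _ (idm (ts_seq2 U : Ch)) (idm (ts_seq3 U : Ch))
  (idm (cs_susp (ts_seq1 U) : Ch))).
- exact: is_iso_idm.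
- exact: is_iso_idm.
- exact: is_iso_idm.
- rewrite comp1m compm1; exact: (@level_eq C (ts_seq2 U) (ts_seq3 U)).
- rewrite comp1m compm1; exact: (@level_eq C (ts_seq3 U) (cs_susp (ts_seq1 U))).
rewrite fmap1 comp1m compm1; apply: (@completion_eq C) => n /=.
rewrite colim_suspE.
exact/esym/(@hom_inN _ _ (cs_susp (ts_seq2 U))).
Qed.

End Rotate.

Lemma colimit_exact_rot (X Y Z : Ch) (f : hom X Y) (g : hom Y Z) h :
  colimit_exact (Triangle f g h) -> colimit_exact (Triangle g h (- fmap (susp Ch) f)).
Proof.
move=> [U [hU [[a b c /= e1 e2 e3] [/= ia ib ic]]]].
exists (rot_ts U); split; first exact: rot_ts_coherent.
apply: tri_isomorphic_trans (rot_ts_colimit U).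
apply: (@tri_isomorphicP Ch _ _ _ _ _ _ _ _ _ _ _ _ b c (fmap (susp Ch) a) ib ic
  (is_iso_fmap (susp Ch) ia)) => //.
by rewrite compNr compNl -!fmapM e1.
Qed.

Lemma colimit_exact_fill (hC : phantomless C) (T T' : triangle Ch) :
  colimit_exact T -> colimit_exact T' -> fills T T'.
Proof.
move=> [U [hU i]] [U' [hU' i']]; apply: (fills_iso i i') => a b sq.
have [c [m2 m3]] := colimit_fill hC hU hU' sq.
by exists (@TriMor Ch (colimit_triangle U) (colimit_triangle U') a b c sq m2 m3).
Qed.

Definition qi_seq (X : sequence A) : sequence C :=
  Sequence (fun n => fmap G [seq_map X n]).

Definition strict (X Y : sequence A) (u : forall n, hom (X n) (Y n)) : Prop :=
  forall n, u n.+1 ∘ seq_map X n = seq_map Y n ∘ u n.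

Lemma qi_strict (X Y : sequence A) (u : forall n, hom (X n) (Y n)) : strict u ->
  forall n, fmap G [u n.+1] ∘ seq_map (qi_seq X) n = seq_map (qi_seq Y) n ∘ fmap G [u n].
Proof. by move=> h n; rewrite -!fmapM -!stable_classM h. Qed.

(** The Cauchy property of each term is a field, so that sequences which share a term can
    share the proof as well, and then have equal objects of the completion there. *)
Record ses_sequence := SesSequence {
  ss1 : sequence A; ss2 : sequence A; ss3 : sequence A;
  ss_u : forall n, hom (ss1 n) (ss2 n);
  ss_v : forall n, hom (ss2 n) (ss3 n);
  ss_su : strict ss_u;
  ss_sv : strict ss_v;
  ss_conf : forall n, conf (ss_u n) (ss_v n);
  ss_c1 : cauchy (qi_seq ss1);
  ss_c2 : cauchy (qi_seq ss2);
  ss_c3 : cauchy (qi_seq ss3)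
}.

Section SesSequence.
Variable s : ses_sequence.

Definition ss_ses n : ses A := Ses (ss_conf s n).
Definition ss_mor n : ses_mor (ss_ses n) (ss_ses n.+1) :=
  @SesMor A (ss_ses n) (ss_ses n.+1) (seq_map (ss1 s) n) (seq_map (ss2 s) n)
    (seq_map (ss3 s) n) (esym (ss_su s n)) (esym (ss_sv s n)).

Definition ss_ts : triangle_sequence C :=
  @TriangleSequence C (fun n => qi_triangle F (ss_ses n))
    (fun n => qi_tri_mor F (ss_mor n)) (fun n => qi_triangle_exact F (ss_ses n))
    (ss_c1 s) (ss_c2 s) (ss_c3 s).

Lemma ss_coherent : ts_coherent ss_ts F.
Proof.
exists ss_ses, (fun n => qi_lift F (ss_ses n)), ss_mor; split=> n.
  exact: qi_lift_iso.
exact: qi_is_lift.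
Qed.

Definition ss_ob1 : Ch := CauchySequence (ss_c1 s).
Definition ss_ob2 : Ch := CauchySequence (ss_c2 s).
Definition ss_ob3 : Ch := CauchySequence (ss_c3 s).
Definition ss_f : @hom Ch ss_ob1 ss_ob2 :=
  level (X := ss_ob1) (Y := ss_ob2) (fun n => fmap G [ss_u s n]) (qi_strict (ss_su s)).
Definition ss_g : @hom Ch ss_ob2 ss_ob3 :=
  level (X := ss_ob2) (Y := ss_ob3) (fun n => fmap G [ss_v s n]) (qi_strict (ss_sv s)).
Definition ss_h : @hom Ch ss_ob3 (susp Ch ss_ob1) := tri_h (colimit_triangle ss_ts).

Lemma ss_exact : colimit_exact (Triangle ss_f ss_g ss_h).
Proof.
have -> : ss_f = tri_f (colimit_triangle ss_ts) by apply: (@level_eq C ss_ob1 ss_ob2).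
have -> : ss_g = tri_g (colimit_triangle ss_ts) by apply: (@level_eq C ss_ob2 ss_ob3).
exact: (colimit_exact_colimit ss_coherent).
Qed.

End SesSequence.

(** The connecting map is natural for strict morphisms of exact sequences; all relations
    of the octahedron that involve connecting maps are instances. *)
Lemma ss_h_nat (s s' : ses_sequence) (t : forall n, ses_mor (ss_ses s n) (ss_ses s' n))
    (x : @hom Ch (ss_ob1 s) (ss_ob1 s')) (z : @hom Ch (ss_ob3 s) (ss_ob3 s')) :
  (forall n, lim_pr x n = hom_in (Y := qi_seq (ss1 s')) (fmap G [ses_mor1 (t n)])) ->
  (forall n, lim_pr z n = hom_in (Y := qi_seq (ss3 s')) (fmap G [ses_mor3 (t n)])) ->
  fmap (susp Ch) x ∘ ss_h s = ss_h s' ∘ z.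
Proof.
move=> hx hz; apply: (@completion_eq C) => n.
rewrite (completion_compE (C := C) (n := n) (m := n) _ (ss_h s) (qi_w F (ss_ses s n)) (erefl _)).
rewrite (completion_compE (C := C) (n := n) (m := n) (ss_h s') z _ (hz n)).
rewrite [RHS](precompE (Y := seq_susp (qi_seq (ss1 s')))).
rewrite -[tri_h (ss_ts s' n) ∘ _](qi_triangle_mor_h F (t n)).
transitivity (precomp (qi_w F (ss_ses s n)) (colim_susp (lim_pr x n))) => //.
by rewrite hx colim_suspE; apply: (precompE (Y := seq_susp (qi_seq (ss1 s')))).
Qed.

Lemma realize (X : Ch) : exists (XX : sequence A) (cX : cauchy (qi_seq XX))
  (a : @hom Ch X (CauchySequence cX)), is_iso a.
Proof.
pose XX : sequence A := @Sequence A (fun n => F (X n)) (fun n => repr (fmap F (seq_map X n))).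
have eX n : [seq_map XX n] = fmap F (seq_map X n) := stable_classK _.
have [a ha] := dependent_choice (fun n => qi_full (F := F) (idm (F (X n)))).
have na n : a n.+1 ∘ seq_map X n = seq_map (qi_seq XX) n ∘ a n.
  apply: qi_faithful; rewrite !(fmapM F) !compA ha comp1m quasi_inverse_nat eX.
  by rewrite -compA ha compm1.
have ia n : is_iso (a n).
  apply: (equiv_iso (te_equiv F)); have [e [l r]] := qi_isoP F (F (X n)).
  exists (qi_iso F _); split; first exact: ha.
  by apply: (is_iso_mono (qi_isoP F _)); rewrite compA ha comp1m compm1.
have cX := @cauchy_iso C X (qi_seq XX) a na ia (cs_cauchy X).
by exists XX, cX, (level (X := X) (Y := CauchySequence cX) a na); apply: level_iso.
Qed.

(** Reindex the target, replace each component by an admissible monomorphism, and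
    strictify each square.  No recursion on n is needed: the correction changes only the
    transition map of the new target from n to n + 1, and not the monomorphisms. *)
Lemma realize_adm_mono (XX : sequence A) (cX : cauchy (qi_seq XX)) (Y : Ch)
    (u : @hom Ch (CauchySequence cX) Y) :
  exists (YY : sequence A) (cY : cauchy (qi_seq YY)) (uu : forall n, hom (XX n) (YY n))
    (su : strict uu) (b : @hom Ch Y (CauchySequence cY)),
  [/\ forall n, adm_mono (@conf A) (uu n), is_iso b
    & b ∘ u = level (X := CauchySequence cX) (Y := CauchySequence cY)
        (fun n => fmap G [uu n]) (qi_strict su)].
Proof.
have [Y' [g [f [hf [ig ->]]]]] := reindex_level u.
have hq n : exists q : hom (XX n : St A) (F (Y' n)), q ∘ qi_iso F _ = fmap F (f n).
  have [e [l r]] := qi_isoP F (XX n).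
  by exists (fmap F (f n) ∘ e); rewrite -compA l compm1.
have [p hp] := dependent_choice hq.
have ex n : exists (Yn : A) (un : hom (XX n) Yn) (q : @hom (St A) Yn (F (Y' n))),
    [/\ adm_mono (@conf A) un, q ∘ [un] = p n & is_iso q].
  have [pn epn] := stable_repr (p n).
  have [Yn [un [q [m qu iq]]]] := adm_mono_replace pn.
  by exists Yn, un, [q]; rewrite -stable_classM qu.
have [Yo {}ex] := dependent_choice ex.
have [uu {}ex] := dependent_choice ex.
have [q {}ex] := dependent_choice ex.
have mu n : adm_mono (@conf A) (uu n) by case: (ex n).
have qu n : q n ∘ [uu n] = p n by case: (ex n).
have iq n : is_iso (q n) by case: (ex n).
have [Zo hZ] := dependent_choice mu; have [v hv] := dependent_choice hZ.
have [y0 hy0] := dependent_choice (fun n => (iq n.+1 : exists _, _)).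
have step n : exists y : hom (Yo n) (Yo n.+1), uu n.+1 ∘ seq_map XX n = y ∘ uu n /\
    q n.+1 ∘ [y] = fmap F (seq_map Y' n) ∘ q n.
  have [y1 ey1] := stable_repr (y0 n ∘ (fmap F (seq_map Y' n) ∘ q n)).
  have qy1 : q n.+1 ∘ [y1] = fmap F (seq_map Y' n) ∘ q n.
    by rewrite ey1 compA (hy0 n).2 comp1m.
  have [|t [t1 t2]] := @ses_mor_strictify A (Ses (hv n)) (Ses (hv n.+1)) (seq_map XX n) y1.
    apply: (is_iso_mono (iq n.+1)); rewrite !compA qy1 /= qu -compA qu.
    apply: (is_iso_epi (qi_isoP F _)); rewrite -!compA hp -quasi_inverse_nat compA hp.
    by rewrite -!fmapM hf.
  exists (ses_mor2 t); rewrite t2 qy1; split=> //.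
  by have := ses_squ t; rewrite t1 /= => ->.
have [y hy] := dependent_choice step.
pose YY : sequence A := Sequence y.
have su : strict (X := XX) (Y := YY) uu by move=> n; case: (hy n).
have hb n : exists b : hom (Y' n) (G (Yo n)), q n ∘ (qi_iso F _ ∘ fmap F b) = idm _.
  have [r [rl rr]] := iq n; have [b eb] := qi_full (F := F) r.
  by exists b; rewrite eb rr.
have [b {}hb] := dependent_choice hb.
have iqq n : is_iso (q n ∘ qi_iso F (Yo n)) by apply: is_iso_comp (iq n) (qi_isoP F _).
have ib n : is_iso (b n).
  apply: (equiv_iso (te_equiv F)); exists (q n ∘ qi_iso F _); split.
    by rewrite -compA hb.
  apply: (is_iso_mono (iqq n)).
  by rewrite compA -(compA (q n) _ (fmap F (b n))) hb comp1m compm1.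
have nb n : b n.+1 ∘ seq_map Y' n = seq_map (qi_seq YY) n ∘ b n.
  apply: (equiv_faithful (te_equiv F)); apply: (is_iso_mono (iqq n.+1)).
  rewrite !(fmapM F) -!compA (compA (qi_iso F _) (fmap F (b n.+1))) (compA (q n.+1)) hb comp1m.
  rewrite (compA (qi_iso F _) (fmap F (fmap G _))) quasi_inverse_nat.
  by rewrite -compA compA (hy n).2 -compA hb compm1.
have cY := @cauchy_iso C Y' (qi_seq YY) b nb ib (cs_cauchy Y').
have [g' [gl gr]] := ig.
pose bl : @hom Ch Y' (CauchySequence cY) := level (X := Y') (Y := CauchySequence cY) b nb.
exists YY, cY, uu, su, (bl ∘ g'); split=> //.
  apply: is_iso_comp; first exact: level_iso.
  by exists g.
rewrite -[LHS]compA (compA g') gl comp1m.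
have [h ->] := @level_compP C (CauchySequence cX) Y' (CauchySequence cY) b nb f hf.
apply: (@level_eq C (CauchySequence cX) (CauchySequence cY)) => n.
apply: (equiv_faithful (te_equiv F)); apply: (is_iso_mono (iqq n)).
rewrite (fmapM F) -!compA (compA (qi_iso F _) (fmap F (b n))) compA hb comp1m.
by rewrite quasi_inverse_nat compA qu hp.
Qed.

(** Cokernels are functorial on strict squares. *)
Lemma ses_sequence_exists (XX YY : sequence A) (cX : cauchy (qi_seq XX))
    (cY : cauchy (qi_seq YY)) (u : forall n, hom (XX n) (YY n)) (su : strict u) :
  (forall n, adm_mono (@conf A) (u n)) ->
  exists (ZZ : sequence A) (cZ : cauchy (qi_seq ZZ)) (v : forall n, hom (YY n) (ZZ n))
    (sv : strict v), forall n, conf (u n) (v n).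
Proof.
move=> mu; have [Zo hZ] := dependent_choice mu; have [v hv] := dependent_choice hZ.
have ex n : exists z : hom (Zo n) (Zo n.+1), z ∘ v n = v n.+1 ∘ seq_map YY n.
  apply: (conf_desc (hv n)).
  by rewrite -compA -su compA (conf0 (hv n.+1)) comp0m.
have [z hz] := dependent_choice ex.
pose s n : ses_mor (Ses (hv n)) (Ses (hv n.+1)) :=
  @SesMor A (Ses (hv n)) (Ses (hv n.+1)) (seq_map XX n) (seq_map YY n) (z n)
    (esym (su n)) (hz n).
have cZ : cauchy (qi_seq (Sequence z)).
  apply: (@cauchy_third (fun n => qi_triangle F (Ses (hv n)))
    (fun n => qi_tri_mor F (s n)) _ cX cY).
  by move=> n; apply: qi_triangle_exact.
by exists (Sequence z), cZ, v, (fun n => esym (hz n)).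
Qed.

Lemma colimit_exact_cone (X Y : Ch) (f : hom X Y) :
  exists (Z : Ch) (g : hom Y Z) (h : hom Z (susp Ch X)), colimit_exact (Triangle f g h).
Proof.
have [XX [cX [a ia]]] := realize X; have [a' [al ar]] := ia.
have [YY [cY [u [su [b [mu ib eb]]]]]] := realize_adm_mono (f ∘ a').
have [ZZ [cZ [v [sv cf]]]] := ses_sequence_exists cX cY su mu.
pose s := SesSequence su sv cf cX cY cZ.
exists (ss_ob3 s), (ss_g s ∘ b), (fmap (susp Ch) a' ∘ ss_h s).
apply: colimit_exact_iso (ss_exact s); apply: tri_isomorphic_sym.
apply: (tri_isomorphicP ia ib (is_iso_idm _)).
- by rewrite -[ss_f s]eb -!compA al compm1.
- by rewrite comp1m.
- by rewrite compA -fmapM ar fmap1 comp1m compm1.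
Qed.

Lemma colimit_exact_id (X Z : Ch) : is_zero Z ->
  colimit_exact (Triangle (idm X) (0 : hom X Z) 0).
Proof.
move=> z; have [XX [cX [a ia]]] := realize X.
have mi n : adm_mono (@conf A) (idm (XX n)) by apply: adm_mono1.
have si : strict (X := XX) (Y := XX) (fun n => idm (XX n)).
  by move=> n; rewrite comp1m compm1.
have [ZZ [cZ [v [sv cf]]]] := ses_sequence_exists cX cX si mi.
pose s := SesSequence si sv cf cX cX cZ.
apply: colimit_exact_iso (ss_exact s); apply: tri_isomorphic_sym.
have zs : is_zero (ss_ob3 s).
  apply: is_zeroP; apply: (@completion_eq C) => n.
  have z0 : fmap G [idm (ZZ n)] = 0.
    rewrite -(fmap0 G) -stable_class0; congr (fmap G [_]).
    apply: (conf_epi (cf n)); rewrite comp0m comp1m.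
    by rewrite -[v n]compm1 (conf0 (cf n)).
  have z1 : idm (qi_seq ZZ n) = 0 by rewrite -z0 -(fmap1 G).
  rewrite /= /seq_id_pr z1; exact: (@hom_in0 C _ (qi_seq ZZ)).
apply: (@tri_isomorphicP Ch _ _ _ _ _ _ _ _ _ _ _ _ a a (0 : hom Z (ss_ob3 s))).
- exact: ia.
- exact: ia.
- by exists 0; split; [apply: zero_into z | apply: zero_into zs].
- have -> : ss_f s = idm _.
    apply: (@completion_eq C) => n.
    exact: (congr1 (@hom_in C _ (qi_seq XX) n) (fmap1 G (XX n))).
  by rewrite comp1m compm1.
- exact: zero_into zs.
- by rewrite compm0 compm0.
Qed.

(** Realize u and v by composable strict sequences of admissible monomorphisms; the
    conflations of u, v, v u and the Noether conflation of the cokernels form the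
    octahedron, and its relations are naturality of the connecting maps along the
    evident morphisms between these four conflations. *)
Lemma colimit_exact_octahedron (X Y Z : Ch) (u : hom X Y) (v : hom Y Z) :
  exists (X1 Y1 Z1 : Ch) (u1 : hom X1 Y1) (v1 : hom Y1 Z1)
    (a : hom X X1) (b : hom Y Y1) (c : hom Z Z1),
  [/\ is_iso a, is_iso b & is_iso c] /\
  [/\ b ∘ u = u1 ∘ a, c ∘ v = v1 ∘ b & octahedron colimit_exact u1 v1].
Proof.
have [XX [cX [a ia]]] := realize X; have [a' [al ar]] := ia.
have [YY [cY [uu [su [b [mu ib eb]]]]]] := realize_adm_mono (u ∘ a').
have [b' [bl br]] := ib.
have [ZZ [cZ [vv [sv [c [mv ic ec]]]]]] := realize_adm_mono (v ∘ b').
have [UU [cU [i [si cfu]]]] := ses_sequence_exists cX cY su mu.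
have [VV [cV [j [sj cfv]]]] := ses_sequence_exists cY cZ sv mv.
have svu : strict (X := XX) (Y := ZZ) (fun n => vv n ∘ uu n).
  by move=> n; rewrite -compA su !compA sv.
have mvu n : adm_mono (@conf A) (vv n ∘ uu n) by apply: adm_monoM.
have [WW [cW [k [sk cfw]]]] := ses_sequence_exists cX cZ svu mvu.
have exf n : exists f : hom (UU n) (WW n), f ∘ i n = k n ∘ vv n.
  by apply: (conf_desc (cfu n)); rewrite -compA (conf0 (cfw n)).
have [f hf] := dependent_choice exf.
have exg n : exists g : hom (WW n) (VV n), g ∘ k n = j n.
  by apply: (conf_desc (cfw n)); rewrite compA (conf0 (cfv n)) comp0m.
have [g hg] := dependent_choice exg.
have cfn n : conf (f n) (g n) := noether_conf (cfu n) (cfv n) (cfw n) (hf n) (hg n).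
have sf : strict (X := UU) (Y := WW) f.
  move=> n; apply: (conf_epi (cfu n)).
  by rewrite -!compA hf -si !compA hf -sk -!compA sv.
have sg : strict (X := WW) (Y := VV) g.
  by move=> n; apply: (conf_epi (cfw n)); rewrite -!compA hg -sk !compA hg sj.
pose sU := SesSequence su si cfu cX cY cU.
pose sV := SesSequence sv sj cfv cY cZ cV.
pose sW := SesSequence svu sk cfw cX cZ cW.
pose sN := SesSequence sf sg cfn cU cW cV.
exists (ss_ob1 sU), (ss_ob1 sV), (ss_ob2 sV), (ss_f sU), (ss_f sV), a, b, c.
split=> //; split.
- by rewrite -[ss_f sU]eb -!compA al compm1.
- by rewrite -[ss_f sV]ec -!compA bl compm1.
have evu : ss_f sV ∘ ss_f sU = ss_f sW.
  apply: (@level_comp C (ss_ob1 sU) (ss_ob1 sV) (ss_ob2 sV)) => n.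
  by rewrite -fmapM -stable_classM.
exists (ss_ob3 sV), (ss_ob3 sW), (ss_ob3 sU), (ss_g sU), (ss_h sU), (ss_g sV), (ss_h sV),
  (ss_g sW), (ss_h sW), (ss_f sN), (ss_g sN).
have G1 (P : A) : fmap G [idm P] = idm _ := fmap1 G P.
have in1 (W : sequence A) n : hom_in (Y := qi_seq W) (fmap G [idm (W n)]) =
    hom_in (Y := qi_seq W) (idm (qi_seq W n)) by congr (hom_in _); apply: G1.
have one (P Q : A) (q : hom P Q) : q ∘ idm P = idm Q ∘ q by rewrite comp1m compm1.
have e1 n : k n ∘ vv n = f n ∘ i n by rewrite hf.
have e2 n : idm (VV n) ∘ j n = g n ∘ k n by rewrite comp1m hg.
have e3 n : vv n ∘ uu n = (vv n ∘ uu n) ∘ idm (XX n) by rewrite compm1.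
have e4 n : idm (ZZ n) ∘ (vv n ∘ uu n) = vv n ∘ uu n by rewrite comp1m.
have e5 n : g n ∘ k n = j n ∘ idm (ZZ n) by rewrite compm1 hg.
split; [exact: ss_exact | exact: ss_exact | by rewrite evu; exact: (ss_exact sW) | split].
- have h1 : fmap (susp Ch) (ss_g sU) ∘ ss_h sV = ss_h sN ∘ idm (ss_ob3 sV : Ch).
    apply: (@ss_h_nat sV sN (fun n =>
      @SesMor A (ss_ses sV n) (ss_ses sN n) _ _ _ (e1 n) (e2 n))) => // n.
    exact/esym/(in1 VV).
  by rewrite h1 compm1; exact: (ss_exact sN).
- by apply: (@level_square C (ss_ob2 sU) (ss_ob3 sU) (ss_ob2 sW) (ss_ob3 sW)) => n;
    rewrite -!fmapM -!stable_classM hf.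
- have h3 : fmap (susp Ch) (idm (ss_ob1 sU : Ch)) ∘ ss_h sU = ss_h sW ∘ ss_f sN.
    apply: (@ss_h_nat sU sW (fun n =>
      @SesMor A (ss_ses sU n) (ss_ses sW n) _ _ _ (e3 n) (hf n))) => // n.
    exact/esym/(in1 XX).
  by rewrite fmap1 comp1m in h3; rewrite h3.
- apply: (@level_comp C (ss_ob2 sW) (ss_ob3 sW) (ss_ob3 sV)) => n.
  by rewrite -fmapM -stable_classM hg.
- apply/esym.
  by apply: (@ss_h_nat sW sV (fun n => @SesMor A (ss_ses sW n) (ss_ses sV n) _ _ _ (e4 n) (e5 n))).
Qed.

Lemma colimit_exact_triangulated : phantomless C -> triangulated colimit_exact.
Proof.
move=> hC; apply: pretriangulated_triangulated.
- split.
  + exact: completion_additive (triang_additive (tri_catP C)).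
  + exact: completion_susp_equiv.
  + exact: colimit_exact_iso.
  + exact: colimit_exact_id.
  + exact: colimit_exact_rot.
  + exact: colimit_exact_fill.
- exact: colimit_exact_cone.
- exact: colimit_exact_octahedron.
Qed.

End Main.

Theorem theorem4p7 (C : triangulated_category) (A : frobenius_category)
    (F : triangle_equivalence C A) (hC : phantomless C) :
  exists! E : triangle (suspended_completion C) -> Prop,
    triangulated E /\
    (forall T : triangle (suspended_completion C),
       E T <-> exists S : triangle_sequence C,
                 ts_coherent S F /\ tri_isomorphic T (colimit_triangle S)).
Proof.
exists (colimit_exact F); split; first by split=> //; apply: colimit_exact_triangulated.
move=> E [_ hE]; apply/funext => T; apply/propext; apply: iff_sym; exact: hE.
Qed.
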